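(* Let $0<c_1<c_2<\dots<c_m$ be constants and let $\mu>0$, $\nu>0$, $\rho>0$ be arbitrary. Then there exist positive constants $\tilde C_\mu,\hat C_\nu,\dot C_\rho$, independent of $T$, such that for every $T>0$, all $F,G,H\in C^\infty(\mathbb{R}^2\times[0,T))$, every $i\in\{1,\dots,m\}$ and every $(x,t)\in\mathbb{R}^2\times[0,T)$, $$|L_{c_i}(F)(x,t)|\,(1+|x|)^{1/2}\le\tilde C_\mu\,M^{(i)}_{\mu,0}(F)(x,t)$$ and $$|\nabla L_{c_i}(G+H)(x,t)|\,(1+|x|)^{1/2}\,(1+||x|-c_it|)\le\hat C_\nu\,M^{(i)}_{\nu,0}(G)(x,t)+\dot C_\rho\{1+\log(1+t+|x|)\}\,M^{(i)}_{0,\rho}(H)(x,t),$$ where $\nabla=(\partial_1,\partial_2)$.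
   Context: For $c>0$ and $F\in C^\infty(\mathbb{R}^2\times[0,T))$, $$L_c(F)(x,t)=\frac1{2\pi c}\int_0^t\Big(\int_{|x-y|<c(t-s)}\frac{F(y,s)}{\sqrt{c^2(t-s)^2-|x-y|^2}}\,dy\Big)ds,$$ which is the solution of $(\partial_0^2-c^2\Delta)L_c(F)=F$ on $\mathbb{R}^2\times[0,T)$ with zero initial data ($\partial_0=\partial_t$). Set $c_0=0$, $c_*=\frac13\min_{1\le i\le m}\{c_i-c_{i-1}\}$, and $$\Lambda_j(T)=\{(x,t)\in\mathbb{R}^2\times[0,T):\ ||x|-c_jt|\le c_*t\}\ (j=1,\dots,m),\qquad \Lambda_0(T)=\mathbb{R}^2\times[0,T)\setminus\bigcup_{j=1}^m\Lambda_j(T).$$ Let $\Gamma=(\Gamma_0,\dots,\Gamma_4)=(\partial_0,\partial_1,\partial_2,\Omega,S)$ with $\Omega=x_1\partial_2-x_2\partial_1$, $S=t\partial_0+x_1\partial_1+x_2\partial_2$; $\Gamma^a=\Gamma_0^{a_0}\cdots\Gamma_4^{a_4}$ and $|a|=a_0+\dots+a_4$ for a multi-index $a$. For a scalar function $F$, $|F(y,s)|_1=\sum_{|a|\le1}|\Gamma^aF(y,s)|$. For $\mu,\nu\ge0$ and $i\in\{1,\dots,m\}$, $$M^{(i)}_{\mu,\nu}(F)(x,t)=\sum_{j=0}^m\ \sup_{(y,s)\in\Lambda_j(T)\cap D^i(x,t)}\big\{|y|^{1/2}z^{(j)}_{\mu,\nu}(|y|,s)\,|F(y,s)|_1\big\},$$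 $$z^{(j)}_{\mu,\nu}(\lambda,s)=(1+s+\lambda)^{1+\mu}(1+|\lambda-c_js|)^{1+\nu},\qquad D^i(x,t)=\{(y,s):\ |x-y|\le c_i(t-s)\},$$ where the supremum over an empty set is $0$. *)

(* Defs.v *)
From mathcomp Require Import all_boot all_order all_algebra.
From mathcomp Require Import all_classical all_reals all_analysis.

Set Implicit Arguments.
Unset Strict Implicit.
Unset Printing Implicit Defensive.

Import Order.TTheory GRing.Theory Num.Theory.
Import numFieldNormedType.Exports.

Local Open Scope classical_set_scope.
Local Open Scope ring_scope.

Section Wave2D.
Context {R : realType}.

(* A point of R^2 x R is p = (x, t) = ((x_1, x_2), t). *)
Notation plane := (R * R)%type.
Notation spacetime := ((R * R) * R)%type.

Implicit Types (F : spacetime -> R) (p : spacetime) (x : plane).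

(* Euclidean norm: the library norm of R * R is the max norm. *)
Definition enorm x : R := Num.sqrt (x.1 ^+ 2 + x.2 ^+ 2).

Definition slab (T : R) : set spacetime := [set p | 0 <= p.2 < T].

(* Functions on R^2 x [0,T) are total functions whose values outside the slab
   are irrelevant. At t = 0 the time derivative is therefore one-sided: the
   increments h range over those with 0 <= t + h (the constraint t + h < T
   always holds for small h). *)
Definition time_incr (t : R) : set_system R :=
  within [set h | 0 <= t + h] (0 : R)^'.

Definition diff_quot0 F p (h : R) : R := (F (p.1, p.2 + h) - F p) / h.

Definition derivable0 F p := cvg (diff_quot0 F p h @[h --> time_incr p.2]).

Definition d0 F p : R := lim (diff_quot0 F p h @[h --> time_incr p.2]).

Definition e1 : spacetime := ((1, 0), 0).
Definition e2 : spacetime := ((0, 1), 0).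

Definition d1 F p : R := 'D_e1 F p.
Definition d2 F p : R := 'D_e2 F p.

Fixpoint diffn (T : R) (n : nat) F : Prop :=
  {within slab T, continuous F} /\
  if n is k.+1 then
    (forall p, slab T p ->
       [/\ derivable0 F p, derivable F p e1 & derivable F p e2]) /\
    [/\ diffn T k (d0 F), diffn T k (d1 F) & diffn T k (d2 F)]
  else True.

(* C^oo(R^2 x [0,T)): smooth up to and including t = 0. *)
Definition smooth (T : R) F : Prop := forall n, diffn T n F.

Definition rotation F p : R := p.1.1 * d2 F p - p.1.2 * d1 F p.

Definition scaling F p : R :=
  p.2 * d0 F p + p.1.1 * d1 F p + p.1.2 * d2 F p.

Definition Gamma (k : 'I_5) : (spacetime -> R) -> spacetime -> R :=
  match val k with
  | 0%N => d0
  | 1%N => d1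
  | 2%N => d2
  | 3%N => rotation
  | _ => scaling
  end.

(* Gamma_0^{a_0} ... Gamma_4^{a_4}, as a composition of operators. *)
Definition Gamma_mono (a : 'I_5 -> nat) F : spacetime -> R :=
  foldr (fun k G => iter (a k) (Gamma k) G) F (enum 'I_5).

(* |F(p)|_n, the sum over |a| <= n; each a_k is then at most n. *)
Definition Gamma_norm (n : nat) F p : R :=
  \sum_(a : {ffun 'I_5 -> 'I_n.+1} | (\sum_k a k <= n)%N)
     `|Gamma_mono (fun k => a k : nat) F p|.

Definition Lwave (c : R) F p : R :=
  (2 * pi * c)^-1 *
  Rintegral lebesgue_measure `[0, p.2] (fun s =>
    Rintegral (lebesgue_measure \x lebesgue_measure)%E
      [set y | enorm (p.1 - y) < c * (p.2 - s)]
      (fun y => F (y, s) /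
         Num.sqrt (c ^+ 2 * (p.2 - s) ^+ 2 - enorm (p.1 - y) ^+ 2))).

Definition grad_norm F p : R := enorm (d1 F p, d2 F p).

(* The speeds are c 1 < ... < c m, with c 0 = 0. In cstar the seed of the
   minimum is its term of index 1, so it adds nothing when 1 <= m. *)
Definition cstar (c : nat -> R) (m : nat) : R :=
  3^-1 * \big[Num.min/(c 1%N - c 0%N)]_(1 <= i < m.+1) (c i - c i.-1).

Definition cone_nbhd (c : nat -> R) (m : nat) (T : R) (j : nat) :
    set spacetime :=
  [set p | slab T p /\ `|enorm p.1 - c j * p.2| <= cstar c m * p.2].

Definition Lambda (c : nat -> R) (m : nat) (T : R) (j : nat) : set spacetime :=
  if j is 0%N
  then slab T `\` \bigcup_(k in [set k | (1 <= k <= m)%N]) cone_nbhd c m T k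
  else cone_nbhd c m T j.

Definition zweight (c : nat -> R) (j : nat) (mu nu lambda s : R) : R :=
  (1 + s + lambda) `^ (1 + mu) * (1 + `|lambda - c j * s|) `^ (1 + nu).

Definition Dcone (ci : R) p : set spacetime :=
  [set q | enorm (p.1 - q.1) <= ci * (p.2 - q.2)].

(* [sup set0 = 0] in the library. *)
Definition Mnorm (c : nat -> R) (m : nat) (T : R) (i : nat) (mu nu : R) F p
    : R :=
  \sum_(0 <= j < m.+1)
    sup [set Num.sqrt (enorm q.1) * zweight c j mu nu (enorm q.1) q.2
             * Gamma_norm 1 F q
        | q in Lambda c m T j `&` Dcone (c i) p].

End Wave2D.

(* Main.v *)
Require Import Defs.
From HB Require Import structures.
From mathcomp Require Import all_boot all_order all_algebra.
From mathcomp Require Import all_classical all_reals all_analysis.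
Set Implicit Arguments.
Unset Strict Implicit.
Unset Printing Implicit Defensive.
From mathcomp Require Import measurable_realfun ring lra.
Import Order.TTheory GRing.Theory Num.Theory.
Import numFieldNormedType.Exports.
Local Open Scope classical_set_scope.
Local Open Scope ring_scope.

(* With [y = x - c (t - s) w] and [w = (sin th, cos th * sin ch)] the singular
   kernel of [Lwave] becomes the smooth weight [(t - s) cos th], so that [Lwave]
   is an integral of a continuous function over a box and commutes with space
   derivatives. Put [r = |x|] and [C = c t]. At the points of the cone,
     (r^2 - C^2) grad F = (x + C w) (S F) + (x - C w)^perp (Omega F) + remainder,
   where the remainder only involves derivatives of [F] tangential to the cone.
   Integrating them by parts bounds [|r - C| |grad (Lwave F)|] by the integral of
   [(t - s) (|S F| + |Omega F|) + 4 t |F|] against [cos th].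

   Hence everything reduces to the integral over the backward cone, with the
   extra factor [1 + t / (t - s)], of the wave kernel against the weights
     |y|^(-1/2) (1 + s + |y|)^(-1-e) (1 + ||y| - a s|)^(-1-k).
   In polar coordinates [l = |y|] the angular integral is at most
     (1 + r)^(-1/2) l^(-1/2) (1 + ((1 + l) / |r + l - c (t - s)|)^(3/4))
   up to a constant, and for fixed [q = l - a s] the last singularity is
   integrable in [s]. Integrating in [s], then in [q], leaves a constant if
   [0 < e] and a logarithm if [e = 0]. *)

(** * Densities and changes of variables *)

(** The vectors in the gradient identity only produce (x + C w) . (x - C w) = r^2 - C^2 |w|^2, and
    |w| < 1 inside the disc. The missing C^2 (1 - |w|^2), with 1 - |w|^2 = (cos th cos ch)^2, is
    absorbed by further derivatives in the two angles. All coefficients are controlled by r + C, so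
    this factor of r^2 - C^2 divides out and |r - C| remains. Integration by parts leaves terms 4 t
    |F| without the factor t - s of the kernel: hence the extra factor 1 + t / (t - s), whose
    singularity at the apex forces a separate bound for t - s < 1. The exponent 3/4 is 1/2 + 1/4.
    The fourth root is lost where two inverse square roots of the angular integral merge, the square
    root where r^(-1/2) is replaced, for small r, by a power of the gap |r + l - c (t - s)|. A total
    below 1 keeps the singularity integrable in time. A weight whose second exponent is exactly 1 is
    not integrable in q, so half of mu or nu is first transferred to it. *)

Section density.
Local Open Scope ereal_scope.
Context d (T : measurableType d) (R : realType) (mu : {measure set T -> \bar R}).
Variable f : T -> R.
Hypotheses (mf : measurable_fun setT f) (f0 : forall x, (0 <= f x)%R).

Definition density (A : set T) : \bar R := \int[mu]_(x in A) (f x)%:E.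

Let density0 : density set0 = 0. Proof. exact: integral_set0. Qed.

Let density_ge0 A : 0 <= density A.
Proof. by apply: integral_ge0 => x _; rewrite lee_fin. Qed.

Let density_sigma_additive : semi_sigma_additive density.
Proof.
move=> F mF tF mUF; rewrite /density; apply: cvg_toP.
  apply: ereal_nondecreasing_is_cvgn => m n mn.
  by apply: lee_sum_nneg_natr => // k _ _; exact: density_ge0.
rewrite ge0_integral_bigcup//=.
- by apply/measurable_EFinP; exact: measurable_funTS.
- by move=> x _; rewrite lee_fin.
Qed.

HB.instance Definition _ := isMeasure.Build _ _ _ density
  density0 density_ge0 density_sigma_additive.

Import HBNNSimple.

(** Both integrals pass to the limit along simple approximations of [g] by monotone convergence and
    are additive on nonnegative functions, so only indicators have to be compared. *)
Lemma ge0_integral_density (g : T -> \bar R) :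
  measurable_fun setT g -> (forall x, 0 <= g x) ->
  \int[density]_x g x = \int[mu]_x (g x * (f x)%:E).
Proof.
move=> mg g0; pose g_ := nnsfun_approx measurableT mg.
have mfE : measurable_fun setT (EFin \o f) by exact: measurableT_comp.
have f0E x : 0 <= (f x)%:E by rewrite lee_fin.
transitivity (limn (fun n => \int[density]_x (g_ n x)%:E)).
  rewrite -monotone_convergence//=.
  - apply: eq_integral => x _; apply/esym/cvg_lim => //=.
    exact: cvg_nnsfun_approx.
  - by move=> n; exact/measurable_EFinP/measurable_funTS.
  - by move=> n x _; rewrite lee_fin.
  - by move=> x _ m n mn; rewrite lee_fin; exact/lefP/nd_nnsfun_approx.
transitivity (limn (fun n => \int[mu]_x ((g_ n x)%:E * (f x)%:E))); last first.
  rewrite -monotone_convergence//=.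
  - apply: eq_integral => x _; apply/cvg_lim => //=.
    apply: cvgeZr => //; exact: cvg_nnsfun_approx.
  - move=> n; apply: emeasurable_funM => //.
    exact/measurable_EFinP/measurable_funTS.
  - by move=> n x _; rewrite mule_ge0// lee_fin.
  - move=> x _ m n mn; rewrite lee_wpmul2r// lee_fin.
    exact/lefP/nd_nnsfun_approx.
apply: congr_lim; apply/funext => n.
under [LHS]eq_integral do rewrite fimfunE -fsumEFin//.
rewrite [LHS]ge0_integral_fsum//=; last 2 first.
  - by move=> y; exact/measurable_EFinP/measurable_funM.
  - by move=> y x _; rewrite nnfun_muleindic_ge0.
under [RHS]eq_integral.
  move=> x _; rewrite fimfunE -fsumEFin// ge0_mule_fsuml; last first.
    by move=> y; rewrite nnfun_muleindic_ge0.
  over.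
rewrite [RHS]ge0_integral_fsum//=; last 2 first.
  - move=> y; apply: emeasurable_funM => //.
    exact/measurable_EFinP/measurable_funM.
  - by move=> y x _; rewrite mule_ge0// nnfun_muleindic_ge0.
apply: eq_fsbigr => y _.
rewrite integralZl_indic_nnsfun// integral_indic//= setIT.
have [y0|y0] := ltP y 0%R.
  rewrite preimage_nnfun0// measure0 mule0 integral0_eq// => x _.
  by rewrite indicE memNset// mulr0 mul0e.
rewrite /density integral_mkcond -ge0_integralZl//=; last 2 first.
  - apply/measurable_restrict => //.
    by rewrite setTI; exact: measurable_funTS.
  - by move=> x _; rewrite patchE; case: ifP.
apply: eq_integral => x _; rewrite patchE indicE EFinM -muleA.
by case: (x \in _); rewrite ?mul1e// mul0e.
Qed.

End density.

Lemma eq_integral_support d (T : measurableType d) (R : realType)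
    (mu : {measure set T -> \bar R}) (D E : set T) (f : T -> \bar R) :
  (forall x, D x -> ~ E x -> f x = 0%E) ->
  (forall x, E x -> ~ D x -> f x = 0%E) ->
  (\int[mu]_(x in D) f x = \int[mu]_(x in E) f x)%E.
Proof.
move=> DE ED; rewrite integral_mkcond [RHS]integral_mkcond.
apply: eq_integral => x _; rewrite !patchE.
have [xD|xD] := boolP (x \in D); have [xE|xE] := boolP (x \in E) => //.
- by rewrite inE in xD; rewrite notin_setE in xE; exact: DE.
- by rewrite inE in xE; rewrite notin_setE in xD; rewrite ED.
Qed.

Section change_of_variables.
Context {R : realType}.
Local Notation mu := (@lebesgue_measure R).

Lemma is_derive_continuous (phi dphi : R -> R) :
  (forall x : R, is_derive x (1 : R) phi (dphi x)) -> continuous phi.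
Proof.
by move=> dp x; apply/differentiable_continuous/derivable1_diffP; case: (dp x).
Qed.

Lemma integral_is_derive (phi dphi : R -> R) (a b : R) :
  a <= b -> (forall x : R, is_derive x (1 : R) phi (dphi x)) -> continuous dphi ->
  (\int[mu]_(x in `[a, b]) (dphi x)%:E = (phi b - phi a)%:E)%E.
Proof.
rewrite le_eqVlt => /predU1P[<-|ab] dp cd.
  by rewrite set_itv1 integral_set1 subrr.
have cp := is_derive_continuous dp.
rewrite (continuous_FTC2 (F := phi) ab) ?EFinB//.
- exact: continuous_subspaceT.
- split; first by move=> x _; case: (dp x).
  + exact/cvg_at_right_filter/cp.
  + exact/cvg_at_left_filter/cp.
- by move=> x _; rewrite derive1E; apply: derive_val.
Qed.

Section sub.
Variables (phi dphi : R -> R) (a b : R).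
Hypotheses (ab : a < b) (dp : forall x : R, is_derive x (1 : R) phi (dphi x))
  (cd : continuous dphi) (d0 : forall x, a <= x <= b -> 0 <= dphi x)
  (ip : {in `[a, b] &, {homo phi : x y / x < y}}).

Let cp : continuous phi := is_derive_continuous dp.

Let mphi : measurable_fun [set: measurableTypeR R] (phi : _ -> measurableTypeR R).
Proof. exact: continuous_measurable_fun. Qed.

Let f := dphi \_ `[a, b].

Let mf : measurable_fun [set: measurableTypeR R] f.
Proof.
apply/measurable_restrict => //.
by rewrite setTI; apply: measurable_funTS; exact: continuous_measurable_fun.
Qed.

Let f0 x : 0 <= f x.
Proof.
by rewrite /f patchE; case: ifPn => // /[!inE]/=; rewrite in_itv/=; exact: d0.
Qed.

Let m1_pushforward : {measure set (measurableTypeR R) -> \bar R}.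
Proof.
pose m := (pushforward (density mu f : {measure set _ -> \bar R})
  (phi : _ -> measurableTypeR R) : {measure set _ -> \bar R}).
exact: (m mf f0 mphi).
Defined.

Let phi_lt x y : a <= x <= b -> a <= y <= b -> (phi x < phi y) = (x < y).
Proof.
move=> xab yab; have [xy|yx|->] := ltgtP x y; last by rewrite ltxx.
- by apply: ip => //; rewrite in_itv.
- by apply/negbTE; rewrite -leNgt ltW//; apply: ip => //; rewrite in_itv.
Qed.

(** Two finite measures that agree on the rays []-oo, q[] agree. For [phi a < q <= phi b] the
    preimage of the ray in [[a, b]] is [[a, c[] with [phi c = q], and the fundamental theorem of
    calculus gives it the mass [q - phi a]. *)
Lemma change_of_variables_measure (A : set R) : measurable A ->
  A `<=` `[phi a, phi b] -> density mu f (phi @^-1` A) = mu A.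
Proof.
move=> mA AD.
have mD : measurable (`[phi a, phi b] : set (measurableTypeR R)) by [].
have aab : a <= a <= b by rewrite lexx ltW.
have bab : a <= b <= b by rewrite lexx ltW.
have pab : phi a < phi b by rewrite phi_lt.
pose m1 := m1_pushforward.
pose m2 : {measure set (measurableTypeR R) -> \bar R} := mrestr mu mD.
have m1E (B : set R) : measurable B ->
    m1 B = (\int[mu]_(x in `[a, b] `&` phi @^-1` B) (dphi x)%:E)%E.
  move=> mB; rewrite /m1 /= /pushforward /density integral_mkcondl.
  by apply: eq_integral => x _; rewrite /f !patchE; case: ifP.
suff -> : density mu f (phi @^-1` A) = m2 A.
  by rewrite /m2 /= /mrestr setIidl.
rewrite -[LHS]/(m1 A).
apply: (@measure_unique _ _ (measurableTypeR R)
  (@RGenInftyO.G R) (fun n => `]-oo, n%:R[%classic)) => //.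
- exact: RGenInftyO.measurableE.
- move=> _ _ [x ->] [y ->]; exists (Num.min x y).
  by apply/seteqP; split => z /=; rewrite !in_itv/= lt_min => /andP.
- by move=> n; exists n%:R.
- apply/seteqP; split => // x _ /=.
  exists (Num.trunc `|x|).+1 => //=; rewrite in_itv/=.
  by rewrite (le_lt_trans (ler_norm x))// truncnS_gt.
- move=> _ [q ->]; rewrite m1E// /m2 /= /mrestr.
  have [qa|aq] := leP q (phi a).
    rewrite (_ : _ `&` _ = set0) ?integral_set0; last first.
      rewrite -subset0 => x /=; rewrite !in_itv/= => -[xab].
      apply/negP; rewrite -leNgt (le_trans qa)// leNgt phi_lt// -leNgt.
      by case/andP: xab.
    rewrite (_ : _ `&` _ = set0) ?measure0// -subset0 => x /=.
    by rewrite !in_itv/= => -[xq /andP[ax _]]; move: (lt_le_trans xq qa); rewrite ltNge ax.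
  have [bq|qb] := ltP (phi b) q.
    rewrite setIidl; last first.
      move=> x /=; rewrite !in_itv/= => xab; rewrite (le_lt_trans _ bq)//.
      by rewrite leNgt phi_lt// -leNgt; case/andP: xab.
    rewrite setIidr; last first.
      by move=> x /=; rewrite !in_itv/= => /andP[_ xb]; rewrite (le_lt_trans xb).
    by rewrite (integral_is_derive (ltW ab) dp cd) lebesgue_measure_itv/= lte_fin pab.
  have [c] : exists2 c, c \in `[a, b] & phi c = q.
    apply: IVT; [exact: ltW|exact: continuous_subspaceT|].
    by rewrite ge_min le_max (ltW aq) qb orbT.
  rewrite in_itv/= => cab cq.
  rewrite (_ : _ `&` _ = `[a, c[%classic); last first.
    apply/seteqP; split => x /=; rewrite !in_itv/=.
      by rewrite -cq => -[xab]; rewrite phi_lt// => ->; case/andP: xab => ->.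
    move=> /andP[ax xc]; have xab : a <= x <= b.
      by rewrite ax (le_trans (ltW xc))//; case/andP: cab.
    by split => //; rewrite -cq phi_lt.
  rewrite (_ : _ `&` _ = `[phi a, q[%classic); last first.
    apply/seteqP; split => x /=; rewrite !in_itv/=.
      by move=> [-> /andP[->]].
    by move=> /andP[-> xq]; rewrite xq (ltW (lt_le_trans xq qb)).
  rewrite lebesgue_measure_itv/= lte_fin aq -cq integral_itv_bndo_bndc; last first.
    by apply/measurable_EFinP/measurable_funTS; exact: continuous_measurable_fun.
  by rewrite (integral_is_derive _ dp cd)//; case/andP: cab.
- move=> n; rewrite m1E//.
  apply: (@le_lt_trans _ _ (\int[mu]_(x in `[a, b]) (dphi x)%:E)%E); last first.
    by rewrite (integral_is_derive (ltW ab) dp cd) ltry.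
  apply: ge0_subset_integral => //=.
  - apply: measurableI => //; rewrite -[X in measurable X]setTI; exact: mphi.
  - by apply/measurable_EFinP/measurable_funTS; exact: continuous_measurable_fun. 
Qed.

(** The integrand is only measurable and [dphi] may vanish: in the applications [g] is singular, and
    the derivatives of [b * sin x] and [x ^+ 4] vanish at endpoints of the interval. *)
Lemma ge0_change_of_variables (g : R -> \bar R) :
  measurable_fun [set: measurableTypeR R] g -> (forall x, (0 <= g x)%E) ->
  (\int[mu]_(x in `[phi a, phi b]) g x =
   \int[mu]_(x in `[a, b]) (g (phi x) * (dphi x)%:E))%E.
Proof.
move=> mg g0.
pose m1 := m1_pushforward.
have mD : measurable (`[phi a, phi b] : set (measurableTypeR R)) by [].
rewrite -(@eq_measure_integral _ _ _ _ _ m1); last first.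
  by move=> A mA AD; exact: change_of_variables_measure.
rewrite ge0_integral_pushforward//=; last exact: measurable_funTS.
rewrite integral_mkcond ge0_integral_density//=; last 2 first.
- apply/measurable_restrict => //; last first.
    rewrite setTI; apply: measurable_funTS.
    by apply: (measurableT_comp mg); exact: mphi.
  by rewrite -[X in measurable X]setTI; exact: mphi.
- by move=> x; rewrite patchE; case: ifP => /=.
rewrite [RHS]integral_mkcond.
apply: eq_integral => x _; rewrite /f !patchE.
case: ifPn => [|xD]; case: ifPn => xab//=; rewrite ?mule0 ?mul0e//.
exfalso; move: xD; rewrite notin_setE; apply => /=.
move: xab; rewrite inE/= !in_itv/= => xab.
by rewrite (leNgt (phi a)) (leNgt (phi x)) !phi_lt -?leNgt ?lexx ?(ltW ab).
Qed.

End sub.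
End change_of_variables.

(** * Invariance of Lebesgue measure under translations, reflections, shears and rotations *)

Section plane.
Context {R : realType}.
Local Notation mu := (@lebesgue_measure R).
Local Notation mu2 := (mu \x mu)%E.
Implicit Types (f : R * R -> \bar R) (g : R -> \bar R).

Lemma lebesgue_measure_addr (b : R) (A : set R) : measurable A ->
  pushforward mu ((fun x => x + b) : _ -> measurableTypeR R) A = mu A.
Proof.
have mb : measurable_fun [set: measurableTypeR R]
    ((fun x => x + b) : _ -> measurableTypeR R).
  by apply: measurable_funD.
pose m := (pushforward mu ((fun x => x + b) : _ -> measurableTypeR R) :
  {measure set (measurableTypeR R) -> \bar R}).
move=> mA; apply/esym/(@lebesgue_measure_unique _ (m mb)) => //= _ [[p q]] _ <-.
rewrite /pushforward (_ : _ @^-1` _ = `]p - b, q - b]%classic); last first.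
  by apply/seteqP; split => x /=; rewrite !in_itv/= ltrBlDr lerBrDr.
by rewrite !lebesgue_measure_itv/= !lte_fin ltrD2r -!EFinB opprB addrA subrK.
Qed.

Lemma integral_addr (b : R) g : measurable_fun setT g -> (forall x, 0 <= g x)%E ->
  (\int[mu]_x g (x + b)%R = \int[mu]_x g x)%E.
Proof.
move=> mg g0.
have mb : measurable_fun [set: measurableTypeR R]
    ((fun x => x + b) : _ -> measurableTypeR R).
  by apply: measurable_funD.
pose m := (pushforward mu ((fun x => x + b) : _ -> measurableTypeR R) :
  {measure set (measurableTypeR R) -> \bar R}).
rewrite -[RHS](@eq_measure_integral _ _ _ _ mu (m mb)); last first.
  by move=> A mA _; exact: lebesgue_measure_addr.
by rewrite ge0_integral_pushforward.
Qed.

Lemma ge0_integralZlT d (T : measurableType d) (m : {measure set T -> \bar R})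
    (k : R) (f : T -> \bar R) :
  measurable_fun setT f -> (forall x, 0 <= f x)%E -> 0 <= k ->
  (\int[m]_x (k%:E * f x) = k%:E * \int[m]_x f x)%E.
Proof. by move=> mf f0 k0; rewrite ge0_integralZl_EFin. Qed.

Lemma integral_oppr g : measurable_fun setT g -> (forall x, 0 <= g x)%E ->
  (\int[mu]_x g (- x)%R = \int[mu]_x g x)%E.
Proof.
move=> mg g0.
have mb : measurable_fun [set: measurableTypeR R] (-%R : _ -> measurableTypeR R).
  by [].
pose m := (pushforward mu (-%R : _ -> measurableTypeR R) :
  {measure set (measurableTypeR R) -> \bar R}).
rewrite -[RHS](@eq_measure_integral _ _ _ _ mu (m mb)); last first.
  by move=> A mA _; exact: lebesgue_measureN.
by rewrite ge0_integral_pushforward.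
Qed.

Lemma integral_even g : measurable_fun setT g -> (forall x, 0 <= g x)%E ->
  (forall x, g (- x) = g x) ->
  (\int[mu]_x g x = \int[mu]_(x in `[0%R, +oo[) g x + \int[mu]_(x in `[0%R, +oo[) g x)%E.
Proof.
move=> mg g0 ge.
have {1}-> : [set: R] = `]-oo, 0%R] `|` `]0%R, +oo[.
  apply/seteqP; split => // x _ /=; rewrite !in_itv/= andbT.
  by case: (leP x 0); [left|right].
rewrite ge0_integral_setU//=; last 2 first.
- exact: measurable_funTS.
- by apply/disj_setPS => x /= []; rewrite !in_itv/= andbT leNgt => /negP.
congr (_ + _)%E.
  rewrite [RHS]ge0_integration_by_substitution0//.
  by apply: eq_integral => u _; rewrite ge.
by rewrite integral_itv_obnd_cbnd//; exact: measurable_funTS.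
Qed.

Lemma integral_subl (b : R) g : measurable_fun setT g -> (forall x, 0 <= g x)%E ->
  (\int[mu]_x g (b - x)%R = \int[mu]_x g x)%E.
Proof.
move=> mg g0; rewrite -(integral_oppr mg g0) -[RHS](integral_addr (- b))//.
  by apply: eq_integral => x _; rewrite opprD opprK addrC.
by apply: measurableT_comp.
Qed.

Lemma integral2E f : measurable_fun setT f -> (forall x, 0 <= f x)%E ->
  (\int[mu2]_z f z = \int[mu]_x \int[mu]_y f (x, y))%E.
Proof. by move=> mf f0; rewrite fubini_tonelli1. Qed.

Lemma integral2_swap f : measurable_fun setT f -> (forall x, 0 <= f x)%E ->
  (\int[mu]_x \int[mu]_y f (x, y) = \int[mu]_y \int[mu]_x f (x, y))%E.
Proof. by move=> mf f0; exact: fubini_tonelli. Qed.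

Lemma measurable_sec1 f x : measurable_fun setT f ->
  measurable_fun setT (fun y => f (x, y)).
Proof. by move=> mf; apply: (measurableT_comp mf); exact: measurable_pair1. Qed.

Lemma measurable_sec2 f y : measurable_fun setT f ->
  measurable_fun setT (fun x => f (x, y)).
Proof. by move=> mf; apply: (measurableT_comp mf); exact: measurable_pair2. Qed.

Lemma measurable_integral1 f : measurable_fun setT f -> (forall x, 0 <= f x)%E ->
  measurable_fun setT (fun x => \int[mu]_y f (x, y))%E.
Proof. by move=> mf f0; exact: measurable_fun_fubini_tonelli_F. Qed.

Lemma measurable_integral2 f : measurable_fun setT f -> (forall x, 0 <= f x)%E ->
  measurable_fun setT (fun y => \int[mu]_x f (x, y))%E.
Proof. by move=> mf f0; exact: measurable_fun_fubini_tonelli_G. Qed.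

Lemma measurable_fst12 : measurable_fun [set: measurableTypeR R * measurableTypeR R]
  (fst : R * R -> R).
Proof. exact: measurable_fst. Qed.

Lemma measurable_snd12 : measurable_fun [set: measurableTypeR R * measurableTypeR R]
  (snd : R * R -> R).
Proof. exact: measurable_snd. Qed.

Lemma measurable_affine2 (a b c d : R) :
  measurable_fun [set: measurableTypeR R * measurableTypeR R]
  (fun z : R * R => (a * z.1 + b * z.2, c * z.1 + d * z.2) : R * R).
Proof.
apply: measurable_fun_pair; apply: measurable_funD; apply: measurable_funM => //;
  try exact: measurable_fst; exact: measurable_snd.
Qed.

Lemma integral2_shear1 (k : R) f :
  measurable_fun setT f -> (forall x, 0 <= f x)%E ->
  (\int[mu2]_z f (z.1 + k * z.2, z.2)%R = \int[mu2]_z f z)%E.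
Proof.
move=> mf f0.
have mS : measurable_fun [set: measurableTypeR R * measurableTypeR R]
   (fun z : R * R => f (z.1 + k * z.2, z.2)).
  rewrite (_ : (fun z : R * R => _) =
    f \o (fun z : R * R => (1 * z.1 + k * z.2, 0 * z.1 + 1 * z.2))).
    by apply: measurableT_comp => //; exact: measurable_affine2.
  by apply/funext => z /=; rewrite !mul1r mul0r add0r.
rewrite (integral2E mS (fun=> f0 _)) (integral2E mf f0).
etransitivity; first exact: (integral2_swap mS).
apply/esym; etransitivity; first exact: (integral2_swap mf).
apply/esym.
apply: eq_integral => y _.
by rewrite -[RHS](integral_addr (k * y))//; exact: measurable_sec2.
Qed.

Lemma integral2_shear2 (k : R) f :
  measurable_fun setT f -> (forall x, 0 <= f x)%E ->
  (\int[mu2]_z f (z.1, z.2 + k * z.1)%R = \int[mu2]_z f z)%E.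
Proof.
move=> mf f0.
have mS : measurable_fun [set: measurableTypeR R * measurableTypeR R]
   (fun z : R * R => f (z.1, z.2 + k * z.1)).
  rewrite (_ : (fun z : R * R => _) =
    f \o (fun z : R * R => (1 * z.1 + 0 * z.2, k * z.1 + 1 * z.2))).
    by apply: measurableT_comp => //; exact: measurable_affine2.
  by apply/funext => z /=; rewrite !mul1r mul0r addr0 addrC.
rewrite (integral2E mS (fun=> f0 _)) (integral2E mf f0).
apply: eq_integral => x _.
by rewrite -[RHS](integral_addr (k * x))//; exact: measurable_sec1.
Qed.

Lemma integral2_opp f : measurable_fun setT f -> (forall x, 0 <= f x)%E ->
  (\int[mu2]_z f (- z.1, - z.2)%R = \int[mu2]_z f z)%E.
Proof.
move=> mf f0.
have mS : measurable_fun [set: measurableTypeR R * measurableTypeR R]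
   (fun z : R * R => f (- z.1, - z.2)).
  rewrite (_ : (fun z : R * R => _) =
    f \o (fun z : R * R => ((-1) * z.1 + 0 * z.2, 0 * z.1 + (-1) * z.2))).
    by apply: measurableT_comp => //; exact: measurable_affine2.
  by apply/funext => z /=; rewrite !mulN1r !mul0r addr0 add0r.
rewrite (integral2E mS (fun=> f0 _)) (integral2E mf f0).
transitivity (\int[mu]_x \int[mu]_y f ((- x)%R, y))%E.
  by apply: eq_integral => x _; exact: (integral_oppr (measurable_sec1 (- x) mf) (fun=> f0 _)).
apply: (integral_oppr (measurable_integral1 mf f0)) => x.
exact: integral_ge0.
Qed.

(* For [c != -1] a rotation is a product of three shears. *)
Lemma integral2_rotation (c s : R) f : c ^+ 2 + s ^+ 2 = 1 ->
  measurable_fun setT f -> (forall x, 0 <= f x)%E ->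
  (\int[mu2]_z f (c * z.1 - s * z.2, s * z.1 + c * z.2)%R = \int[mu2]_z f z)%E.
Proof.
move=> cs mf f0; have [cN1|cN1] := eqVneq c (-1).
  have -> : s = 0.
    move: cs; rewrite cN1 sqrrN expr1n -[RHS]addr0 => /addrI/eqP.
    by rewrite sqrf_eq0 => /eqP.
  rewrite cN1 -[RHS]integral2_opp//.
  by apply: eq_integral => z _; rewrite !mul0r subr0 add0r !mulN1r.
(* [k] is the tangent of half the rotation angle; the three shears have factors [- k], [s] and
   [- k]. *)
pose k := s / (1 + c).
have c1 : 1 + c != 0 by rewrite addrC addr_eq0.
have mS1 : measurable_fun [set: measurableTypeR R * measurableTypeR R]
   (fun z : R * R => f (z.1 + - k * z.2, z.2)).
  rewrite (_ : (fun z : R * R => _) =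
    f \o (fun z : R * R => (1 * z.1 + - k * z.2, 0 * z.1 + 1 * z.2))).
    by apply: measurableT_comp => //; exact: measurable_affine2.
  by apply/funext => z /=; rewrite !mul1r mul0r add0r.
have mS2 : measurable_fun [set: measurableTypeR R * measurableTypeR R]
   (fun z : R * R => f (z.1 + - k * (z.2 + s * z.1), z.2 + s * z.1)).
  rewrite (_ : (fun z : R * R => _) = (fun z : R * R => f (z.1 + - k * z.2, z.2)) \o
     (fun z : R * R => (1 * z.1 + 0 * z.2, s * z.1 + 1 * z.2))).
    by apply: measurableT_comp => //; exact: measurable_affine2.
  by apply/funext => z /=; rewrite !mul1r mul0r addr0 (addrC (s * _)).
rewrite -[RHS](integral2_shear1 (- k))// -[RHS](integral2_shear2 s)//=.
rewrite -[RHS](integral2_shear1 (- k))//=.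
have ks : k * (1 + c) = s by rewrite /k divfK.
have sk : s * k = 1 - c.
  apply: (mulIf c1); rewrite -mulrA ks -[LHS]expr2.
  by move/eqP: cs; rewrite addrC eq_sym -subr_eq => /eqP <-; ring.
have ks2 (z : R) : k * (1 + c) * z = s * z by rewrite ks.
have sk2 (z : R) : s * k * z = (1 - c) * z by rewrite sk.
apply: eq_integral => -[z1 z2] _ /=; congr (f (_, _)).
- have := ks2 z2; have := sk2 z1; have := sk2 (k * z2); lra.
- have := sk2 z2; lra.
Qed.

End plane.

(** * The disc kernel in hemisphere coordinates *)

Section measurability.
Context {R : realType}.

(** Rectangles with rational ends form a countable base, so open sets of the plane belong to the
    product sigma-algebra, the one of Tonelli's theorem. *)
Lemma open_measurable_prod (U : set (R * R)) : open U ->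
  measurable (U : set (measurableTypeR R * measurableTypeR R)).
Proof.
move=> oU.
pose B (q : (rat * rat) * (rat * rat)) : set (R * R) :=
  `]ratr q.1.1, ratr q.1.2[ `*` `]ratr q.2.1, ratr q.2.2[.
have -> : U = \bigcup_q (if `[< B q `<=` U >] then B q else set0).
  apply/seteqP; split => [z Uz|z [q _]]; last first.
    by case: asboolP => // qU /qU.
  have := oU; rewrite openE => /(_ _ Uz); rewrite /interior.
  move=> /nbhs_ballP[e /= e0 eU].
  have lo (x : R) : x - e < x by rewrite ltrBlDr ltrDl.
  have hi (x : R) : x < x + e by rewrite ltrDl.
  have [a] := rat_in_itvoo (lo z.1); rewrite in_itv/= => /andP[a1 a2].
  have [b] := rat_in_itvoo (hi z.1); rewrite in_itv/= => /andP[b1 b2].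
  have [c] := rat_in_itvoo (lo z.2); rewrite in_itv/= => /andP[c1 c2].
  have [d] := rat_in_itvoo (hi z.2); rewrite in_itv/= => /andP[d1 d2].
  exists ((a, b), (c, d)) => //; case: asboolP => [_|].
    by rewrite /B /=; split; rewrite /= in_itv/= ?a2 ?b1 ?c2.
  case=> -[u v]; rewrite /B /= => -[]; rewrite /= !in_itv/=.
  move=> /andP[u1 u2] /andP[v1 v2]; apply: eU; split; rewrite /ball/= ltr_distlC.
    by rewrite (lt_trans a1)//= (lt_trans u2).
  by rewrite (lt_trans c1)//= (lt_trans v2).
apply: countable_bigcupT_measurable; first exact: countableP.
by move=> q; case: ifP => // _; apply: measurableX.
Qed.

Lemma continuous_measurable_prod (f : R * R -> R) : continuous f ->
  measurable_fun [set: measurableTypeR R * measurableTypeR R] f.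
Proof.
move=> cf; apply: (measurability _ (@RGenOInfty.measurableE R)) => //.
move=> _ [_ [x ->] <-]; rewrite setTI.
by apply: open_measurable_prod; apply: open_comp => // *; exact: cf.
Qed.

(** Inversion is continuous off [0], and the convention [0^-1 = 0] concerns a single point. *)
Lemma measurable_invr : measurable_fun [set: R] (@GRing.inv R).
Proof.
have -> : [set: R] = [set x : R | x != 0] `|` [set 0].
  by apply/seteqP; split => // x _ /=; have [->|] := eqVneq x 0; [right|left].
have o0 : open [set x : R | x != 0].
  rewrite (_ : [set x : R | x != 0] = ~` [set 0]); last first.
    by apply/seteqP; split => x /= /eqP.
  by apply: closed_openC; exact: closed_eq.
apply/measurable_funU => //; first exact: open_measurable.
split; last exact: measurable_fun_set1.
by apply: open_continuous_measurable_fun => // x /[!inE] /inv_continuous.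
Qed.

Lemma measurable_sqrtr : measurable_fun [set: R] (@Num.sqrt R).
Proof. by apply: continuous_measurable_fun; exact: sqrt_continuous. Qed.

End measurability.

Section sphere.
Context {R : realType}.
Local Notation mu := (@lebesgue_measure R).
Local Notation mu2 := (mu \x mu)%E.
Local Notation ang := (`[- (pi / 2), pi / 2]%classic : set R).

(* [0] outside the disc [|z| < rho], by the conventions on [sqrt] and [^-1]. *)
Definition kern (rho : R) (z : R * R) : R :=
  (Num.sqrt (rho ^+ 2 - (z.1 ^+ 2 + z.2 ^+ 2)))^-1.

Definition hemi (th ch : R) : R * R := (sin th, cos th * sin ch).

Lemma pihalf_gt0 : 0 < pi / 2 :> R.
Proof. by rewrite divr_gt0// pi_gt0. Qed.

Lemma cos_ge0 (x : R) : - (pi / 2) <= x <= pi / 2 -> 0 <= cos x.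
Proof. exact: cos_ge0_pihalf. Qed.

Lemma sinN_pihalf : sin (- (pi / 2)) = -1 :> R.
Proof. by rewrite sinN sin_pihalf. Qed.

Lemma measurable_kern1 (c : R) :
  measurable_fun [set: measurableTypeR R] (fun u : R => (Num.sqrt (c - u ^+ 2))^-1).
Proof.
apply: (measurableT_comp measurable_invr).
apply: (measurableT_comp measurable_sqrtr).
by apply: measurable_funB => //; exact: measurable_funX.
Qed.

Lemma measurable_kern (rho : R) :
  measurable_fun [set: measurableTypeR R * measurableTypeR R] (kern rho).
Proof.
apply: (measurableT_comp measurable_invr).
apply: (measurableT_comp measurable_sqrtr).
apply: measurable_funB => //; apply: measurable_funD; apply: measurable_funX.
- exact: measurable_fst.
- exact: measurable_snd.
Qed.

Lemma integral_scaled_sin (b : R) (g : R -> \bar R) : 0 < b ->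
  measurable_fun [set: measurableTypeR R] g -> (forall x, 0 <= g x)%E ->
  (\int[mu]_(u in `[(- b)%R, b]) g u =
   \int[mu]_(x in ang) (g (b * sin x)%R * (b * cos x)%R%:E))%E.
Proof.
move=> b0 mg g0.
have pp : - (pi / 2) < pi / 2 :> R by rewrite -subr_gt0 opprK addr_gt0// pihalf_gt0.
have := @ge0_change_of_variables R (fun x => b * sin x) (fun x => b * cos x)
  (- (pi / 2)) (pi / 2) pp _ _ _ _ g mg g0.
rewrite sinN_pihalf sin_pihalf mulr1 mulrN1; apply.
- move=> x; apply: continuousM; first exact: cvg_cst.
  exact: continuous_cos.
- by move=> x xpi; rewrite mulr_ge0 ?(ltW b0)// cos_ge0.
- by move=> x y xI yI xy; rewrite ltr_pM2l// ltr_sin.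
Qed.

(** The derivative [b * cos x] of the substitution [u = b * sin x] is exactly the square root in the
    kernel, so the singularity cancels. *)
Lemma integral_kern1 (b : R) (g : R -> \bar R) : 0 < b ->
  measurable_fun [set: measurableTypeR R] g -> (forall x, 0 <= g x)%E ->
  (\int[mu]_u (g u * ((Num.sqrt (b ^+ 2 - u ^+ 2))^-1)%R%:E) =
   \int[mu]_(x in ang) g (b * sin x)%R)%E.
Proof.
move=> b0 mg g0.
transitivity (\int[mu]_(u in `[(- b)%R, b])
   (g u * ((Num.sqrt (b ^+ 2 - u ^+ 2))^-1)%R%:E))%E.
  apply: eq_integral_support => u; last by move=> _ /(_ I).
  move=> _ /=; rewrite in_itv/= -ler_norml => /negP.
  rewrite -ltNge => bu; rewrite ler0_sqrtr ?invr0 ?mule0// subr_le0.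
  by rewrite -[leRHS]real_normK ?num_real// ler_sqr ?nnegrE ?(ltW b0)// ltW.
rewrite (integral_scaled_sin b0); last 2 first.
- apply: emeasurable_funM => //; apply/measurable_EFinP.
  exact: measurable_kern1.
- by move=> x; rewrite mule_ge0// lee_fin invr_ge0 sqrtr_ge0.
have mgs : measurable_fun [set: measurableTypeR R] (fun x => g (b * sin x)).
  apply: (measurableT_comp mg); apply: measurable_funM => //.
  by apply: continuous_measurable_fun; exact: continuous_sin.
have mbc : measurable_fun [set: measurableTypeR R] (fun x => (b * cos x)).
  apply: measurable_funM => //.
  by apply: continuous_measurable_fun; exact: continuous_cos.
have mk := measurable_kern1 (b ^+ 2).
have ms : measurable_fun [set: measurableTypeR R] (fun x => b * sin x).
  apply: measurable_funM => //.
  by apply: continuous_measurable_fun; exact: continuous_sin.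
(* At the endpoints [cos x = 0], and weight times kernel is [0] instead of [1]; they are removed as
   a null set. *)
rewrite integral_itv_bndoo; last first.
  apply: measurable_funTS; apply: emeasurable_funM; last exact/measurable_EFinP.
  apply: emeasurable_funM => //; apply/measurable_EFinP.
  exact: (measurableT_comp mk ms).
rewrite [RHS]integral_itv_bndoo; last exact: measurable_funTS.
apply: eq_integral => x; rewrite inE/= in_itv/= => xpi.
have cx : 0 < cos x by exact: cos_gt0_pihalf.
rewrite -muleA -EFinM (_ : (Num.sqrt _)^-1 * _ = 1) ?mule1//.
have -> : b ^+ 2 - (b * sin x) ^+ 2 = (b * cos x) ^+ 2.
  by rewrite !exprMn cos2sin2; ring.
rewrite sqrtr_sqr ger0_norm; last by rewrite mulr_ge0// ltW.
by rewrite mulVf// mulf_neq0// gt_eqF.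
Qed.

(** The section of the disc at abscissa [rho * sin th] is a segment of half-length [rho * cos th],
    on which the kernel has the form of [integral_kern1]. Only the outer substitution leaves a
    Jacobian. *)
Lemma integral_kern (rho : R) (h : R * R -> \bar R) : 0 < rho ->
  measurable_fun [set: measurableTypeR R * measurableTypeR R] h ->
  (forall z, 0 <= h z)%E ->
  (\int[mu2]_z (h z * (kern rho z)%:E) =
   \int[mu]_(th in ang) ((\int[mu]_(ch in ang)
     h (rho * (hemi th ch).1, rho * (hemi th ch).2)%R) * (rho * cos th)%R%:E))%E.
Proof.
move=> r0 mh h0.
have mhk : measurable_fun [set: measurableTypeR R * measurableTypeR R]
    (fun z => h z * (kern rho z)%:E)%E.
  apply: emeasurable_funM => //; apply/measurable_EFinP.
  exact: measurable_kern.
have hk0 z : (0 <= h z * (kern rho z)%:E)%E.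
  by rewrite mule_ge0// lee_fin invr_ge0 sqrtr_ge0.
rewrite (integral2E mhk hk0).
transitivity (\int[mu]_(x in `[(- rho)%R, rho])
    \int[mu]_y (h (x, y) * (kern rho (x, y))%:E))%E.
  apply: eq_integral_support => u; last by move=> _ /(_ I).
  move=> _ /=; rewrite in_itv/= -ler_norml => /negP.
  rewrite -ltNge => bu; rewrite integral0_eq// => v _.
  rewrite /kern/= ler0_sqrtr ?invr0 ?mule0// subr_le0.
  rewrite (@le_trans _ _ (u ^+ 2)) ?lerDl ?sqr_ge0//.
  by rewrite -[leRHS]real_normK ?num_real// ler_sqr ?nnegrE ?(ltW r0)// ltW.
rewrite (integral_scaled_sin r0); last 2 first.
- exact: (measurable_integral1 mhk hk0).
- by move=> x; apply: integral_ge0.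
apply: eq_integral => x; rewrite inE/= in_itv/= => xpi.
have [cx0|cx] := eqVneq (cos x) 0; first by rewrite cx0 mulr0 !mule0.
have cx0 : 0 < cos x by rewrite lt_neqAle eq_sym cx cos_ge0.
congr (_ * _)%E; rewrite /kern /hemi /=.
under eq_integral => y _.
  rewrite opprD addrA (_ : rho ^+ 2 - _ = (rho * cos x) ^+ 2); last first.
    by rewrite !exprMn cos2sin2; ring.
  over.
rewrite (integral_kern1 (b := rho * cos x) (g := fun y => h (rho * sin x, y))).
- by apply: eq_integral => y _; rewrite mulrA.
- by rewrite mulr_gt0.
- exact: measurable_sec1.
- by move=> y.
Qed.

Lemma integral2_subl (x : R * R) (h : R * R -> \bar R) :
  measurable_fun [set: measurableTypeR R * measurableTypeR R] h ->
  (forall z, 0 <= h z)%E ->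
  (\int[mu2]_z h (x - z)%R = \int[mu2]_z h z)%E.
Proof.
move=> mh h0.
have mS : measurable_fun [set: measurableTypeR R * measurableTypeR R]
    (fun z : R * R => h (x - z)).
  apply: (measurableT_comp mh).
  by apply: measurable_fun_pair; apply: measurable_funB.
rewrite (integral2E mS (fun=> h0 _)) (integral2E mh h0).
transitivity (\int[mu]_u \int[mu]_v h ((x.1 - u)%R, v))%E.
  apply: eq_integral => u _.
  exact: (integral_subl x.2 (measurable_sec1 (x.1 - u) mh) (fun=> h0 _)).
apply: (integral_subl x.1 (measurable_integral1 mh h0)) => u.
exact: integral_ge0.
Qed.

End sphere.

(** * The angular integral *)

Section kernel_bound.
Context {R : realType}.
Local Notation mu := (@lebesgue_measure R).
Local Notation mu2 := (mu \x mu)%E.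

Definition root4 (x : R) : R := Num.sqrt (Num.sqrt x).

Lemma root4_ge0 x : 0 <= root4 x. Proof. exact: sqrtr_ge0. Qed.

Lemma root4_gt0 x : 0 < x -> 0 < root4 x.
Proof. by move=> x0; rewrite !sqrtr_gt0. Qed.

Lemma root4_sqr x : root4 x ^+ 2 = Num.sqrt x.
Proof. by rewrite sqr_sqrtr// sqrtr_ge0. Qed.

Lemma root4K x : 0 <= x -> root4 x ^+ 4 = x.
Proof. by move=> x0; rewrite (exprM _ 2 2) root4_sqr sqr_sqrtr. Qed.

Lemma ler_root4 x y : x <= y -> root4 x <= root4 y.
Proof. by move=> xy; rewrite !ler_wsqrtr. Qed.

Lemma root4M x y : 0 <= x -> root4 (x * y) = root4 x * root4 y.
Proof. by move=> x0; rewrite /root4 sqrtrM// sqrtrM// sqrtr_ge0. Qed.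

Lemma root4X x : 0 <= x -> root4 (x ^+ 4) = x.
Proof.
by move=> x0; rewrite /root4 (exprM _ 2 2) sqrtr_sqr ger0_norm ?exprn_ge0// sqrtr_sqr ger0_norm.
Qed.

Lemma measurable_root4 : measurable_fun [set: R] root4.
Proof. by apply: (measurableT_comp measurable_sqrtr); exact: measurable_sqrtr. Qed.

(* [|u|^(-3/4)] cut off at [|u| = L]. *)
Definition cusp (L u : R) : R := if `|u| < L then (root4 `|u| ^+ 3)^-1 else 0.

Lemma cusp_ge0 L u : 0 <= cusp L u.
Proof. by rewrite /cusp; case: ifP => // _; rewrite invr_ge0 exprn_ge0// root4_ge0. Qed.

Lemma measurable_cusp L : measurable_fun [set: R] (cusp L).
Proof.
apply: measurable_fun_ifT => //.
- by apply: measurable_fun_ltr.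
- apply: (measurableT_comp measurable_invr); apply: measurable_funX.
  by apply: (measurableT_comp measurable_root4).
Qed.

(** The substitution [u = x ^+ 4] turns |u|^(-3/4) du into 4 dx. *)
Lemma integral_cusp0 L : 0 < L ->
  (\int[mu]_(u in `[0%R, +oo[) (cusp L u)%:E <= (4 * root4 L)%:E)%E.
Proof.
move=> L0.
have mc : measurable_fun [set: measurableTypeR R] (fun u => (cusp L u)%:E).
  by apply/measurable_EFinP; exact: measurable_cusp.
have c0 u : (0 <= (cusp L u)%:E)%E by rewrite lee_fin cusp_ge0.
have -> : (\int[mu]_(u in `[0%R, +oo[) (cusp L u)%:E =
   \int[mu]_(u in `[0%R, L]) (cusp L u)%:E)%E.
  apply: eq_integral_support => u /=; rewrite !in_itv/= andbT; last first.
    by move=> /andP[-> _].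
  move=> u0 /negP; rewrite u0/= -ltNge => Lu.
  by rewrite /cusp ger0_norm// ltNge (ltW Lu).
have l0 := root4_gt0 L0.
have dX4 (x : R) : is_derive x (1 : R) (fun x : R => x ^+ 4) (4 * x ^+ 3).
  by apply: is_derive_eq; rewrite /GRing.scale/=; ring.
have := @ge0_change_of_variables R (fun x => x ^+ 4) (fun x => 4 * x ^+ 3)
  0 (root4 L) l0 dX4 _ _ _ (fun u => (cusp L u)%:E) mc c0.
rewrite /= expr0n/= root4K ?(ltW L0)// => ->; last first.
- by move=> x y /= + + xy; rewrite !in_itv/= => /andP[x0 _] /andP[y0 _]; rewrite ltrXn2r.
- by move=> x /andP[x0 _]; rewrite mulr_ge0// exprn_ge0.
- move=> x; apply: (@cvgM _ _ _ _ (fun=> 4) (fun x => x ^+ 3)).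
    exact: cvg_cst.
  exact: exprn_continuous.
apply: (@le_trans _ _ (\int[mu]_(x in `[0%R, root4 L]) 4%:E)%E).
  apply: ge0_le_integral => //=.
  - move=> x; rewrite in_itv/= => /andP[x0 _]; rewrite -EFinM lee_fin.
    by rewrite mulr_ge0 ?cusp_ge0// mulr_ge0// exprn_ge0.
  - apply: emeasurable_funM; apply/measurable_EFinP; apply: measurable_funTS.
      by apply: (measurableT_comp (measurable_cusp L)); exact: measurable_funX.
    by apply: measurable_funM => //; exact: measurable_funX.
  - move=> x; rewrite in_itv/= => /andP[x0 _]; rewrite -EFinM lee_fin /cusp.
    case: ifP => _; last by rewrite mul0r.
    rewrite ger0_norm ?exprn_ge0// root4X//.
    have [->|xN0] := eqVneq x 0; first by rewrite expr0n/= mulr0 mulr0.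
    by rewrite mulrCA mulVf ?mulr1// expf_neq0.
rewrite integral_cst//= lebesgue_measure_itv/= lte_fin l0.
by rewrite -EFinB -EFinM subr0.
Qed.

Lemma integral_cusp (c L : R) : 0 < L ->
  (\int[mu]_u (cusp L (u - c))%:E <= (8 * root4 L)%:E)%E.
Proof.
move=> L0.
have mc : measurable_fun [set: measurableTypeR R] (fun u => (cusp L u)%:E).
  by apply/measurable_EFinP; exact: measurable_cusp.
have c0 u : (0 <= (cusp L u)%:E)%E by rewrite lee_fin cusp_ge0.
rewrite (integral_addr (- c) mc c0).
rewrite (integral_even mc c0); last by move=> u; rewrite /cusp normrN.
have -> : 8 * root4 L = 4 * root4 L + 4 * root4 L by ring.
by rewrite EFinD; apply: leeD; exact: integral_cusp0.
Qed.

(** The smaller of [X] and [Y] is [m]; the larger is at least [m] and at least [D], so its square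
    root is at least D^(1/4) m^(1/4). Two zeros that merge at distance about [D] thus cost D^(-1/4)
    and leave the integrable power 3/4. *)
Lemma ler_inv_sqrtM (X Y m D : R) : 0 < m -> m <= X -> m <= Y -> 0 < D ->
  D <= X \/ D <= Y ->
  m = X \/ m = Y ->
  (Num.sqrt X)^-1 * (Num.sqrt Y)^-1 <= (root4 D)^-1 * (root4 m ^+ 3)^-1.
Proof.
move=> m0 mX mY D0.
have X0 := lt_le_trans m0 mX; have Y0 := lt_le_trans m0 mY.
have key Z : m <= Z -> D <= Z -> root4 D * root4 m <= root4 Z ^+ 2.
  by move=> mZ DZ; rewrite expr2 ler_pM ?root4_ge0// ler_root4.
rewrite -!invfM => DXY mXY; rewrite lef_pV2 ?posrE; last 2 first.
- by rewrite mulr_gt0 ?sqrtr_gt0.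
- by rewrite mulr_gt0 ?exprn_gt0 ?root4_gt0.
rewrite -!root4_sqr exprSr mulrA.
have swap Z : m <= Z -> D <= Z ->
    root4 D * root4 m ^+ 2 * root4 m <= root4 m ^+ 2 * root4 Z ^+ 2.
  move=> mZ DZ; rewrite [root4 D * _]mulrC -mulrA ler_wpM2l ?exprn_ge0 ?root4_ge0//.
  exact: key.
have mone Z : m <= Z -> root4 m ^+ 2 <= root4 Z ^+ 2.
  by move=> mZ; rewrite ler_sqr ?nnegrE ?root4_ge0// ler_root4.
case: mXY => mE; rewrite -mE in mX mY DXY X0 Y0 *; subst.
- case: DXY => [DX|DY]; last exact: swap.
  apply: (le_trans (swap _ (lexx _) DX)).
  by rewrite ler_wpM2l ?exprn_ge0 ?root4_ge0// mone.
- rewrite [leRHS]mulrC; case: DXY => [DX|DY]; first exact: swap.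
  apply: (le_trans (swap _ (lexx _) DY)).
  by rewrite ler_wpM2l ?exprn_ge0 ?root4_ge0// mone.
Qed.

(* One of the two factors is evaluated at distance at least [l/2]. *)
Lemma ler_two_cusps (u v p : R) : u < p < v ->
  (root4 (p - u) ^+ 3)^-1 * (Num.sqrt (v - p))^-1 <=
  2 * (Num.sqrt (v - u))^-1 * (cusp (v - u) (p - u) + cusp (v - u) (p - v)).
Proof.
move=> /andP[up pv].
have uv := lt_trans up pv.
have a0 : 0 < p - u by rewrite subr_gt0.
have b0 : 0 < v - p by rewrite subr_gt0.
have l0 : 0 < v - u by rewrite subr_gt0.
have lE : v - u = (p - u) + (v - p) by ring.
rewrite /cusp (gtr0_norm a0) distrC (gtr0_norm b0).
rewrite ltrD2r pv ltrD2l ltrN2 up.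
set a := root4 (p - u); set b := root4 (v - p); set l := root4 (v - u).
have a'0 : 0 < a by exact: root4_gt0.
have b'0 : 0 < b by exact: root4_gt0.
have l'0 : 0 < l by exact: root4_gt0.
rewrite -!root4_sqr -/b -/l.
have al : a <= l by rewrite ler_root4// lE lerDl ltW.
have bl : b <= l by rewrite ler_root4// lE lerDr ltW.
have lab : l ^+ 4 = a ^+ 4 + b ^+ 4 by rewrite !root4K ?ltW// lE.
have ia : 0 < a^-1 by rewrite invr_gt0.
have ib : 0 < b^-1 by rewrite invr_gt0.
have il : 0 < l^-1 by rewrite invr_gt0.
rewrite -!exprVn.
have half z : 0 < z -> l ^+ 4 <= 2 * z ^+ 4 -> z^-1 ^+ 2 <= 2 * l^-1 ^+ 2.
  move=> z0 h.
  have : l ^+ 2 <= 2 * z ^+ 2.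
    rewrite -ler_sqr ?nnegrE ?mulr_ge0 ?exprn_ge0 ?(ltW z0) ?(ltW l'0)//.
    have -> : (l ^+ 2) ^+ 2 = l ^+ 4 by ring.
    have -> : (2 * z ^+ 2) ^+ 2 = 4 * z ^+ 4 by ring.
    have : 0 <= z ^+ 4 by rewrite exprn_ge0// (ltW z0).
    lra.
  move=> h2; rewrite !exprVn ler_pdivlMr ?exprn_gt0// mulrC.
  by rewrite ler_pdivrMr ?exprn_gt0.
have [ab|ba] := leP (a ^+ 4) (b ^+ 4).
- have := half b b'0; rewrite lab => /(_ _) h.
  have {}h : b^-1 ^+ 2 <= 2 * l^-1 ^+ 2 by apply: h; lra.
  apply: (@le_trans _ _ (a^-1 ^+ 3 * (2 * l^-1 ^+ 2))).
    by rewrite ler_wpM2l// exprn_ge0// ltW.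
  rewrite mulrC ler_wpM2l ?mulr_ge0 ?exprn_ge0 ?(ltW il)// lerDl.
  by rewrite exprn_ge0// ltW.
- have := half a a'0; rewrite lab => /(_ _) h.
  have {}h : a^-1 ^+ 2 <= 2 * l^-1 ^+ 2 by apply: h; lra.
  have ba' : b <= a.
    by rewrite -(@ler_pXn2r _ 4) ?nnegrE ?(ltW a'0) ?(ltW b'0)// ltW.
  apply: (@le_trans _ _ (b^-1 ^+ 3 * (2 * l^-1 ^+ 2))).
    have ab' : a^-1 <= b^-1 by rewrite lef_pV2 ?posrE.
    rewrite exprSr -mulrA mulrC; apply: ler_pM; rewrite ?exprn_ge0 ?mulr_ge0 ?(ltW ia)
      ?exprn_ge0 ?(ltW ib)//.
    by rewrite [leRHS]exprSr mulrC ler_wpM2l ?exprn_ge0 ?(ltW ib).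
  rewrite mulrC ler_wpM2l ?mulr_ge0 ?exprn_ge0 ?(ltW il)// lerDr.
  by rewrite exprn_ge0// ltW.
Qed.

End kernel_bound.

Section angular_kernel.
Context {R : realType}.
Local Notation mu := (@lebesgue_measure R).
Local Notation mu2 := (mu \x mu)%E.

(** For [r = enorm x], [l = enorm y] and [p] the component of [y] along [x], the first factor is
    [kern rho (x - y)] and the second is the density in [p] of the angle on the circle
    [enorm y = l]. *)
Definition radial_kern (r rho l p : R) : R :=
  (Num.sqrt (rho ^+ 2 - r ^+ 2 - l ^+ 2 + 2 * r * p))^-1 *
  (Num.sqrt (l ^+ 2 - p ^+ 2))^-1.

Lemma radial_kern_ge0 r rho l p : 0 <= radial_kern r rho l p.
Proof. by rewrite mulr_ge0// invr_ge0 sqrtr_ge0. Qed.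

Lemma measurable_radial_kern r rho l :
  measurable_fun [set: measurableTypeR R] (radial_kern r rho l).
Proof.
apply: measurable_funM; apply: (measurableT_comp measurable_invr);
  apply: (measurableT_comp measurable_sqrtr).
- by apply: measurable_funD => //; exact: measurable_funM.
- by apply: measurable_funB => //; exact: measurable_funX.
Qed.

Lemma radial_kern_eq0 r rho l p : 0 <= l -> l <= `|p| -> radial_kern r rho l p = 0.
Proof.
move=> l0 lp; rewrite /radial_kern [X in _ * X^-1]ler0_sqrtr ?invr0 ?mulr0//.
by rewrite subr_le0 -(real_normK (num_real p)) ler_sqr ?nnegrE.
Qed.

(** The circle of radius [l] misses the disc: for [p <= l] the argument of the first root is at most
    rho^2 - (l - r)^2. *)
Lemma radial_kern_out r rho l p : 0 <= r -> 0 <= rho -> 0 <= l -> rho <= `|l - r| ->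
  radial_kern r rho l p = 0.
Proof.
move=> r0 rho0 l0 h; have [lp|pl] := leP l `|p|; first exact: radial_kern_eq0.
rewrite /radial_kern ler0_sqrtr ?invr0 ?mul0r//.
have {}h : rho ^+ 2 <= (l - r) ^+ 2.
  by rewrite -[leRHS]real_normK ?num_real// ler_sqr ?nnegrE.
have : r * p <= r * l by rewrite ler_wpM2l// (le_trans (ler_norm _))// ltW.
by move: h; rewrite sqrrB; lra.
Qed.

Lemma integral_le_cusps (f : R -> R) (A L u v : R) :
  measurable_fun [set: measurableTypeR R] f -> (forall p, 0 <= f p) -> 0 < L -> 0 <= A ->
  (forall p, f p <= A * (cusp L (p - u) + cusp L (p - v))) ->
  (\int[mu]_p (f p)%:E <= (16 * A * root4 L)%:E)%E.
Proof.
move=> mf f0 L0 A0 fA.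
have mc w : measurable_fun [set: measurableTypeR R] (fun p => (cusp L (p - w))%:E).
  apply/measurable_EFinP; apply: (measurableT_comp (measurable_cusp L)).
  exact: measurable_funB.
have c0 w p : (0 <= (cusp L (p - w))%:E)%E by rewrite lee_fin cusp_ge0.
apply: (@le_trans _ _ (\int[mu]_p
    (A%:E * ((cusp L (p - u))%:E + (cusp L (p - v))%:E)))%E).
  apply: ge0_le_integral => //=.
  - by move=> p _; rewrite lee_fin.
  - exact/measurable_EFinP.
  - apply: emeasurable_funM => //; exact: emeasurable_funD.
  - by move=> p _; rewrite -EFinD -EFinM lee_fin.
rewrite ge0_integralZl//=; last 2 first.
- exact: emeasurable_funD.
- by move=> p _; rewrite adde_ge0.
rewrite ge0_integralD//= (_ : 16 * A * root4 L = A * (8 * root4 L + 8 * root4 L)).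
  rewrite EFinM EFinD lee_wpmul2l ?lee_fin//.
  by apply: leeD; exact: integral_cusp.
ring.
Qed.

(** The arguments of the roots vanish at [p0], [- l] and [l]. Since 2 r (p0 + l) = (r + l + rho) (r
    + l - rho), the zeros [p0] and [- l] are at least [d] apart, and their merging costs d^(-1/4) by
    [ler_inv_sqrtM]. When [p0] approaches [l] instead, two inverse square roots remain on a short
    interval between their singularities, and the integral stays bounded. *)
Lemma integral_radial_kern_root (r rho l : R) : 0 < r -> 0 < rho -> 0 < l ->
  `|l - r| < rho -> r + l != rho ->
  (\int[mu]_p (radial_kern r rho l p)%:E <=
   (64 * (Num.sqrt r)^-1 * (root4 l)^-1 * (root4 `|r + l - rho|)^-1)%:E)%E.
Proof.
move=> r0 rho0 l0 lr rl.
set d := `|r + l - rho|.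
have d0 : 0 < d by rewrite normr_gt0 subr_eq0.
pose p0 := (r ^+ 2 + l ^+ 2 - rho ^+ 2) / (2 * r).
have r20 : 0 < 2 * r by rewrite mulr_gt0.
have p0E : 2 * r * p0 = r ^+ 2 + l ^+ 2 - rho ^+ 2.
  by rewrite /p0 mulrC divfK// gt_eqF.
move: (lr); rewrite ltr_norml => /andP[lr1 lr2].
have NE p : rho ^+ 2 - r ^+ 2 - l ^+ 2 + 2 * r * p = (2 * r) * (p - p0).
  by rewrite mulrBr p0E; ring.
have p0l : p0 < l.
  rewrite -(ltr_pM2l r20) p0E.
  have : (l - r) ^+ 2 < rho ^+ 2.
    by rewrite -[ltLHS]real_normK ?num_real// ltr_sqr ?nnegrE ?(ltW rho0).
  by rewrite sqrrB; lra.
have dp0 : d <= `|p0 + l|.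
  rewrite -(ler_pM2l r20).
  have -> : 2 * r * `|p0 + l| = `|2 * r * p0 + 2 * r * l|.
    by rewrite -mulrDr [RHS]normrM (gtr0_norm r20).
  rewrite p0E.
  rewrite (_ : r ^+ 2 + l ^+ 2 - rho ^+ 2 + 2 * r * l = (r + l + rho) * (r + l - rho)); last by
    ring.
  rewrite normrM ler_wpM2r ?normr_ge0// ger0_norm; lra.
have rk p : radial_kern r rho l p =
    (Num.sqrt (2 * r))^-1 * (Num.sqrt (p - p0))^-1 * (Num.sqrt (l ^+ 2 - p ^+ 2))^-1.
  by rewrite /radial_kern NE sqrtrM ?invfM ?mulrA// ltW.
have s2r : (Num.sqrt (2 * r))^-1 <= (Num.sqrt r)^-1.
  by rewrite lef_pV2 ?posrE ?sqrtr_gt0// ler_wsqrtr//; lra.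
have yE p : - l < p < l ->
    (Num.sqrt (l ^+ 2 - p ^+ 2))^-1 = (Num.sqrt (p + l))^-1 * (Num.sqrt (l - p))^-1.
  move=> /andP[lp pl]; rewrite subr_sqr [(l - p) * _]mulrC addrC sqrtrM ?invfM//.
  by lra.
have qd := root4_gt0 d0. have ql := root4_gt0 l0.
(* For [p0 <= 0] the support has length at least [l]. For [0 < p0] it stays at distance at least [l]
   from [- l], and the factor d^(-1/4) is recovered at the end because [d] is at most a multiple of
   [l]. *)
have [v0|v0] := leP p0 0.
- pose v := Num.max p0 (- l).
  have vl : v < l by rewrite gt_max p0l; lra.
  have lv : l <= l - v by rewrite lerBrDl addrC -lerBrDl subrr ge_max v0; lra.
  have L0 : 0 < l - v by rewrite subr_gt0.
  have qL := root4_gt0 L0.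
  pose A := (Num.sqrt r)^-1 * (root4 d)^-1 * (2 * (Num.sqrt (l - v))^-1).
  have A0 : 0 <= A by rewrite !mulr_ge0 ?invr_ge0 ?sqrtr_ge0 ?root4_ge0.
  apply: (le_trans (@integral_le_cusps _ A (l - v) v l _ _ L0 A0 _)).
  + exact: measurable_radial_kern.
  + exact: radial_kern_ge0.
  + move=> p.
    have [|vp] := leP p v.
      rewrite le_max => /orP[pp|pl].
        by rewrite rk [Num.sqrt (p - p0)]ler0_sqrtr ?subr_le0// invr0 mulr0 mul0r mulr_ge0//
          addr_ge0 ?cusp_ge0.
      rewrite radial_kern_eq0 ?(ltW l0)//; last by rewrite ler_normr; apply/orP; right; lra.
      by rewrite mulr_ge0 ?addr_ge0 ?cusp_ge0.
    have [lp|pl] := leP l p.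
      by rewrite radial_kern_eq0 ?(ltW l0) ?ler_normr ?lp// mulr_ge0 ?addr_ge0 ?cusp_ge0.
    move: (vp); rewrite gt_max => /andP[X0 Y0].
    rewrite rk yE ?pl ?Y0// !mulrA -[_ * (Num.sqrt (p - p0))^-1 * _]mulrA.
    have h : (Num.sqrt (p - p0))^-1 * (Num.sqrt (p + l))^-1 <= (root4 d)^-1 * (root4 (p - v) ^+
      3)^-1.
      have [pl0|pl0] := leP p0 (- l).
        have vE : v = - l by apply/max_idPr.
        apply: ler_inv_sqrtM => //; rewrite ?vE; [lra|lra|lra| |right; lra].
        by left; move: dp0; rewrite ler0_norm; lra.
      have vE : v = p0 by apply/max_idPl/ltW.
      apply: ler_inv_sqrtM => //; rewrite ?vE; [lra|lra|lra| |left; lra].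
      by right; move: dp0; rewrite ger0_norm; lra.
    have h2 := @ler_two_cusps R v l p; rewrite vp pl in h2; have {}h2 := h2 isT.
    rewrite /A -!mulrA ler_pM// ?mulr_ge0 ?invr_ge0 ?sqrtr_ge0//.
    rewrite !mulrA.
    apply: (@le_trans _ _ ((root4 d)^-1 * (root4 (p - v) ^+ 3)^-1 * (Num.sqrt (l - p))^-1)).
      by rewrite ler_wpM2r ?invr_ge0 ?sqrtr_ge0.
    by rewrite -!mulrA ler_wpM2l ?invr_ge0 ?root4_ge0// !mulrA.
  + rewrite lee_fin /A -[Num.sqrt (l - v)]root4_sqr.
    have -> : 16 * ((Num.sqrt r)^-1 / root4 d * (2 / root4 (l - v) ^+ 2)) * root4 (l - v) =
      32 * ((Num.sqrt r)^-1 / root4 d) * (root4 (l - v))^-1.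
      have := qL; set q := root4 (l - v) => q0; field.
      by rewrite !gt_eqF ?sqrtr_gt0.
    have : (root4 (l - v))^-1 <= (root4 l)^-1.
      by rewrite lef_pV2 ?posrE// ler_root4.
    move=> h; rewrite [leRHS](_ : _ = 32 * ((Num.sqrt r)^-1 / root4 d) * (2 * (root4 l)^-1));
      last by ring.
    rewrite ler_wpM2l// ?mulr_ge0 ?invr_ge0 ?sqrtr_ge0 ?root4_ge0//.
    by rewrite (le_trans h)// ler_peMl ?invr_ge0 ?root4_ge0// ler1n.
- have L0 : 0 < l - p0 by rewrite subr_gt0.
  have qL := root4_gt0 L0.
  pose A := (Num.sqrt r)^-1 * (Num.sqrt l)^-1 * root4 (l - p0) * (2 * (Num.sqrt (l - p0))^-1).
  have A0 : 0 <= A by rewrite !mulr_ge0 ?invr_ge0 ?sqrtr_ge0 ?root4_ge0.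
  apply: (le_trans (@integral_le_cusps _ A (l - p0) p0 l _ _ L0 A0 _)).
  + exact: measurable_radial_kern.
  + exact: radial_kern_ge0.
  + move=> p.
    have [pp|pp] := leP p p0.
      by rewrite rk [Num.sqrt (p - p0)]ler0_sqrtr ?subr_le0// invr0 mulr0 mul0r mulr_ge0//
        addr_ge0 ?cusp_ge0.
    have [lp|pl] := leP l p.
      by rewrite radial_kern_eq0 ?(ltW l0) ?ler_normr ?lp// mulr_ge0 ?addr_ge0 ?cusp_ge0.
    have Y0 : - l < p by lra.
    rewrite rk yE ?pl ?Y0//.
    have h2 := @ler_two_cusps R p0 l p; rewrite pp pl in h2; have {}h2 := h2 isT.
    have X0 : 0 < p - p0 by rewrite subr_gt0.
    (* The power 1/2 is weakened to 3/4 to fit [ler_two_cusps]; the factor (l - p0)^(1/4) gained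
       here compensates for the possibly short interval. *)
    have h : (Num.sqrt (p - p0))^-1 <= root4 (l - p0) * (root4 (p - p0) ^+ 3)^-1.
      rewrite -root4_sqr; have := root4_gt0 X0; set q := root4 (p - p0) => q0.
      have -> : (q ^+ 2)^-1 = q * (q ^+ 3)^-1 by field; rewrite gt_eqF.
      rewrite ler_wpM2r ?invr_ge0 ?exprn_ge0 ?(ltW q0)//.
      by rewrite ler_root4// lerD2r ltW.
    have h3 : (Num.sqrt (p + l))^-1 <= (Num.sqrt l)^-1.
      by rewrite lef_pV2 ?posrE ?sqrtr_gt0//; [rewrite ler_wsqrtr//; lra|lra].
    rewrite [leLHS](_ : _ = (Num.sqrt (2 * r))^-1 * ((Num.sqrt (p + l))^-1 *
       ((Num.sqrt (p - p0))^-1 * (Num.sqrt (l - p))^-1))); last by ring.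
    rewrite /A -!mulrA.
    rewrite ler_pM ?mulr_ge0 ?invr_ge0 ?sqrtr_ge0//.
    rewrite ler_pM ?mulr_ge0 ?invr_ge0 ?sqrtr_ge0//.
    apply: (@le_trans _ _ (root4 (l - p0) * (root4 (p - p0) ^+ 3)^-1 * (Num.sqrt (l - p))^-1)).
      by rewrite ler_wpM2r ?invr_ge0 ?sqrtr_ge0.
    by rewrite -!mulrA ler_wpM2l ?root4_ge0// !mulrA.
  + rewrite lee_fin /A -!root4_sqr.
    have -> : 16 * ((root4 r ^+ 2)^-1 / root4 l ^+ 2 * root4 (l - p0) * (2 / root4 (l - p0) ^+
      2)) * root4 (l - p0) =
      32 * ((root4 r ^+ 2)^-1 / root4 l) * (root4 l)^-1.
      have := qL; set q := root4 (l - p0) => q0; field.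
      by rewrite !gt_eqF ?root4_gt0.
    have d2l : root4 d <= 2 * root4 l.
      have d16 : d <= 2 ^+ 4 * l by move: dp0; rewrite ger0_norm; lra.
      by rewrite (le_trans (ler_root4 d16))// root4M ?root4X// exprn_ge0.
    have h : (root4 l)^-1 <= 2 * (root4 d)^-1.
      by rewrite ler_pdivlMr// mulrC ler_pdivrMr.
    rewrite [leRHS](_ : _ = 32 * ((root4 r ^+ 2)^-1 / root4 l) * (2 * (root4 d)^-1)); last by ring.
    by rewrite ler_wpM2l// ?mulr_ge0 ?invr_ge0 ?exprn_ge0 ?root4_ge0.
Qed.

(** The whole circle lies in the disc, so the argument of the first root is at least
    [l * (rho - (r + l))], and the second factor integrates to [pi]. *)
Lemma integral_radial_kern_in (r rho l : R) : 0 <= r -> 0 < l -> r + l < rho ->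
  (\int[mu]_p (radial_kern r rho l p)%:E <=
   (4 * (Num.sqrt l)^-1 * (Num.sqrt `|r + l - rho|)^-1)%:E)%E.
Proof.
move=> r0 l0 h.
have d0 : 0 < rho - (r + l) by rewrite subr_gt0.
rewrite distrC gtr0_norm//.
pose A := (Num.sqrt l)^-1 * (Num.sqrt (rho - (r + l)))^-1.
have A0 : 0 <= A by rewrite mulr_ge0 ?invr_ge0 ?sqrtr_ge0.
have mk := measurable_kern1 (l ^+ 2).
apply: (@le_trans _ _ (\int[mu]_p (A%:E * ((Num.sqrt (l ^+ 2 - p ^+ 2))^-1)%:E))%E).
  apply: ge0_le_integral => //=.
  - by move=> p _; rewrite lee_fin radial_kern_ge0.
  - by apply/measurable_EFinP; exact: measurable_radial_kern.
  - by apply: emeasurable_funM => //; exact/measurable_EFinP.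
  - move=> p _; rewrite -EFinM lee_fin.
    have [lp|pl] := leP l `|p|.
      by rewrite radial_kern_eq0 ?(ltW l0)// mulr_ge0 ?invr_ge0 ?sqrtr_ge0.
    rewrite ler_wpM2r ?invr_ge0 ?sqrtr_ge0// /A -invfM -sqrtrM ?(ltW l0)//.
    move: pl; rewrite ltr_norml => /andP[pl1 pl2].
    have rp : - (r * l) <= r * p by rewrite -mulrN ler_wpM2l// ltW.
    have N0 : l * (rho - (r + l)) <= rho ^+ 2 - r ^+ 2 - l ^+ 2 + 2 * r * p.
      have : 0 <= (rho - (r + l)) * (rho + r) by rewrite mulr_ge0//; lra.
      lra.
    rewrite lef_pV2 ?posrE ?sqrtr_gt0 ?ler_wsqrtr// ?mulr_gt0//.
    by rewrite (lt_le_trans _ N0)// mulr_gt0.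
rewrite ge0_integralZl//=; last first.
  by apply/measurable_EFinP.
have -> : (\int[mu]_p ((Num.sqrt (l ^+ 2 - p ^+ 2))^-1)%:E = pi%:E)%E.
  transitivity (\int[mu]_p (1 * ((Num.sqrt (l ^+ 2 - p ^+ 2))^-1)%R%:E))%E.
    by apply: eq_integral => p _; rewrite mul1e.
  rewrite (integral_kern1 l0 (g := fun=> 1%E))//.
  have pp : - (pi / 2) < pi / 2 :> R.
    by rewrite -subr_gt0 opprK addr_gt0// pihalf_gt0.
  rewrite integral_cst//= lebesgue_measure_itv/= lte_fin pp mul1e -EFinB.
  by congr EFin; field.
rewrite -EFinM lee_fin /A mulrC -mulrA ler_wpM2r ?mulr_ge0 ?invr_ge0 ?sqrtr_ge0//.
by have := @pihalf_lt2 R; lra.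
Qed.

End angular_kernel.

Section angular_kernel.
Context {R : realType}.
Local Notation mu := (@lebesgue_measure R).
Local Notation mu2 := (mu \x mu)%E.

(** The regimes [1 <= r], then [r < 1] with [r + l < rho], then [r < 1] with [rho <= r + l] produce
    the powers 1, 2 and 3 of [W], all at most [1 + W ^+ 3]. In the last one r^(-1/2) is not bounded;
    [d <= 2 * r] exchanges it for d^(-1/2). *)
Lemma integral_radial_kern (r rho l : R) : 0 <= r -> 0 < rho -> 0 < l ->
  r + l != rho ->
  (\int[mu]_p (radial_kern r rho l p)%:E <=
   (256 * (Num.sqrt (1 + r))^-1 * (Num.sqrt l)^-1 *
     (1 + root4 ((1 + l) / `|r + l - rho|) ^+ 3))%:E)%E.
Proof.
move=> r0 rho0 l0 rl.
set d := `|r + l - rho|.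
have d0 : 0 < d by rewrite normr_gt0 subr_eq0.
set W := root4 ((1 + l) / d).
have W0 : 0 <= W by exact: root4_ge0.
have W3 : 0 <= W ^+ 3 by exact: exprn_ge0.
have rhs0 : 0 <= 256 * (Num.sqrt (1 + r))^-1 * (Num.sqrt l)^-1 * (1 + W ^+ 3).
  by rewrite !mulr_ge0 ?ler0n ?invr_ge0 ?sqrtr_ge0 ?addr_ge0.
have [lr|lr] := leP rho `|l - r|.
  rewrite integral0_eq ?lee_fin// => p _.
  by rewrite radial_kern_out// ltW.
have W1 : W <= 1 + W ^+ 3.
  have [w1|w1] := leP W 1; first by rewrite (le_trans w1)// lerDl.
  by rewrite (@le_trans _ _ (W ^+ 3)) ?lerDr// ler_eXnr// ltW.
have W2 : W ^+ 2 <= 1 + W ^+ 3.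
  have [w1|w1] := leP W 1.
    by rewrite (@le_trans _ _ 1) ?lerDl// exprn_ile1.
  by rewrite (@le_trans _ _ (W ^+ 3)) ?lerDr// ler_weXn2l// ltW.
have ql := root4_gt0 l0; have qd := root4_gt0 d0.
have lW : root4 l / root4 d <= W.
  rewrite ler_pdivrMr// /W -root4M.
    by rewrite ler_root4// divfK ?gt_eqF//; lra.
  by rewrite divr_ge0 ?(ltW d0)//; lra.
have dW : (root4 d)^-1 <= W.
  rewrite -[leLHS]mul1r ler_pdivrMr// /W -root4M.
    rewrite divfK ?gt_eqF// (le_trans _ (@ler_root4 R 1 (1 + l) _))//; last lra.
    by rewrite /root4 !sqrtr1.
  by rewrite divr_ge0 ?(ltW d0)//; lra.
have sl0 : 0 < (Num.sqrt l)^-1 by rewrite invr_gt0 sqrtr_gt0.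
have s1r : 0 < Num.sqrt (1 + r) by rewrite sqrtr_gt0; lra.
have [r1|r1] := leP 1 r.
  have r0' : 0 < r by lra.
  apply: (le_trans (integral_radial_kern_root _ _ _ lr rl)) => //.
  rewrite lee_fin -/d.
  have h1 : (Num.sqrt r)^-1 <= 2 * (Num.sqrt (1 + r))^-1.
    rewrite ler_pdivlMr// mulrC ler_pdivrMr ?sqrtr_gt0//.
    have -> : 2 = Num.sqrt (2 ^+ 2) :> R by rewrite sqrtr_sqr ger0_norm.
    by rewrite -sqrtrM ?exprn_ge0// ler_wsqrtr//; lra.
  have h2 : (root4 l)^-1 * (root4 d)^-1 <= (Num.sqrt l)^-1 * (1 + W ^+ 3).
    rewrite -root4_sqr.
    have -> : (root4 l)^-1 * (root4 d)^-1 = (root4 l ^+ 2)^-1 * (root4 l / root4 d).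
      by field; rewrite !gt_eqF.
    by rewrite ler_wpM2l ?invr_ge0 ?exprn_ge0 ?root4_ge0// (le_trans lW).
  rewrite -!mulrA.
  apply: (@le_trans _ _ (64 * (2 * (Num.sqrt (1 + r))^-1 * ((Num.sqrt l)^-1 * (1 + W ^+ 3))))).
    rewrite ler_wpM2l// ler_pM ?mulr_ge0 ?invr_ge0 ?sqrtr_ge0 ?root4_ge0//.
  have := rhs0; rewrite -!mulrA.
  set z := (_ * (_ * (1 + _))); lra.
have h1 : 1 <= 2 * (Num.sqrt (1 + r))^-1.
  rewrite ler_pdivlMr// mul1r.
  have -> : 2 = Num.sqrt (2 ^+ 2) :> R by rewrite sqrtr_sqr ger0_norm.
  by rewrite ler_wsqrtr//; lra.
have fin B : 0 <= B -> B <= 1 + W ^+ 3 ->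
    ((128 * ((Num.sqrt l)^-1 * B))%:E <=
    (256 * (Num.sqrt (1 + r))^-1 * (Num.sqrt l)^-1 * (1 + W ^+ 3))%:E)%E.
  move=> B0 hB; rewrite lee_fin.
  have k1 : (Num.sqrt l)^-1 * B <= (Num.sqrt l)^-1 * (1 + W ^+ 3).
    by rewrite ler_wpM2l// ltW.
  rewrite -[leLHS]mul1r [leRHS](_ : _ = 2 * (Num.sqrt (1 + r))^-1 * (128 * ((Num.sqrt l)^-1 *
    (1 + W ^+ 3)))); last by ring.
  by apply: ler_pM => //; rewrite ?mulr_ge0 ?ler_wpM2l ?(ltW sl0).
have [rr|rr] := ltP (r + l) rho.
  apply: (le_trans (integral_radial_kern_in _ _ rr)) => //.
  rewrite -/d; apply: le_trans (fin (W ^+ 2) _ _); rewrite ?exprn_ge0//.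
  rewrite lee_fin -mulrA ler_pM ?mulr_ge0 ?invr_ge0 ?sqrtr_ge0//; first lra.
  rewrite ler_wpM2l ?(ltW sl0)// -root4_sqr -exprVn.
  by rewrite ler_sqr ?nnegrE ?invr_ge0 ?root4_ge0.
have r0' : 0 < r.
  by rewrite lt_neqAle r0 andbT; apply/eqP => r00; move: lr; rewrite -r00 subr0 gtr0_norm//; lra.
have d2r : d <= 2 * r.
  move: lr; rewrite ltr_norml /d ger0_norm; lra.
apply: (le_trans (integral_radial_kern_root _ _ _ lr rl)) => //.
rewrite -/d; apply: le_trans (fin (W ^+ 3) _ _); rewrite ?exprn_ge0 ?lerDr//.
rewrite lee_fin.
have h3 : (Num.sqrt r)^-1 <= 2 * (root4 d ^+ 2)^-1.
  rewrite root4_sqr ler_pdivlMr ?sqrtr_gt0// mulrC ler_pdivrMr ?sqrtr_gt0//.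
  have -> : 2 = Num.sqrt (2 ^+ 2) :> R by rewrite sqrtr_sqr ger0_norm.
  by rewrite -sqrtrM ?exprn_ge0// ler_wsqrtr//; lra.
rewrite -!mulrA.
have -> : 128 * ((Num.sqrt l)^-1 * W ^+ 3) = 64 * (2 * ((Num.sqrt l)^-1 * W ^+ 3)) by ring.
rewrite ler_wpM2l//.
apply: (@le_trans _ _ (2 * (root4 d ^+ 2)^-1 * ((root4 l)^-1 * (root4 d)^-1))).
  by rewrite ler_wpM2r// mulr_ge0 ?invr_ge0 ?root4_ge0.
rewrite -mulrA ler_wpM2l// -root4_sqr.
have -> : (root4 d ^+ 2)^-1 * ((root4 l)^-1 / root4 d) =
  (root4 l ^+ 2)^-1 * ((root4 d)^-1 ^+ 2 * (root4 l / root4 d)).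
  by field; rewrite !gt_eqF.
rewrite ler_wpM2l ?invr_ge0 ?exprn_ge0 ?root4_ge0// [W ^+ 3]exprSr ler_pM//.
- by rewrite exprn_ge0 ?invr_ge0 ?root4_ge0.
- by rewrite divr_ge0 ?root4_ge0.
- by rewrite ler_sqr ?nnegrE ?invr_ge0 ?root4_ge0.
Qed.

End angular_kernel.

(** * Polar coordinates *)

Section radial.
Context {R : realType}.
Local Notation mu := (@lebesgue_measure R).
Local Notation mu2 := (mu \x mu)%E.

Lemma measurable_enorm :
  measurable_fun [set: measurableTypeR R * measurableTypeR R] (@enorm R).
Proof.
apply: (measurableT_comp measurable_sqrtr).
by apply: measurable_funD; apply: measurable_funX;
  [exact: measurable_fst|exact: measurable_snd].
Qed.

Lemma enorm_ge0 (z : R * R) : 0 <= enorm z.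
Proof. exact: sqrtr_ge0. Qed.

Lemma sqr_enorm (z : R * R) : enorm z ^+ 2 = z.1 ^+ 2 + z.2 ^+ 2.
Proof. by rewrite sqr_sqrtr// addr_ge0// sqr_ge0. Qed.

Lemma ler_abs1_enorm (z : R * R) : `|z.1| <= enorm z.
Proof. by rewrite -sqrtr_sqr ler_wsqrtr// lerDl sqr_ge0. Qed.

Lemma ler_abs2_enorm (z : R * R) : `|z.2| <= enorm z.
Proof. by rewrite -sqrtr_sqr ler_wsqrtr// lerDr sqr_ge0. Qed.

(** The coordinates are [p = y.1] and [l = enorm y], so no angle appears: at fixed [p] one has dy.2
    = l (l^2 - p^2)^(-1/2) dl on each half line. *)
Definition polar_weight (p l : R) : R :=
  if 0 < l then l * (Num.sqrt (l ^+ 2 - p ^+ 2))^-1 else 0.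

Lemma polar_weight_ge0 p l : 0 <= polar_weight p l.
Proof.
by rewrite /polar_weight; case: ltP => // l0; rewrite mulr_ge0 ?(ltW l0)// invr_ge0 sqrtr_ge0.
Qed.

Lemma measurable_polar_weight :
  measurable_fun [set: measurableTypeR R * measurableTypeR R]
    (fun z : R * R => polar_weight z.1 z.2).
Proof.
have m1 := @measurable_fst12 R; have m2 := @measurable_snd12 R.
apply: measurable_fun_ifT => //.
- by apply: measurable_fun_ltr.
- apply: measurable_funM => //; apply: (measurableT_comp measurable_invr).
  apply: (measurableT_comp measurable_sqrtr).
  by apply: measurable_funB; apply: measurable_funX.
Qed.

Lemma is_derive_sqrt_sqrD (p y : R) : p != 0 ->
  is_derive y (1 : R) (fun y : R => Num.sqrt (p ^+ 2 + y ^+ 2))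
    (y / Num.sqrt (p ^+ 2 + y ^+ 2)).
Proof.
move=> pN0.
have q0 : 0 < p ^+ 2 + y ^+ 2.
  by rewrite ltr_wpDr ?sqr_ge0// lt_neqAle eq_sym sqrf_eq0 pN0 sqr_ge0.
have d1 : is_derive y (1 : R) (fun y : R => p ^+ 2 + y ^+ 2) (2 * y).
  by apply: is_derive_eq; rewrite /GRing.scale/=; ring.
have := @is_derive1_comp R Num.sqrt (fun y => p ^+ 2 + y ^+ 2) y _ _
  (is_derive1_sqrt q0) d1.
rewrite (_ : _ * _ = y / Num.sqrt (p ^+ 2 + y ^+ 2))//.
by field; rewrite gt_eqF// sqrtr_gt0.
Qed.

(** Substitute [l = enorm (p, y)] on the half line [0 <= y], which evenness in [y] doubles. The
    condition [p != 0] keeps the square root differentiable at [y = 0], and [M] reduces the half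
    line to a segment. *)
Lemma integral_section_polar (M p : R) (h : R * R -> \bar R) :
  measurable_fun [set: measurableTypeR R * measurableTypeR R] h ->
  (forall z, 0 <= h z)%E -> 0 < M -> p != 0 ->
  (forall l, `|p| <= l -> M < l -> h (p, l) = 0%E) ->
  (\int[mu]_y h (p, enorm (p, y)) <=
   \int[mu]_l (h (p, l) * (2 * polar_weight p l)%:E))%E.
Proof.
move=> mh h0 M0 pN0 hM.
have mhp := measurable_sec1 p mh.
pose phi y := Num.sqrt (p ^+ 2 + y ^+ 2).
have phiE y : enorm (p, y) = phi y by [].
have dphi (y : R) : is_derive y (1 : R) phi (y / phi y) by exact: is_derive_sqrt_sqrD.
have phi0 y : 0 < phi y.
  by rewrite sqrtr_gt0 ltr_wpDr ?sqr_ge0// lt_neqAle eq_sym sqrf_eq0 pN0 sqr_ge0.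
have cphi := is_derive_continuous dphi.
have mphi : measurable_fun [set: measurableTypeR R] phi.
  exact: continuous_measurable_fun.
have mG : measurable_fun [set: measurableTypeR R] (fun y => h (p, phi y)).
  exact: (measurableT_comp mhp mphi).
pose g l := (h (p, l) * (polar_weight p l)%:E)%E.
have mpw : measurable_fun [set: measurableTypeR R] (fun l => (polar_weight p l)%:E).
  apply/measurable_EFinP; have := measurable_sec1 p (f := EFin \o (fun z : R * R =>
    polar_weight z.1 z.2)).
  move=> /(_ _)/measurable_EFinP; apply; apply/measurable_EFinP.
  exact: measurable_polar_weight.
have mg : measurable_fun [set: measurableTypeR R] g by exact: emeasurable_funM.
have g0 l : (0 <= g l)%E by rewrite mule_ge0// lee_fin polar_weight_ge0.
under eq_integral do rewrite phiE.
rewrite (integral_even mG)//; last by move=> y; rewrite /phi sqrrN.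
suff key : (\int[mu]_(y in `[0%R, +oo[) h (p, phi y) <= \int[mu]_l g l)%E.
  apply: (le_trans (leeD key key)); rewrite -ge0_integralD//.
  apply: ge0_le_integral => //=.
  - by move=> l _; rewrite adde_ge0.
  - exact: emeasurable_funD.
  - apply: emeasurable_funM => //; apply/measurable_EFinP.
    by apply: measurable_funM => //; exact/measurable_EFinP.
  - move=> l _; rewrite /g -ge0_muleDr ?lee_fin ?polar_weight_ge0//.
    by rewrite -EFinD -mulr2n mulr_natl.
have -> : (\int[mu]_(y in `[0%R, +oo[) h (p, phi y) =
    \int[mu]_(y in `[0%R, M]) h (p, phi y))%E.
  apply: eq_integral_support => y /=; rewrite !in_itv/= andbT; last first.
    by move=> /andP[->].
  move=> y0; rewrite y0/= => /negP; rewrite -ltNge => My; apply: hM.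
    exact: (ler_abs1_enorm (p, y)).
  apply: (lt_le_trans My); rewrite (le_trans (ler_norm _))//.
  exact: (ler_abs2_enorm (p, y)).
have := @ge0_change_of_variables R phi (fun y => y / phi y) 0 M M0 dphi _ _ _ g mg g0.
move=> sub.
apply: (@le_trans _ _ (\int[mu]_(l in `[phi 0%R, phi M]) g l)%E); last first.
  exact: ge0_subset_integral.
rewrite sub; last first.
- move=> x y /=; rewrite !in_itv/= => /andP[x0 _] /andP[y0 _] xy.
  rewrite ltr_sqrt; first by rewrite ltrD2l ltr_sqr.
  by rewrite ltr_wpDr ?sqr_ge0// lt_neqAle eq_sym sqrf_eq0 pN0 sqr_ge0.
- by move=> y /andP[y0 _]; rewrite divr_ge0// ltW.
- move=> y; apply: cvgM; first exact: cvg_id.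
  by apply: (continuous_comp (cphi y)); apply: inv_continuous; rewrite gt_eqF.
have mf : measurable_fun [set: measurableTypeR R]
    (fun x => g (phi x) * (x / phi x)%:E)%E.
  apply: emeasurable_funM; first exact: (measurableT_comp mg mphi).
  apply/measurable_EFinP; apply: measurable_funM => //.
  exact: (measurableT_comp measurable_invr mphi).
rewrite [leLHS]integral_itv_bndoo; last exact: measurable_funTS.
rewrite [leRHS]integral_itv_bndoo; last exact: measurable_funTS.
rewrite le_eqVlt; apply/orP; left; apply/eqP; apply: eq_integral => y.
rewrite inE/= in_itv/= => /andP[y0 _].
rewrite /g /polar_weight phi0 -muleA -EFinM.
rewrite (_ : _ * _ = 1) ?mule1//.
have -> : phi y ^+ 2 - p ^+ 2 = y ^+ 2.
  by rewrite sqr_sqrtr ?addr_ge0 ?sqr_ge0//; ring.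
rewrite sqrtr_sqr gtr0_norm//.
by field; rewrite !gt_eqF.
Qed.

(** The sections at [p != 0] suffice, since the line [p = 0] is a null set. *)
Lemma integral_polar_le (M : R) (h : R * R -> \bar R) :
  measurable_fun [set: measurableTypeR R * measurableTypeR R] h ->
  (forall z, 0 <= h z)%E -> 0 < M ->
  (forall p l, `|p| <= l -> M < l -> h (p, l) = 0%E) ->
  (\int[mu2]_z h (z.1, enorm z) <=
   \int[mu]_l \int[mu]_p (h (p, l) * (2 * polar_weight p l)%:E))%E.
Proof.
move=> mh h0 M0 hM.
have mH : measurable_fun [set: measurableTypeR R * measurableTypeR R]
    (fun z : R * R => h (z.1, enorm z)).
  apply: (measurableT_comp mh); apply: measurable_fun_pair.
    exact: measurable_fst.
  exact: measurable_enorm.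
have mw : measurable_fun [set: measurableTypeR R * measurableTypeR R]
    (fun z : R * R => h z * (2 * polar_weight z.1 z.2)%:E)%E.
  apply: emeasurable_funM => //; apply/measurable_EFinP.
  by apply: measurable_funM => //; exact: measurable_polar_weight.
have w0 z : (0 <= h z * (2 * polar_weight z.1 z.2)%:E)%E.
  by rewrite mule_ge0// lee_fin mulr_ge0// polar_weight_ge0.
rewrite (integral2E mH (fun=> h0 _)).
have <- := integral2_swap mw w0.
apply: ae_ge0_le_integral => //=.
- by move=> p _; apply: integral_ge0.
- exact: (measurable_integral1 mH (fun=> h0 _)).
- by move=> p _; apply: integral_ge0 => l _; exact: (w0 (p, l)).
- exact: (measurable_integral1 mw w0).
exists [set 0]; split => //; first exact: lebesgue_measure_set1.
move=> p /=; apply: contra_notP => pN0 _.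
apply: (integral_section_polar mh h0 M0); first exact/eqP.
by move=> l; exact: hM.
Qed.

End radial.

(** * The disc kernel against radial weights *)

Section disc_bound.
Context {R : realType}.
Local Notation mu := (@lebesgue_measure R).
Local Notation mu2 := (mu \x mu)%E.

Lemma integral2_dot (x : R * R) (H : R * R -> \bar R) :
  measurable_fun [set: measurableTypeR R * measurableTypeR R] H ->
  (forall z, 0 <= H z)%E ->
  (\int[mu2]_y H (x.1 * y.1 + x.2 * y.2, enorm y)%R =
   \int[mu2]_y H (enorm x * y.1, enorm y)%R)%E.
Proof.
move=> mH H0.
have [x0|xN0] := eqVneq (enorm x) 0.
  have [x1 x2] : x.1 = 0 /\ x.2 = 0.
    have := sqr_enorm x; rewrite x0 expr0n/= => /esym/eqP.
    by rewrite paddr_eq0 ?sqr_ge0// !sqrf_eq0 => /andP[/eqP-> /eqP->].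
  by rewrite x0 x1 x2; apply: eq_integral => y _; rewrite !mul0r addr0.
pose c := x.1 / enorm x; pose s := x.2 / enorm x.
have cs : c ^+ 2 + s ^+ 2 = 1.
  by rewrite /c /s !expr_div_n -mulrDl -sqr_enorm divff// expf_neq0.
have mF : measurable_fun [set: measurableTypeR R * measurableTypeR R]
    (fun y : R * R => H (x.1 * y.1 + x.2 * y.2, enorm y)).
  apply: (measurableT_comp mH); apply: measurable_fun_pair; last exact: measurable_enorm.
  apply: measurable_funD; apply: measurable_funM => //.
have xc : x.1 = enorm x * c by rewrite /c mulrC divfK.
have xs : x.2 = enorm x * s by rewrite /s mulrC divfK.
have dotE (y1 y2 : R) :
    x.1 * (c * y1 - s * y2) + x.2 * (s * y1 + c * y2) = enorm x * y1.
  by rewrite xc xs -[RHS]mulr1 -cs; ring.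
have sqrE (y1 y2 : R) :
    (c * y1 - s * y2) ^+ 2 + (s * y1 + c * y2) ^+ 2 = y1 ^+ 2 + y2 ^+ 2.
  by rewrite -[RHS]mulr1 -cs; ring.
rewrite -(integral2_rotation cs mF (fun=> H0 _)).
apply: eq_integral => -[y1 y2] _.
by rewrite /= dotE /enorm/= sqrE.
Qed.

(** The bound of [integral_radial_kern] stripped of its constant and of its powers of [1 + r] and
    [l], and set to [0] for circles that miss the disc. *)
Definition cone_factor (r rho l : R) : R :=
  if (0 < l) && (`|l - r| < rho) then
    1 + root4 ((1 + l) / `|r + l - rho|) ^+ 3 else 0.

Lemma cone_factor_ge0 r rho l : 0 <= cone_factor r rho l.
Proof.
by rewrite /cone_factor; case: ifP => // _; rewrite addr_ge0// exprn_ge0// root4_ge0.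
Qed.

Lemma measurable_cone_factor d (T : measurableType d) (r rho l : T -> R) :
  measurable_fun setT r -> measurable_fun setT rho -> measurable_fun setT l ->
  measurable_fun setT (fun x => cone_factor (r x) (rho x) (l x)).
Proof.
move=> mr mrho ml; apply: measurable_fun_ifT.
- apply: measurable_and; apply: measurable_fun_ltr => //.
  by apply: (measurableT_comp (@normr_measurable R setT)); exact: measurable_funB.
- apply: measurable_funD => //; apply: measurable_funX.
  apply: (measurableT_comp measurable_root4); apply: measurable_funM.
    exact: measurable_funD.
  apply: (measurableT_comp measurable_invr).
  apply: (measurableT_comp (@normr_measurable R setT)); apply: measurable_funB => //.
  exact: measurable_funD.
- exact: measurable_cst.
Qed.

Lemma kern_sub_dot (rho : R) (x y : R * R) :
  kern rho (x - y) = (Num.sqrt (rho ^+ 2 - enorm x ^+ 2 - enorm y ^+ 2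
    + 2 * (x.1 * y.1 + x.2 * y.2)))^-1.
Proof. by rewrite /kern !sqr_enorm /=; congr (Num.sqrt _)^-1; ring. Qed.

(** Once [x] is rotated onto the first axis, the integrand depends on [p] and [l] only. The Jacobian
    [l] cancels two factors l^(-1/2), that of the weight and that of [integral_radial_kern]. *)
Lemma integral_kern_radial_le (x : R * R) (rho : R) (w : R -> R) : 0 < rho ->
  measurable_fun [set: measurableTypeR R] w -> (forall l, 0 <= w l) ->
  (\int[mu2]_y ((Num.sqrt (enorm y))^-1 * w (enorm y) * kern rho (x - y))%:E <=
   (512 / Num.sqrt (1 + enorm x))%:E *
   \int[mu]_l (w l * cone_factor (enorm x) rho l)%:E)%E.
Proof.
move=> rho0 mw w0; set r := enorm x.
have r0 : 0 <= r by exact: enorm_ge0.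
have ms1 := @measurable_fst12 R; have ms2 := @measurable_snd12 R.
pose g l := (Num.sqrt l)^-1 * w l.
have g0 l : 0 <= g l by rewrite mulr_ge0// invr_ge0 sqrtr_ge0.
have mg : measurable_fun [set: measurableTypeR R] g.
  by apply: measurable_funM => //; apply: (measurableT_comp measurable_invr measurable_sqrtr).
pose H (z : R * R) := ((g z.2) *
  (Num.sqrt (rho ^+ 2 - r ^+ 2 - z.2 ^+ 2 + 2 * z.1))^-1)%:E.
have mN (a : R) : measurable_fun [set: measurableTypeR R * measurableTypeR R]
    (fun z : R * R => ((g z.2) *
      (Num.sqrt (rho ^+ 2 - r ^+ 2 - z.2 ^+ 2 + 2 * (a * z.1)))^-1)%:E).
  apply/measurable_EFinP; apply: measurable_funM; first exact: (measurableT_comp mg ms2).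
  apply: (measurableT_comp measurable_invr); apply: (measurableT_comp measurable_sqrtr).
  apply: measurable_funD; first by apply: measurable_funB => //; exact: measurable_funX.
  by apply: measurable_funM => //; exact: measurable_funM.
have mH : measurable_fun [set: measurableTypeR R * measurableTypeR R] H.
  by apply: eq_measurable_fun (mN 1) => z _; rewrite /H mul1r.
have H0 z : (0 <= H z)%E by rewrite lee_fin mulr_ge0// invr_ge0 sqrtr_ge0.
rewrite [leLHS](_ : _ = \int[mu2]_y H (x.1 * y.1 + x.2 * y.2, enorm y)%R)%E; last first.
  by apply: eq_integral => y _; rewrite kern_sub_dot.
rewrite integral2_dot// -/r.
pose h (z : R * R) := H (r * z.1, z.2).
have h0 z : (0 <= h z)%E by exact: H0.
have M0 : 0 < r + rho by rewrite ltr_wpDl.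
rewrite (le_trans (integral_polar_le (h := h) (mN r) h0 M0 _))//.
  move=> p l pl rl; rewrite /h /H /= ler0_sqrtr ?invr0 ?mulr0//.
  have l0 : 0 <= l by exact: le_trans pl.
  have : r * p <= r * l by rewrite ler_wpM2l// (le_trans (ler_norm _)).
  have : rho ^+ 2 <= (l - r) ^+ 2 by rewrite ler_sqr ?nnegrE; lra.
  by rewrite sqrrB; lra.
have inner l : (\int[mu]_p (h (p, l) * (2 * polar_weight p l)%:E) =
   (if (0 < l)%R then (2 * l * g l)%:E * \int[mu]_p (radial_kern r rho l p)%:E else 0))%E.
  case: ltP => l0; last first.
    rewrite integral0_eq// => p _; rewrite /polar_weight ltNge l0/= mulr0.
    by rewrite mule0.
  rewrite -ge0_integralZl//=; last 3 first.
  - by apply/measurable_EFinP; exact: measurable_radial_kern.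
  - by move=> p _; rewrite lee_fin radial_kern_ge0.
  - by rewrite lee_fin mulr_ge0// mulr_ge0// ltW.
  apply: eq_integral => p _; rewrite /h /H /= -EFinM /polar_weight l0.
  by rewrite /radial_kern mulrA -EFinM; congr EFin; ring.
have k0 : 0 <= 512 / Num.sqrt (1 + r) by rewrite mulr_ge0 ?ler0n// invr_ge0 sqrtr_ge0.
have mwc : measurable_fun [set: measurableTypeR R]
    (fun l => (w l * cone_factor r rho l)%:E).
  apply/measurable_EFinP; apply: measurable_funM => //.
  exact: measurable_cone_factor.
have -> : ((512 / Num.sqrt (1 + r))%:E *
      \int[mu]_l (w l * cone_factor r rho l)%:E =
    \int[mu]_l ((512 / Num.sqrt (1 + r))%:E * (w l * cone_factor r rho l)%:E))%E.
  have wc0 l : setT l -> (0 <= (w l * cone_factor r rho l)%:E)%E.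
    by rewrite lee_fin mulr_ge0// cone_factor_ge0.
  exact: esym (ge0_integralZl_EFin mu measurableT wc0 mwc k0).
have mhw : measurable_fun [set: measurableTypeR R * measurableTypeR R]
    (fun z : R * R => h z * (2 * polar_weight z.1 z.2)%:E)%E.
  apply: emeasurable_funM; first exact: (mN r).
  apply/measurable_EFinP; apply: measurable_funM => //.
  exact: measurable_polar_weight.
have hw0 z : (0 <= h z * (2 * polar_weight z.1 z.2)%:E)%E.
  by rewrite mule_ge0// lee_fin mulr_ge0// polar_weight_ge0.
apply: ae_ge0_le_integral.
- exact: measurableT.
- by move=> l _; apply: integral_ge0 => p _; exact: (hw0 (p, l)).
- exact: (measurable_integral2 mhw hw0).
- by move=> l _; apply: mule_ge0; rewrite lee_fin// mulr_ge0// cone_factor_ge0.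
- exact: emeasurable_funM (measurable_cst _) mwc.
(* At [l = rho - r] the convention [0^-1 = 0] makes [cone_factor] finite although the angular
   integral may not be; this radius is excluded as a null set. *)
exists [set (rho - r)]; split => //; first exact: lebesgue_measure_set1.
move=> l /=; apply: contra_notP => lN _; rewrite inner.
case: ltP => l0; last first.
  by apply: mule_ge0; rewrite lee_fin// mulr_ge0// cone_factor_ge0.
have [lr|lr] := leP rho `|l - r|.
  rewrite integral0_eq ?mule0; last first.
    by move=> p _; rewrite radial_kern_out// ltW.
  by apply: mule_ge0; rewrite lee_fin// mulr_ge0// cone_factor_ge0.
have rl : r + l != rho.
  by apply/eqP => rl; apply: lN; rewrite -rl addrC addKr.
have := integral_radial_kern r0 rho0 l0 rl => K.
apply: (le_trans (lee_wpmul2l _ K)); first by rewrite lee_fin mulr_ge0// mulr_ge0// ltW.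
rewrite /cone_factor l0 lr/= -!EFinM lee_fin /g.
rewrite le_eqVlt; apply/orP; left; apply/eqP.
have sl : Num.sqrt l ^+ 2 = l by rewrite sqr_sqrtr// ltW.
have sl0 : 0 < Num.sqrt l by rewrite sqrtr_gt0.
have s1 : 0 < Num.sqrt (1 + r) by rewrite sqrtr_gt0; lra.
rewrite -{1}sl.
set W := (1 + root4 _ ^+ 3).
move: sl0 s1; set u := Num.sqrt l; set v := Num.sqrt _ => u0 v0.
by field; rewrite !gt_eqF.
Qed.

End disc_bound.

(** * Decaying weights and integrable singularities in time *)

Section decay.
Context {R : realType}.
Local Notation mu := (@lebesgue_measure R).

Definition decay (e z : R) : R := (z `^ (1 + e))^-1.

Lemma decay_ge0 e z : 0 <= decay e z.
Proof. by rewrite invr_ge0 powR_ge0. Qed.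

Lemma ler_decay e z z' : 0 <= e -> 0 < z -> z <= z' -> decay e z' <= decay e z.
Proof.
move=> e0 z0 zz'; have z'0 := lt_le_trans z0 zz'.
rewrite /decay lef_pV2 ?posrE ?powR_gt0//.
by apply: ge0_ler_powR; rewrite ?nnegrE ?(ltW z0) ?(ltW z'0) ?addr_ge0.
Qed.

Lemma decay_le_inv e z : 0 <= e -> 1 <= z -> decay e z <= z^-1.
Proof.
move=> e0 z1; have z0 : 0 < z by lra.
rewrite /decay lef_pV2 ?posrE ?powR_gt0// -{1}(powRr1 (ltW z0)).
by rewrite ler_powR//; lra.
Qed.

Lemma decayM e z z' : 0 <= z -> 0 <= z' -> decay e (z * z') = decay e z * decay e z'.
Proof. by move=> z0 z'0; rewrite /decay powRM// invfM. Qed.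

Lemma measurable_decay d (T : measurableType d) (f : T -> R) e :
  measurable_fun setT f -> measurable_fun setT (fun x => decay e (f x)).
Proof.
move=> mf; apply: (measurableT_comp measurable_invr).
by apply: (measurableT_comp (measurable_powR (1 + e))).
Qed.

Lemma measurable_cusp2 d (T : measurableType d) (L f : T -> R) :
  measurable_fun setT L -> measurable_fun setT f ->
  measurable_fun setT (fun x => cusp (L x) (f x)).
Proof.
move=> mL mf; have mn := measurableT_comp (@normr_measurable R setT) mf.
apply: measurable_fun_ifT => //.
- exact: measurable_fun_ltr.
- apply: (measurableT_comp measurable_invr); apply: measurable_funX.
  exact: (measurableT_comp measurable_root4 mn).
Qed.

(** Normalized to have integral at most 8 whatever the scale [X], which below varies with the
    position of the singularity. *)
Definition bump (X u : R) : R := (root4 X)^-1 * cusp X u.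

Lemma bump_ge0 X u : 0 <= bump X u.
Proof. by rewrite mulr_ge0 ?cusp_ge0// invr_ge0 root4_ge0. Qed.

Lemma measurable_bump d (T : measurableType d) (L f : T -> R) :
  measurable_fun setT L -> measurable_fun setT f ->
  measurable_fun setT (fun x => bump (L x) (f x)).
Proof.
move=> mL mf; apply: measurable_funM; last exact: measurable_cusp2.
apply: (measurableT_comp measurable_invr).
exact: (measurableT_comp measurable_root4 mL).
Qed.

Lemma integral_bump (X c : R) : (\int[mu]_u (bump X (u - c))%:E <= 8%:E)%E.
Proof.
have [X0|X0] := leP X 0.
  rewrite integral0_eq ?lee_fin// => u _; rewrite /bump /cusp ltNge.
  by rewrite (le_trans X0)//= mulr0.
under eq_integral do rewrite EFinM.
rewrite ge0_integralZl//=; last 3 first.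
- apply/measurable_EFinP; apply: (measurableT_comp (measurable_cusp X)).
  exact: measurable_funB.
- by move=> u _; rewrite lee_fin cusp_ge0.
- by rewrite lee_fin invr_ge0 root4_ge0.
apply: (@le_trans _ _ ((root4 X)^-1%:E * (8 * root4 X)%:E)%E).
  by rewrite lee_wpmul2l ?integral_cusp// lee_fin invr_ge0 root4_ge0.
by rewrite -EFinM mulrCA mulVf ?mulr1// gt_eqF// root4_gt0.
Qed.

(* At distance [> A/(2K)] from [s0] the second factor is bounded; otherwise [A]
   is comparable with its value [X] at [s0]. *)
Lemma decay_singular_le (k g : R) : 0 < g ->
  exists2 C : R, 0 < C & forall e b s0 s m, 0 <= e -> 0 <= m ->
    let A := b + k * s in let X := b + k * s0 in 1 + m <= A ->
    decay e A * (1 + root4 (A / (g * `|s - s0|)) ^+ 3) <=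
    C * (decay e (1 + m) + bump X (s - s0)).
Proof.
move=> g0; pose K := 1 + `|k|.
have K1 : 1 <= K by rewrite lerDl.
have K0 : 0 < K by lra.
pose c1 := root4 (2 * K / g); pose c2 := root4 (2 / g).
have c10 : 0 <= c1 ^+ 3 by rewrite exprn_ge0// root4_ge0.
have c20 : 0 <= c2 ^+ 3 by rewrite exprn_ge0// root4_ge0.
exists (1 + c1 ^+ 3 + 2 * c2 ^+ 3); first by lra.
move=> e b s0 s m e0 m0 A X mA.
have A0 : 0 < A by lra.
have dA : decay e A <= decay e (1 + m) by apply: ler_decay => //; lra.
have d0 := decay_ge0 e A; have b0 := bump_ge0 X (s - s0).
set u := `|s - s0|; have u0 : 0 <= u by exact: normr_ge0.
have [far|near] := leP A (2 * K * u).
  have u0' : 0 < u.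
    by rewrite lt_neqAle u0 andbT; apply/eqP => u00; move: far; rewrite -u00; lra.
  have h : root4 (A / (g * u)) ^+ 3 <= c1 ^+ 3.
    rewrite lerXn2r ?nnegrE ?root4_ge0// ler_root4//.
    rewrite ler_pdivrMr ?mulr_gt0//.
    rewrite (_ : 2 * K / g * (g * u) = 2 * K * u)//.
    by field; rewrite gt_eqF.
  apply: (@le_trans _ _ ((1 + c1 ^+ 3) * decay e (1 + m))).
    by rewrite mulrC; apply: ler_pM => //; rewrite ?lerD2l// addr_ge0// exprn_ge0// root4_ge0.
  have d1 := decay_ge0 e (1 + m).
  apply: ler_pM => //; [lra|lra|].
  by rewrite lerDl.
have AX : `|A - X| <= K * u.
  rewrite /A /X opprD addrACA subrr add0r -mulrBr normrM.
  by rewrite ler_wpM2r// /K lerDr.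
move: AX; rewrite ler_distl => /andP[AX1 AX2].
have XA1 : A <= 2 * X by lra.
have X0 : 0 < X by lra.
have XA2 : X <= 2 * A by lra.
have uX : u < X by have : u <= K * u by [rewrite ler_peMl]; lra.
rewrite mulrDr mulr1.
apply: (@le_trans _ _ (decay e (1 + m) + 2 * c2 ^+ 3 * bump X (s - s0))); last first.
  rewrite mulrDr; apply: lerD.
    by rewrite -[leLHS]mul1r ler_wpM2r ?decay_ge0//; lra.
  by rewrite ler_wpM2r//; lra.
apply: lerD => //.
(* At the singular time itself the convention [0^-1 = 0] removes the singular term. *)
have [u00|uN0] := eqVneq u 0.
  rewrite u00 mulr0 invr0 mulr0 /root4 !sqrtr0 expr0n/= mulr0.
  by rewrite mulr_ge0// mulr_ge0.
have u0' : 0 < u by rewrite lt_neqAle eq_sym uN0.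
rewrite /bump /cusp uX.
have qX := root4_gt0 X0; have qu := root4_gt0 u0'.
have h1 : decay e A <= 2 * (root4 X ^+ 4)^-1.
  rewrite root4K ?(ltW X0)//.
  apply: (@le_trans _ _ A^-1); first by apply: decay_le_inv => //; lra.
  by rewrite -[leLHS]mul1r ler_pdivrMr// mulrAC ler_pdivlMr// mul1r.
have h2 : root4 (A / (g * u)) ^+ 3 <= c2 ^+ 3 * (root4 X / root4 u) ^+ 3.
  rewrite -exprMn lerXn2r ?nnegrE ?mulr_ge0 ?invr_ge0 ?root4_ge0//.
  rewrite mulrA ler_pdivlMr// -!root4M ?divr_ge0 ?mulr_ge0 ?(ltW g0) ?(ltW A0)//.
  have -> : A / (g * u) * u = A / g by field; rewrite !gt_eqF.
  by rewrite ler_root4// [2 / g * X]mulrAC ler_wpM2r// invr_ge0 ltW.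
(* X^(-1) (X / u)^(3/4) = X^(-1/4) u^(-3/4), the value of the bump. *)
apply: (@le_trans _ _ (2 * (root4 X ^+ 4)^-1 * (c2 ^+ 3 * (root4 X / root4 u) ^+ 3))).
  by apply: ler_pM => //; rewrite exprn_ge0// root4_ge0.
rewrite le_eqVlt; apply/orP; left; apply/eqP; field.
by rewrite !gt_eqF.
Qed.

Lemma integral_FTC (F f : R -> R) (T : R) : 0 < T ->
  (forall u : R, 0 <= u -> is_derive u (1 : R) F (f u)) ->
  (forall u : R, 0 <= u -> {for u, continuous f}) ->
  (\int[mu]_(u in `[0%R, T]) (f u)%:E = (F T - F 0)%:E)%E.
Proof.
move=> T0 dF cf.
have cF (u : R) : 0 <= u -> {for u, continuous F}.
  move=> u0; apply/differentiable_continuous/derivable1_diffP.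
  by case: (dF u u0).
rewrite (continuous_FTC2 (F := F) T0) ?EFinB//.
- apply: continuous_in_subspaceT => u; rewrite inE/= in_itv/= => /andP[u0 _].
  exact: cf.
- split.
  + by move=> u; rewrite in_itv/= => /andP[u0 _]; case: (dF u (ltW u0)).
  + exact/cvg_at_right_filter/cF.
  + exact/cvg_at_left_filter/cF/ltW.
- move=> u; rewrite in_itv/= => /andP[u0 _]; rewrite derive1E.
  by have [_ ->] := dF u (ltW u0).
Qed.

Lemma is_derive_1D (u : R) : is_derive u (1 : R) (fun u : R => 1 + u) 1.
Proof. by rewrite -[X in is_derive _ _ _ X]add0r; exact: is_deriveD. Qed.

Lemma is_derive_powR1D (a u : R) : 0 <= u ->
  is_derive u (1 : R) (fun u : R => (1 + u) `^ a) (a * (1 + u) `^ (a - 1)).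
Proof.
move=> u0; have u1 : 0 < 1 + u by lra.
have d1 : is_derive u (1 : R) (fun u : R => 1 + u) 1.
  exact: is_derive_1D.
have := @is_derive1_comp R (@powR R ^~ a) (fun u => 1 + u) u _ _
  (is_derive1_powR a u1) d1.
by rewrite mulr1.
Qed.

Lemma continuous_decay1D (e u : R) : 0 <= u ->
  {for u, continuous (fun u : R => decay e (1 + u))}.
Proof.
move=> u0; have u1 : 0 < 1 + u by lra.
apply: (@continuous_comp _ _ _ (fun u : R => (1 + u) `^ (1 + e)) GRing.inv).
  apply/differentiable_continuous/derivable1_diffP.
  by case: (is_derive_powR1D (1 + e) u0).
by apply: inv_continuous; rewrite gt_eqF// powR_gt0.
Qed.

Lemma integral_decay (e T : R) : 0 < e -> 0 <= T ->
  (\int[mu]_(u in `[0%R, T]) (decay e (1 + u))%:E <= (e^-1)%:E)%E.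
Proof.
move=> e0; rewrite le_eqVlt => /predU1P[<-|T0].
  by rewrite set_itv1 integral_set1 lee_fin invr_ge0 ltW.
have dF (u : R) : 0 <= u ->
    is_derive u (1 : R) (fun u : R => - e^-1 * (1 + u) `^ (- e)) (decay e (1 + u)).
  move=> u0; have d := is_derive_powR1D (- e) u0.
  have := is_deriveZ (- e^-1) d.
  rewrite (_ : _ *: _ = decay e (1 + u))//.
  rewrite /decay -powRN /GRing.scale/= mulrA mulrNN mulVf ?gt_eqF// mul1r.
  by congr (_ `^ _); ring.
rewrite (integral_FTC T0 dF); last by move=> u; exact: continuous_decay1D.
rewrite lee_fin addr0 powR1 mulr1 opprK mulNr addrC gerBl.
by rewrite mulr_ge0 ?powR_ge0// invr_ge0 ltW.
Qed.

(** The borderline exponent [e = 0], source of the logarithm in the second estimate. *)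
Lemma integral_decay0 (T : R) : 0 <= T ->
  (\int[mu]_(u in `[0%R, T]) (decay 0 (1 + u))%:E <= (ln (1 + T))%:E)%E.
Proof.
rewrite le_eqVlt => /predU1P[<-|T0].
  by rewrite set_itv1 integral_set1 addr0 ln1.
have dF (u : R) : 0 <= u ->
    is_derive u (1 : R) (fun u : R => ln (1 + u)) (decay 0 (1 + u)).
  move=> u0; have u1 : 0 < 1 + u by lra.
  have d1 : is_derive u (1 : R) (fun u : R => 1 + u) 1 by exact: is_derive_1D.
  have := @is_derive1_comp R (@ln R) (fun u => 1 + u) u _ _
    (is_derive1_ln u1) d1.
  by rewrite mulr1 /decay addr0 powRr1// ltW.
rewrite (integral_FTC T0 dF); last by move=> u; exact: continuous_decay1D.
by rewrite addr0 ln1 subr0.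
Qed.

Lemma integral_decay_line (e : R) : 0 < e ->
  (\int[mu]_u (decay e (1 + `|u|))%:E <= (2 * e^-1)%:E)%E.
Proof.
move=> e0.
have mD : measurable_fun [set: measurableTypeR R] (fun u : R => decay e (1 + `|u|)).
  by apply: measurable_decay; apply: measurable_funD.
rewrite (integral_even (g := fun u => (decay e (1 + `|u|))%:E)); last 3 first.
- exact/measurable_EFinP.
- by move=> u; rewrite lee_fin decay_ge0.
- by move=> u; rewrite normrN.
have -> : 2 * e^-1 = e^-1 + e^-1 by ring.
rewrite EFinD.
suff h : (\int[mu]_(u in `[0%R, +oo[) (decay e (1 + `|u|))%:E <= (e^-1)%:E)%E by exact: leeD.
rewrite ge0_integral_ereal_sup//; last by move=> u; exact: decay_ge0.
apply: ge_ereal_sup => _ [n _ <-].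
apply: le_trans (integral_decay e0 (ler0n R n.+1)).
rewrite le_eqVlt; apply/orP; left; apply/eqP; apply: eq_integral.
by move=> u; rewrite inE/= in_itv/= => /andP[u0 _]; rewrite ger0_norm.
Qed.

End decay.

(** * The weighted integral over the backward cone *)

Section pointwise.
Context {R : realType}.

Definition cone_weight (e k a s l : R) : R :=
  decay e (1 + s + l) * decay k (1 + `|l - a * s|).

(** Majorant for [t - s < 1], where the factor t / (t - s) blows up at the apex of the cone. Its
    integral in [l] grows only like tau^(-3/4). *)
Definition tip (c r tau l : R) : R :=
  if (0 < tau) && (tau < 1) then
    tau^-1 * ((1 + (root4 (c * tau) ^+ 3)^-1) * (if `|l - r| < c * tau then 1 else 0)
      + cusp (c * tau) (l - (c * tau - r)))
  else 0.

(** The time at which [r + l = c * (t - s)] when [q = l - a * s] is kept fixed. *)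
Definition cross_time (a c r t q : R) : R := (c * t - r - q) / (a + c).

(** The first pair serves the times up to [t / 2], where the large quantity is [1 + s + l], that is
    [1 + q + (1 + a) * s]; the second serves later times, where it is [1 + (t - s)]. The scale of
    each [bump] is that quantity at the singular time. *)
Definition time_profile (e a c r t q s : R) : R :=
  let s0 := cross_time a c r t q in
  decay e (1 + s) + bump (1 + q + (1 + a) * s0) (s - s0) +
  (decay e (1 + (t - s)) + bump (1 + t + -1 * s0) (s - s0)).

Lemma tip_ge0 c r tau l : 0 <= tip c r tau l.
Proof.
rewrite /tip; case: ifP => // /andP[tau0 _].
rewrite mulr_ge0 ?invr_ge0 ?(ltW tau0)// addr_ge0 ?cusp_ge0//.
by rewrite mulr_ge0 ?addr_ge0 ?invr_ge0 ?exprn_ge0 ?root4_ge0//; case: ifP.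
Qed.

Lemma time_profile_ge0 e a c r t q s : 0 <= time_profile e a c r t q s.
Proof. by rewrite !addr_ge0 ?decay_ge0 ?bump_ge0. Qed.

Lemma root4_1D_le (w : R) : 0 <= w -> root4 (1 + w) ^+ 3 <= 2 + 2 * root4 w ^+ 3.
Proof.
move=> w0.
have q2 : root4 2 ^+ 3 <= 2 :> R.
  have h1 : 1 <= root4 2 :> R.
    by have := @ler_root4 R 1 2; rewrite {1}/root4 !sqrtr1; apply; lra.
  rewrite -{2}(@root4K R 2)// [leRHS]exprSr -[leLHS]mulr1.
  by rewrite ler_wpM2l// exprn_ge0// root4_ge0.
have [w1|w1] := leP w 1.
  apply: (@le_trans _ _ (root4 2 ^+ 3)).
    by rewrite lerXn2r ?nnegrE ?root4_ge0// ler_root4//; lra.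
  by rewrite (le_trans q2)// lerDl mulr_ge0// exprn_ge0// root4_ge0.
apply: (@le_trans _ _ (root4 (2 * w) ^+ 3)).
  by rewrite lerXn2r ?nnegrE ?root4_ge0// ler_root4//; lra.
rewrite root4M// exprMn (@le_trans _ _ (2 * root4 w ^+ 3))//.
  by rewrite ler_wpM2r// exprn_ge0// root4_ge0.
by rewrite lerDr.
Qed.

Lemma inv_root4_le_cusp (L u : R) : 0 < L -> u != 0 ->
  (root4 `|u| ^+ 3)^-1 <= (root4 L ^+ 3)^-1 + cusp L u.
Proof.
move=> L0 u0; rewrite /cusp; case: ltP => uL.
  by rewrite lerDr invr_ge0 exprn_ge0// root4_ge0.
rewrite addr0 lef_pV2 ?posrE ?exprn_gt0 ?root4_gt0 ?normr_gt0//.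
by rewrite lerXn2r ?nnegrE ?root4_ge0// ler_root4.
Qed.

Lemma decayE (e z : R) : 0 < z -> decay e z = z^-1 * (z `^ e)^-1 :> R.
Proof.
move=> z0; rewrite /decay powRD; last by rewrite (gt_eqF z0) implybT.
by rewrite (powRr1 (ltW z0)) invfM.
Qed.

Lemma decay_le1 (e z : R) : 0 <= e -> 1 <= z -> decay e z <= 1 :> R.
Proof. by move=> e0 z1; rewrite (le_trans (decay_le_inv e0 z1))// invf_le1//; lra. Qed.

(* From [t/2] on, [s] is comparable with [t >= tau]. *)
Lemma late_decay_le (e t s tau l : R) : 0 <= e -> 1 <= tau -> tau <= t -> t <= 2 * s ->
  0 <= l -> (1 + t / tau) * decay e (1 + s + l) <= 4 * decay e 2^-1 * decay e (1 + tau) :> R.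
Proof.
move=> e0 tau1 taut ts l0.
have tau0 : 0 < tau by lra.
have h1 : decay e (1 + s + l) <= decay e 2^-1 * decay e (1 + t).
  rewrite mulrC -decayM; [|lra|lra].
  by apply: ler_decay => //; lra.
have h2 : 1 + t / tau <= 2 * (t / tau).
  have : 1 <= t / tau by rewrite ler_pdivlMr// mul1r.
  lra.
apply: (@le_trans _ _ (2 * (t / tau) * (decay e 2^-1 * decay e (1 + t)))).
  by apply: ler_pM => //; rewrite ?decay_ge0// addr_ge0// divr_ge0//; lra.
have h3 : t / tau * decay e (1 + t) <= 2 * decay e (1 + tau).
  rewrite !decayE; [|lra|lra].
  have p1 : ((1 + t) `^ e)^-1 <= ((1 + tau) `^ e)^-1.
    rewrite lef_pV2 ?posrE ?powR_gt0//; [|lra|lra].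
    by apply: ge0_ler_powR; rewrite ?nnegrE//; lra.
  have p2 : t / tau * (1 + t)^-1 <= 2 * (1 + tau)^-1.
    rewrite ler_pdivrMr; last lra.
    rewrite mulrAC ler_pdivlMr; last lra.
    rewrite mulrAC ler_pdivrMr//.
    have : 0 <= (tau - 1) * (t - tau) + tau * t by rewrite addr_ge0// mulr_ge0//; lra.
    have : 0 <= tau * t by rewrite mulr_ge0//; lra.
    nra.
  rewrite !mulrA; apply: ler_pM => //.
    by rewrite mulr_ge0 ?divr_ge0 ?invr_ge0//; lra.
  by rewrite invr_ge0 powR_ge0.
have d0 := decay_ge0 e (2^-1 : R).
rewrite [leLHS](_ : _ = 2 * decay e 2^-1 * (t / tau * decay e (1 + t))); last by ring.
rewrite [leRHS](_ : _ = 2 * decay e 2^-1 * (2 * decay e (1 + tau))); last by ring.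
by rewrite ler_wpM2l// mulr_ge0.
Qed.

(** Either [2 * (c * tau) <= r], and [l] is at most the denominator, or [l] is below
    [3 * (c * tau)]. The numerator [1 + l] is thus replaced by a quantity that depends only on the
    time left before the apex. *)
Lemma near_apex_ratio (c r tau l : R) : 0 < c -> 0 < tau -> 0 < l ->
  `|l - r| < c * tau -> r + l != c * tau ->
  (1 + l) / `|r + l - c * tau| <= 1 + (1 + 3 * (c * tau)) / `|r + l - c * tau|.
Proof.
move=> c0 tau0 l0 lr rl; set d := `|r + l - c * tau|.
have d0 : 0 < d by rewrite normr_gt0 subr_eq0.
rewrite ler_pdivrMr// mulrDl mul1r divfK ?gt_eqF//.
have ct0 : 0 < c * tau by rewrite mulr_gt0.
move: lr; rewrite ltr_norml => /andP[lr1 lr2].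
have [rc|rc] := leP (2 * (c * tau)) r; last by lra.
have : l <= d by rewrite /d ger0_norm; lra.
lra.
Qed.

(** For [2 * s <= t] the factor 1 + t / (t - s) is at most 3. For later [s] with [1 <= t - s], the
    decay in [1 + s + l], a quantity at least [t / 2], pays for that factor and becomes decay in
    [1 + (t - s)]. For [t - s < 1] only [1 + s + l >= t / 2] is retained, and [tip] takes the
    singularity. *)
Lemma cone_integrand_le (e k a c : R) : 0 <= e -> 0 <= k -> 0 <= a -> 0 < c ->
  exists2 C : R, 0 < C & forall r t s l, 0 <= r -> 0 <= s -> s < t ->
    (1 + t / (t - s)) * cone_weight e k a s l * cone_factor r (c * (t - s)) l <=
    C * (decay k (1 + `|l - a * s|) * time_profile e a c r t (l - a * s) s +
         tip c r (t - s) l).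
Proof.
move=> e0 k0 a0 c0.
have ac0 : 0 < a + c by lra.
(* At fixed [l - a * s], the slopes in [s] of [1 + s + l] and [1 + (t - s)] are [1 + a] and [-1],
   and that of the gap [r + l - c * (t - s)] is [a + c]. *)
have [C1 C10 H1] := decay_singular_le (1 + a) ac0.
have [C2 C20 H2] := decay_singular_le (-1) ac0.
pose c3 := 4 * decay e (2^-1 : R).
have c30 : 0 <= c3 by rewrite mulr_ge0// decay_ge0.
pose c5 := root4 (1 + 3 * c) ^+ 3.
have c50 : 0 <= c5 by rewrite exprn_ge0// root4_ge0.
pose c4 := 3 + 2 * c5.
have c40 : 0 < c4 by rewrite /c4; lra.
have c34 : 0 <= c3 * c4 * C2 by rewrite mulr_ge0 ?(ltW C20)// mulr_ge0// ltW.
exists (3 * C1 + c3 * c4 * C2 + 4 * c4); first lra.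
have K1 : 3 * C1 <= 3 * C1 + c3 * c4 * C2 + 4 * c4 by lra.
have K2 : c3 * c4 * C2 <= 3 * C1 + c3 * c4 * C2 + 4 * c4 by lra.
have K3 : 4 * c4 <= 3 * C1 + c3 * c4 * C2 + 4 * c4 by lra.
have K10 : 0 <= 3 * C1 by lra.
have K30 : 0 <= 4 * c4 by lra.
have K0 : 0 <= 3 * C1 + c3 * c4 * C2 + 4 * c4 by exact: le_trans K1.
move=> r t s l r0 s0 st; set q := l - a * s; set tau := t - s.
have t0 : 0 <= t by exact: le_trans (ltW st).
have tau0 : 0 < tau by rewrite subr_gt0.
have tp0 := time_profile_ge0 e a c r t q s.
have ti0 := tip_ge0 c r tau l.
have dk0 := decay_ge0 k (1 + `|q|).
have tt0 : 0 <= t / tau by rewrite divr_ge0// ltW.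
have f0 : 0 <= 1 + t / tau by rewrite addr_ge0.
have taut : tau <= t by rewrite gerBl.
have ct0 : 0 < c * tau by rewrite mulr_gt0.
rewrite /cone_factor; case: ifPn => [/andP[l0 lr]|_]; last first.
  by rewrite mulr0 mulr_ge0// addr_ge0// mulr_ge0.
have A1 : 1 <= 1 + s + l by rewrite -addrA lerDl addr_ge0// ltW.
have tA : t <= 2 * s -> t <= 2 * (1 + s + l) by move: (ltW l0) => *; lra.
set d := `|r + l - c * tau|.
pose s1 := cross_time a c r t q.
have dE : d = (a + c) * `|s - s1|.
  rewrite -{1}(gtr0_norm ac0) -normrM; congr `|_|.
  have -> : (a + c) * (s - s1) = (a + c) * s - (c * t - r - q).
    by rewrite mulrBr; congr (_ - _); rewrite /s1 /cross_time mulrC divfK// gt_eqF.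
  by rewrite /q /tau; ring.
set W := root4 ((1 + l) / d) ^+ 3.
have W0 : 0 <= W by rewrite exprn_ge0// root4_ge0.
have d0 : 0 <= d by exact: normr_ge0.
have wfin X C' : 0 <= X -> X <= C' * (decay k (1 + `|q|) * time_profile e a c r t q s) ->
    0 <= C' -> C' <= 3 * C1 + c3 * c4 * C2 + 4 * c4 ->
    X <= (3 * C1 + c3 * c4 * C2 + 4 * c4) *
      (decay k (1 + `|q|) * time_profile e a c r t q s + tip c r tau l).
  move=> X0 h C'0 hC; apply: (le_trans h); apply: ler_pM => //.
    by rewrite mulr_ge0.
  by rewrite lerDl.
rewrite /cone_weight -/q.
have [st2|st2] := leP (2 * s) t.
  have h1 : 1 + t / tau <= 3.
    have h : t / tau <= 2 by rewrite ler_pdivrMr// /tau; move: st2; clear; lra.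
    by move: h; clear; lra.
  have hA : 1 + s + l = 1 + q + (1 + a) * s by rewrite /q; ring.
  have := H1 e (1 + q) s1 s s e0 s0; cbv zeta; rewrite -hA => /(_ _) H.
  have {}H := H ltac:(by rewrite lerDl ltW).
  rewrite -dE in H.
  have W1 : 1 + W <= 1 + root4 ((1 + s + l) / d) ^+ 3.
    by rewrite lerD2l lerXn2r ?nnegrE ?root4_ge0// ler_root4// ler_wpM2r ?invr_ge0// lerD2r lerDl.
  have dl0 := decay_ge0 e (1 + s + l).
  have P0 : 0 <= decay e (1 + s) + bump (1 + q + (1 + a) * s1) (s - s1).
    by rewrite addr_ge0 ?decay_ge0 ?bump_ge0.
  apply: (wfin _ (3 * C1)); [|  |exact: K10|exact: K1].
    exact: mulr_ge0 (mulr_ge0 f0 (mulr_ge0 dl0 dk0)) (addr_ge0 ler01 W0).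
  apply: (@le_trans _ _ (3 * (decay k (1 + `|q|) * (C1 * (decay e (1 + s) + bump (1 + q + (1 +
    a) * s1) (s - s1)))))).
    rewrite -!mulrA; apply: ler_pM => //.
    - exact: mulr_ge0 dl0 (mulr_ge0 dk0 (addr_ge0 ler01 W0)).
    rewrite mulrCA ler_wpM2l//.
    apply: le_trans H; rewrite ler_wpM2l//.
  rewrite -mulrA ler_wpM2l// mulrCA ler_wpM2l ?(ltW C10)// ler_wpM2l//.
  by rewrite /time_profile -/s1 lerDl addr_ge0 ?decay_ge0 ?bump_ge0.
(* After [t / 2] the numerator [1 + l] is exchanged for [B], which is [1 + tau] away from the apex
   and [1] near it. *)
have W2 B : (1 + 3 * (c * tau)) <= (1 + 3 * c) * B -> 0 <= B ->
    1 + W <= c4 * (1 + root4 (B / d) ^+ 3).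
  move=> hB B0.
  have [rl|rl] := eqVneq (r + l) (c * tau).
    rewrite /W /d rl subrr normr0 invr0 !mulr0 /root4 !sqrtr0 expr0n/= addr0 mulr1.
    by rewrite /c4; move: c50; clear; lra.
  have rat := near_apex_ratio c0 tau0 l0 lr rl; rewrite -/d in rat.
  have w0 : 0 <= (1 + 3 * (c * tau)) / d.
    by rewrite divr_ge0// addr_ge0// mulr_ge0// ltW.
  have h1 : W <= root4 (1 + (1 + 3 * (c * tau)) / d) ^+ 3.
    by rewrite lerXn2r ?nnegrE ?root4_ge0// ler_root4.
  have h2 := root4_1D_le w0.
  have h3 : root4 ((1 + 3 * (c * tau)) / d) ^+ 3 <= c5 * root4 (B / d) ^+ 3.
    rewrite -exprMn -root4M; last by rewrite addr_ge0// mulr_ge0// ltW.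
    by rewrite lerXn2r ?nnegrE ?root4_ge0// ler_root4// [leRHS]mulrA ler_wpM2r ?invr_ge0.
  have h4 : 0 <= root4 (B / d) ^+ 3 by rewrite exprn_ge0// root4_ge0.
  rewrite /c4 mulrDr mulr1 mulrDl; move: h1 h2 h3 h4 c50; clear; lra.
have [tau1|tau1] := leP 1 tau.
  have h1 := @late_decay_le e t s tau l e0 tau1 taut (ltW st2) (ltW l0).
  rewrite -/c3 in h1.
  have := H2 e (1 + t) s1 s tau e0 (ltW tau0); cbv zeta.
  rewrite (_ : 1 + t + -1 * s = 1 + tau); last by rewrite /tau; ring.
  move=> /(_ (lexx _)) H; rewrite -dE in H.
  have hB := W2 (1 + tau) ltac:(by move: ct0 c0 tau0; clear; move=> *; lra) (addr_ge0 ler01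
    (ltW tau0)).
  have P0 : 0 <= decay e (1 + tau) + bump (1 + t + -1 * s1) (s - s1).
    by rewrite addr_ge0 ?decay_ge0 ?bump_ge0.
  have dt0 := decay_ge0 e (1 + tau).
  apply: (wfin _ (c3 * c4 * C2)); [| |exact: c34|exact: K2].
    exact: mulr_ge0 (mulr_ge0 f0 (mulr_ge0 (decay_ge0 _ _) dk0)) (addr_ge0 ler01 W0).
  rewrite [leLHS](_ : _ = decay k (1 + `|q|) * ((1 + t / tau) * decay e (1 + s + l)) * (1 +
    W)); last by ring.
  apply: (@le_trans _ _ (decay k (1 + `|q|) * (c3 * decay e (1 + tau)) * (c4 * (1 + root4 ((1 +
    tau) / d) ^+ 3)))).
    apply: ler_pM => //.
    - exact: mulr_ge0 dk0 (mulr_ge0 f0 (decay_ge0 _ _)).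
    - exact: addr_ge0.
    - exact: ler_wpM2l dk0 _ _ h1.
  rewrite [leLHS](_ : _ = (c3 * c4) * decay k (1 + `|q|) * (decay e (1 + tau) * (1 + root4 ((1
    + tau) / d) ^+ 3))); last by ring.
  rewrite [leRHS](_ : _ = (c3 * c4) * decay k (1 + `|q|) * (C2 * time_profile e a c r t q s));
    last by ring.
  have c340 := mulr_ge0 (mulr_ge0 c30 (ltW c40)) dk0.
  apply: ler_wpM2l => //; apply: (le_trans H).
  rewrite ler_wpM2l ?(ltW C20)// /time_profile -/s1 -/tau lerDr addr_ge0 ?decay_ge0 ?bump_ge0//.
have hB := W2 1 ltac:(by rewrite mulr1 lerD2l ler_wpM2l// ler_piMr// ltW) ler01.
have ts1 : t / tau * decay e (1 + s + l) <= 2 / tau.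
  rewrite mulrAC ler_wpM2r ?invr_ge0 ?(ltW tau0)//.
  apply: (@le_trans _ _ (t * (1 + s + l)^-1)).
    by rewrite ler_wpM2l ?decay_le_inv.
  by rewrite ler_pdivrMr ?(lt_le_trans ltr01)//; exact: tA (ltW st2).
have ts2 : decay e (1 + s + l) <= 2 / tau.
  apply: (@le_trans _ _ 1); first exact: decay_le1.
  by rewrite ler_pdivlMr// mul1r; move: tau1; clear; lra.
have dl0 := decay_ge0 e (1 + s + l).
have dk1 : decay k (1 + `|q|) <= 1 by apply: decay_le1 => //; rewrite lerDl.
have itau0 : 0 <= tau^-1 by rewrite invr_ge0 ltW.
apply: (@le_trans _ _ (4 / tau * (c4 * (1 + root4 (1 / d) ^+ 3)))).
  apply: ler_pM => //.
  - exact: mulr_ge0 f0 (mulr_ge0 dl0 dk0).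
  - exact: addr_ge0.
  - rewrite mulrA -[leRHS]mulr1; apply: ler_pM => //; first exact: mulr_ge0.
    by rewrite mulrDl mul1r; move: ts1 ts2; clear; lra.
have tipE : tau^-1 * (1 + root4 (1 / d) ^+ 3) <= tip c r tau l.
  rewrite /tip tau0 tau1 /= lr mulr1 ler_wpM2l//.
  have [rl|rl] := eqVneq (r + l) (c * tau).
    rewrite /d rl subrr normr0 invr0 mulr0 {1}/root4 !sqrtr0 expr0n/= addr0.
    by rewrite -addrA lerDl addr_ge0 ?cusp_ge0// invr_ge0 exprn_ge0// root4_ge0.
  have -> : root4 (1 / d) ^+ 3 = (root4 `|l - (c * tau - r)| ^+ 3)^-1.
    have -> : l - (c * tau - r) = r + l - c * tau by ring.
    by rewrite div1r /root4 !sqrtrV ?sqrtr_ge0// exprVn.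
  rewrite -addrA lerD2l; apply: inv_root4_le_cusp => //.
  by rewrite opprB addrA subr_eq0 addrC.
have : 4 / tau * (c4 * (1 + root4 (1 / d) ^+ 3)) <= 4 * c4 * tip c r tau l.
  rewrite [leLHS](_ : _ = 4 * c4 * (tau^-1 * (1 + root4 (1 / d) ^+ 3))); last by ring.
  by rewrite ler_wpM2l// mulr_ge0// ltW.
move=> h; apply: (le_trans h); apply: ler_pM => //.
by rewrite lerDr mulr_ge0.
Qed.

End pointwise.

Section cone_estimate.
Context {R : realType}.
Notation mu := (@lebesgue_measure R).
Notation mu2 := (mu \x mu)%E.

(* No measurability: the integral of a nonnegative function is a supremum over
   the simple functions below it. *)
Lemma ge0_integral_mono d (T : measurableType d) (m : {measure set T -> \bar R})
    (D : set T) (f g : T -> \bar R) : (forall x, D x -> 0 <= f x)%E ->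
  (forall x, D x -> f x <= g x)%E -> (\int[m]_(x in D) f x <= \int[m]_(x in D) g x)%E.
Proof.
move=> f0 fg.
have g0 x : D x -> (0 <= g x)%E by move=> Dx; exact: le_trans (f0 _ Dx) (fg _ Dx).
rewrite !ge0_integralE//; apply: ereal_sup_le.
move=> _ [h hf <-]; exists h => // x; apply: (le_trans (hf x)).
by rewrite /patch; case: ifPn => // xD; apply: fg; rewrite inE in xD.
Qed.

(** The support of the first term has length of order tau, so both singular terms integrate to order
    tau^(1/4); with the factor tau^(-1) this is tau^(-3/4), integrable up to the apex. *)
Lemma integral_tip_le (c : R) : 0 < c -> exists2 C : R, 0 < C & forall r tau,
  (\int[mu]_l (tip c r tau l)%:E <= (C * cusp 1 tau)%:E)%E.
Proof.
move=> c0.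
have q0 : 0 < root4 c by rewrite root4_gt0.
pose C := 2 * c * (1 + (root4 c ^+ 3)^-1) + 8 * root4 c.
have C0 : 0 < C.
  by rewrite addr_gt0 ?mulr_gt0// addr_gt0// invr_gt0 exprn_gt0.
exists C => // r tau.
have [/andP[tau0 tau1]|tau01] := boolP ((0 < tau) && (tau < 1)); last first.
  rewrite integral0_eq ?lee_fin ?mulr_ge0 ?cusp_ge0 ?(ltW C0)//.
  by move=> l _; rewrite /tip (negbTE tau01).
have ct0 : 0 < c * tau by rewrite mulr_gt0.
pose k1 := tau^-1 * (1 + (root4 (c * tau) ^+ 3)^-1).
have it0 : 0 <= tau^-1 by rewrite invr_ge0 ltW.
have k10 : 0 <= k1 by rewrite mulr_ge0// addr_ge0// invr_ge0 exprn_ge0// root4_ge0.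
pose A := [set` `](r - c * tau), (r + c * tau)[].
have tipE l : (tip c r tau l)%:E = (k1%:E * (\1_A l)%:E +
    (tau^-1)%:E * (cusp (c * tau) (l - (c * tau - r)))%:E)%E.
  rewrite /tip tau0 tau1 /= -!EFinM -EFinD mulrDr mulrA; congr EFin; congr (_ * _ + _).
  rewrite indicE mem_setE/= in_itv/= ltr_distl.
  by case: (_ && _).
have -> : (\int[mu]_l (tip c r tau l)%:E = \int[mu]_l (k1%:E * (\1_A l : R)%:E +
    (tau^-1)%:E * (cusp (c * tau) (l - (c * tau - r)))%:E))%E.
  by apply: eq_integral => l _; exact: tipE.
have mA : measurable A by exact: measurable_itv.
have m1 : measurable_fun [set: measurableTypeR R] (fun l => (\1_A l : R)%:E).
  by apply/measurable_EFinP; exact: measurable_indic.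
have m2 : measurable_fun [set: measurableTypeR R]
    (fun l => (cusp (c * tau) (l - (c * tau - r)))%:E).
  by apply/measurable_EFinP; apply: measurable_cusp2 => //; exact: measurable_funB.
have p1 l : (0 <= (\1_A l : R)%:E)%E by rewrite lee_fin.
have p2 l : (0 <= (cusp (c * tau) (l - (c * tau - r)))%:E)%E by rewrite lee_fin cusp_ge0.
rewrite ge0_integralD//; last 4 first.
- by move=> l _; rewrite mule_ge0// lee_fin.
- exact: emeasurable_funM.
- by move=> l _; rewrite mule_ge0// lee_fin.
- exact: emeasurable_funM.
rewrite ge0_integralZlT// ge0_integralZlT// integral_indic// setIT.
have muA : mu A = (2 * (c * tau))%:E.
  rewrite lebesgue_measure_itv/= lte_fin ifT; last lra.
  by rewrite -EFinD; congr EFin; ring.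
apply: (@le_trans _ _ (k1%:E * (2 * (c * tau))%:E +
   (tau^-1)%:E * (8 * root4 (c * tau))%:E)%E).
  apply: leeD; first by rewrite -muA; exact: lexx.
  by rewrite lee_wpmul2l ?lee_fin// integral_cusp.
rewrite -!EFinM -EFinD lee_fin /cusp gtr0_norm// tau1 /k1.
have e3 : root4 (c * tau) = root4 c * root4 tau by rewrite root4M// ltW.
set z := root4 tau in e3 *.
have z0 : 0 < z by rewrite root4_gt0.
have z1 : z <= 1.
  by have := ler_root4 (ltW tau1); rewrite -/z /root4 !sqrtr1.
have zE : tau = z ^+ 4 by rewrite /z root4K// ltW.
have ziz : 1 <= (z ^+ 3)^-1 by rewrite invf_ge1 ?exprn_gt0// exprn_ile1// ltW.
rewrite e3 zE exprMn /C invfM [leRHS]mulrDl.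
set w := root4 c in q0 *.
apply: lerD; last first.
  rewrite le_eqVlt; apply/orP; left; apply/eqP; field; exact/lt0r_neq0.
rewrite [leLHS](_ : _ = 2 * c * (1 + (w ^+ 3)^-1 * (z ^+ 3)^-1)); last first.
  by field; apply/andP; split; exact/lt0r_neq0.
rewrite -[leRHS]mulrA ler_wpM2l ?mulr_ge0 ?(ltW c0)// [leRHS]mulrDl mul1r.
by rewrite lerD2r.
Qed.

Lemma measurable_tip (c r tau : R) : measurable_fun [set: measurableTypeR R] (tip c r tau).
Proof.
have [h|h] := boolP ((0 < tau) && (tau < 1)); last first.
  by rewrite (_ : tip c r tau = cst 0)//; apply/funext => l; rewrite /tip (negbTE h).
rewrite (_ : tip c r tau = fun l => tau^-1 *
    ((1 + (root4 (c * tau) ^+ 3)^-1) * (if `|l - r| < c * tau then 1 else 0)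
      + cusp (c * tau) (l - (c * tau - r)))); last by apply/funext => l; rewrite /tip h.
apply: measurable_funM => //; apply: measurable_funD.
  apply: measurable_funM => //; apply: measurable_fun_ifT => //.
  apply: measurable_fun_ltr => //.
  by apply: (measurableT_comp (@normr_measurable R setT)); exact: measurable_funB.
by apply: measurable_cusp2 => //; exact: measurable_funB.
Qed.

Lemma integral_itv_le_line (D : set R) (f : R -> R) : measurable D ->
  measurable_fun [set: measurableTypeR R] f -> (forall x, 0 <= f x) ->
  (\int[mu]_(x in D) (f x)%:E <= \int[mu]_x (f x)%:E)%E.
Proof.
move=> mD mf f0; apply: ge0_subset_integral => //.
  exact/measurable_EFinP.
by move=> x _; rewrite lee_fin.
Qed.

Lemma integral_itv_subl (t : R) (f : R -> R) :
  measurable_fun [set: measurableTypeR R] f -> (forall x, 0 <= f x) ->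
  (\int[mu]_(s in `[0%R, t]) (f (t - s))%:E = \int[mu]_(s in `[0%R, t]) (f s)%:E)%E.
Proof.
move=> mf f0; rewrite [LHS]integral_mkcond [RHS]integral_mkcond.
rewrite -[RHS](integral_subl t); last 2 first.
- apply/(measurable_restrictT _ _).1 => //.
  by apply/measurable_EFinP; exact: measurable_funTS.
- by move=> x; apply: erestrict_ge0 => u _; rewrite lee_fin.
apply: eq_integral => s _; rewrite /patch !mem_setE !in_itv/=.
by rewrite subr_ge0 gerBl andbC.
Qed.

(** Each decay contributes [L], the second one after reflection of [[0, t]], and each bump
    contributes 8 wherever its centre lies. The bound is therefore uniform in [q] and [r]. *)
Lemma integral_time_profile_le (e a c r t q L : R) : 0 <= t -> 0 <= L ->
  (\int[mu]_(s in `[0%R, t]) (decay e (1 + s))%:E <= L%:E)%E ->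
  (\int[mu]_(s in `[0%R, t]) (time_profile e a c r t q s)%:E <= (2 * L + 16)%:E)%E.
Proof.
move=> t0 L0 hL; rewrite /time_profile; set s0 := cross_time _ _ _ _ _.
set X := _ + _ * s0; set Y := _ + _ * s0.
have mD : measurable_fun [set: measurableTypeR R] (fun s => decay e (1 + s)).
  by apply: measurable_decay; exact: measurable_funD.
have mD' : measurable_fun [set: measurableTypeR R] (fun s => decay e (1 + (t - s))).
  by apply: measurable_decay; apply: measurable_funD => //; exact: measurable_funB.
have mB Z : measurable_fun [set: measurableTypeR R] (fun s => bump Z (s - s0)).
  by apply: measurable_bump => //; exact: measurable_funB.
have hB Z : (\int[mu]_(s in `[0%R, t]) (bump Z (s - s0))%:E <= 8%:E)%E.
  apply: le_trans (integral_bump Z s0); apply: integral_itv_le_line => //.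
  by move=> s; exact: bump_ge0.
have hD : (\int[mu]_(s in `[0%R, t]) (decay e (1 + (t - s)))%:E <= L%:E)%E.
  rewrite (integral_itv_subl t (f := fun u => decay e (1 + u)))// => u.
  exact: decay_ge0.
pose g1 s := decay e (1 + s) + bump X (s - s0).
pose g2 s := decay e (1 + (t - s)) + bump Y (s - s0).
have intD (f g : R -> R) : measurable_fun [set: measurableTypeR R] f ->
    measurable_fun [set: measurableTypeR R] g ->
    (forall x, 0 <= f x) -> (forall x, 0 <= g x) ->
    (\int[mu]_(s in `[0%R, t]) (f s + g s)%:E =
     \int[mu]_(s in `[0%R, t]) (f s)%:E + \int[mu]_(s in `[0%R, t]) (g s)%:E)%E.
  move=> mf mg f0 g0.
  under eq_integral do rewrite EFinD.
  rewrite ge0_integralD//; try by move=> x _; rewrite lee_fin.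
    by apply/measurable_EFinP; exact: measurable_funTS.
  by apply/measurable_EFinP; exact: measurable_funTS.
have b0 Z s : 0 <= bump Z (s - s0) by exact: bump_ge0.
rewrite (intD g1 g2); [|exact: measurable_funD|exact: measurable_funD| |]; last 2 first.
- by move=> s; rewrite addr_ge0// decay_ge0.
- by move=> s; rewrite addr_ge0// decay_ge0.
rewrite intD//; last by move=> s; exact: decay_ge0.
rewrite intD//; last by move=> s; exact: decay_ge0.
have -> : 2 * L + 16 = (L + 8) + (L + 8) by ring.
rewrite [leRHS]EFinD; apply: leeD.
  by rewrite [leRHS]EFinD; exact: leeD hL (hB X).
by rewrite [leRHS]EFinD; exact: leeD hD (hB Y).
Qed.

Lemma measurable_time_profile (e a c r t : R) :
  measurable_fun [set: measurableTypeR R * measurableTypeR R]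
    (fun z : R * R => time_profile e a c r t z.1 z.2).
Proof.
have m1 := @measurable_fst12 R; have m2 := @measurable_snd12 R.
have ms0 : measurable_fun [set: measurableTypeR R * measurableTypeR R]
    (fun z : R * R => cross_time a c r t z.1).
  by apply: measurable_funM => //; exact: measurable_funB.
apply: measurable_funD; apply: measurable_funD.
- by apply: measurable_decay; exact: measurable_funD.
- apply: measurable_bump; last exact: measurable_funB.
  apply: measurable_funD; first exact: measurable_funD.
  exact: measurable_funM.
- by apply: measurable_decay; apply: measurable_funD => //; exact: measurable_funB.
- apply: measurable_bump; last exact: measurable_funB.
  by apply: measurable_funD => //; exact: measurable_funM.
Qed.

(** A translation in [l] at each time introduces [q = l - a * s]. Tonelli then allows the
    integration in [s] at fixed [q], whose bound is free of [q], and [decay k] is left to be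
    integrated. *)
Lemma integral_profile_le (e k a c r t L : R) : 0 < k -> 0 <= t -> 0 <= L ->
  (\int[mu]_(s in `[0%R, t]) (decay e (1 + s))%:E <= L%:E)%E ->
  (\int[mu]_(s in `[0%R, t]) \int[mu]_l
    (decay k (1 + `|l - a * s|) * time_profile e a c r t (l - a * s) s)%:E <=
   ((2 * L + 16) * (2 * k^-1))%:E)%E.
Proof.
move=> k0 t0 L0 hL.
have m1 := @measurable_fst12 R; have m2 := @measurable_snd12 R.
pose A (z : R * R) := decay k (1 + `|z.1|) * time_profile e a c r t z.1 z.2.
have A0 z : 0 <= A z by rewrite mulr_ge0 ?decay_ge0 ?time_profile_ge0.
have mA : measurable_fun [set: measurableTypeR R * measurableTypeR R] A.
  apply: measurable_funM; last exact: measurable_time_profile.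
  apply: measurable_decay; apply: measurable_funD => //.
  exact: (measurableT_comp (@normr_measurable R setT)).
pose B (z : R * R) := ((if (0 <= z.2) && (z.2 <= t) then A z else 0) : R)%:E.
have mB : measurable_fun [set: measurableTypeR R * measurableTypeR R] B.
  apply/measurable_EFinP; apply: measurable_fun_ifT => //.
  by apply: measurable_and; apply: measurable_fun_ler.
have B0 z : (0 <= B z)%E by rewrite lee_fin; case: ifP.
have -> : (\int[mu]_(s in `[0%R, t]) \int[mu]_l
    (decay k (1 + `|l - a * s|) * time_profile e a c r t (l - a * s) s)%:E =
    \int[mu]_s \int[mu]_q B (q, s))%E.
  rewrite integral_mkcond; apply: eq_integral => s _; rewrite /patch mem_setE in_itv/=.
  rewrite /B/=; case: ifPn => st; last by rewrite integral0_eq.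
  have := @integral_addr R (- (a * s)) (fun q => (A (q, s))%:E); apply.
    by apply/measurable_EFinP; apply: (measurableT_comp mA); exact: measurable_pair2.
  by move=> q; rewrite lee_fin.
rewrite -integral2_swap//.
apply: (@le_trans _ _ (\int[mu]_q ((2 * L + 16)%:E * (decay k (1 + `|q|))%:E))%E).
  apply: ge0_integral_mono => q _; first by apply: integral_ge0 => s _; exact: B0.
  rewrite (_ : \int[mu]_s B (q, s) = \int[mu]_(s in `[0%R, t]) (A (q, s))%:E)%E; last first.
    rewrite [RHS]integral_mkcond; apply: eq_integral => s _.
    by rewrite /patch mem_setE in_itv/= /B/=; case: ifPn.
  have tp0 s : (0 <= (time_profile e a c r t q s)%:E)%E.
    by rewrite lee_fin time_profile_ge0.
  have mtp : measurable_fun `[0%R, t]%classic (fun s => (time_profile e a c r t q s)%:E).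
    apply/measurable_EFinP; apply: measurable_funTS.
    exact: (measurableT_comp (@measurable_time_profile e a c r t) (measurable_pair1 q)).
  have -> : (\int[mu]_(s in `[0%R, t]) (A (q, s))%:E = (decay k (1 + `|q|))%:E *
      \int[mu]_(s in `[0%R, t]) (time_profile e a c r t q s)%:E)%E.
    rewrite -(ge0_integralZl_EFin mu (measurable_itv _) (fun s _ => tp0 s) mtp (decay_ge0 _ _)).
    by apply: eq_integral => s _; rewrite -EFinM.
  rewrite muleC lee_wpmul2r ?lee_fin ?decay_ge0//.
  exact: integral_time_profile_le.
rewrite ge0_integralZlT//; last 3 first.
- apply/measurable_EFinP; apply: measurable_decay; exact: measurable_funD.
- by move=> q; rewrite lee_fin decay_ge0.
- by rewrite addr_ge0// mulr_ge0.
rewrite [leRHS]EFinM lee_wpmul2l ?lee_fin ?addr_ge0 ?mulr_ge0//.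
exact: integral_decay_line.
Qed.

Lemma kern0 (z : R * R) : kern 0 z = 0.
Proof.
rewrite /kern ler0_sqrtr ?invr0// expr0n/= sub0r oppr_le0.
by rewrite addr_ge0 ?sqr_ge0.
Qed.

(** The bound [L] on the time integral of [decay e] is a parameter so that both uses are covered:
    [L = e^-1] for [0 < e], and a logarithm of [1 + t] for [e = 0]. *)
Lemma cone_integral_le (e k a c : R) : 0 <= e -> 0 < k -> 0 <= a -> 0 < c ->
  exists2 C : R, 0 < C & forall x t L, 0 <= t -> 0 <= L ->
  (\int[mu]_(s in `[0%R, t]) (decay e (1 + s))%:E <= L%:E)%E ->
  (\int[mu]_(s in `[0%R, t]) ((1 + t / (t - s))%:E * \int[mu2]_y
     ((Num.sqrt (enorm y))^-1 * cone_weight e k a s (enorm y)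
        * kern (c * (t - s)) (x - y))%:E) <=
   (C * (1 + L) / Num.sqrt (1 + enorm x))%:E)%E.
Proof.
move=> e0 k0 a0 c0.
have [C1 C10 H1] := cone_integrand_le e0 (ltW k0) a0 c0.
have [C2 C20 H2] := integral_tip_le c0.
pose C3 := 32 * k^-1 + 4 * k^-1 + C2 * 8.
have ik0 : 0 < k^-1 by rewrite invr_gt0.
have C30 : 0 < C3 by rewrite /C3; lra.
have c512 : 0 < 512 :> R by rewrite ltr0n.
exists (512 * C1 * C3); first exact: mulr_gt0 (mulr_gt0 c512 C10) C30.
move=> x t L t0 L0 hL; set r := enorm x.
have r0 : 0 <= r by exact: enorm_ge0.
pose K := 512 / Num.sqrt (1 + r) * C1.
have k0' : 0 <= 512 / Num.sqrt (1 + r) by rewrite mulr_ge0 ?ler0n// invr_ge0 sqrtr_ge0.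
have K0 : 0 <= K by rewrite mulr_ge0// ltW.
pose A s l := decay k (1 + `|l - a * s|) * time_profile e a c r t (l - a * s) s.
have A0 s l : 0 <= A s l by rewrite mulr_ge0 ?decay_ge0 ?time_profile_ge0.
have mw s : measurable_fun [set: measurableTypeR R] (cone_weight e k a s).
  apply: measurable_funM; first by apply: measurable_decay; exact: measurable_funD.
  apply: measurable_decay; apply: measurable_funD => //.
  by apply: (measurableT_comp (@normr_measurable R setT)); exact: measurable_funB.
have w0 s l : 0 <= cone_weight e k a s l by rewrite mulr_ge0 ?decay_ge0.
have mA s : measurable_fun [set: measurableTypeR R] (A s).
  apply: measurable_funM.
    apply: measurable_decay; apply: measurable_funD => //.
    by apply: (measurableT_comp (@normr_measurable R setT)); exact: measurable_funB.
  apply: (measurableT_comp (@measurable_time_profile e a c r t)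
     (g := fun l : R => (l - a * s, s))).
  by apply: measurable_fun_pair => //; exact: measurable_funB.
have step s : 0 <= s <= t ->
   ((1 + t / (t - s))%:E * \int[mu2]_y
     ((Num.sqrt (enorm y))^-1 * cone_weight e k a s (enorm y)
        * kern (c * (t - s)) (x - y))%:E <=
    K%:E * (\int[mu]_l (A s l)%:E + (C2 * cusp 1 (t - s))%:E))%E.
  (* At [s = t] the disc has radius [0] and its kernel vanishes, so the quotient by [t - s] is
     harmless. *)
  move=> /andP[s0]; rewrite le_eqVlt => /predU1P[->|st].
    rewrite integral0_eq ?mule0; last first.
      by move=> y _; rewrite subrr mulr0 kern0 mulr0.
    rewrite mule_ge0 ?lee_fin// adde_ge0 ?lee_fin ?mulr_ge0 ?cusp_ge0 ?(ltW C20)//.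
    by apply: integral_ge0 => l _; rewrite lee_fin.
  have tau0 : 0 < t - s by rewrite subr_gt0.
  have f0 : 0 <= 1 + t / (t - s) by rewrite addr_ge0// divr_ge0// ltW.
  have ct0 : 0 < c * (t - s) by rewrite mulr_gt0.
  have := integral_kern_radial_le x ct0 (mw s) (w0 s) => B.
  apply: (le_trans (lee_wpmul2l _ B)); first by rewrite lee_fin.
  rewrite -/r muleCA [K%:E]EFinM -[leRHS]muleA lee_wpmul2l ?lee_fin//.
  have cf0 l : 0 <= cone_factor r (c * (t - s)) l by exact: cone_factor_ge0.
  have mcf : measurable_fun [set: measurableTypeR R]
     (fun l => (cone_weight e k a s l * cone_factor r (c * (t - s)) l)%:E).
    apply/measurable_EFinP; apply: measurable_funM => //.
    exact: measurable_cone_factor.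
  rewrite -ge0_integralZlT//; last by move=> l; rewrite lee_fin mulr_ge0.
  apply: (@le_trans _ _ (\int[mu]_l (C1%:E * ((A s l)%:E + (tip c r (t - s) l)%:E)))%E).
    apply: ge0_integral_mono => l _.
      by rewrite -EFinM lee_fin mulr_ge0// mulr_ge0.
    by rewrite -EFinD -!EFinM lee_fin mulrA; exact: H1.
  have At0 l : (0 <= (A s l)%:E + (tip c r (t - s) l)%:E)%E.
    by rewrite adde_ge0// lee_fin// tip_ge0.
  have mA' : measurable_fun [set: measurableTypeR R] (fun l => (A s l)%:E).
    exact/measurable_EFinP.
  have mT : measurable_fun [set: measurableTypeR R] (fun l => (tip c r (t - s) l)%:E).
    by apply/measurable_EFinP; exact: measurable_tip.
  rewrite ge0_integralZlT ?(ltW C10)//; last exact: emeasurable_funD.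
  rewrite lee_wpmul2l ?lee_fin ?(ltW C10)//.
  rewrite ge0_integralD//; last 2 first.
  - by move=> l _; rewrite lee_fin.
  - by move=> l _; rewrite lee_fin tip_ge0.
  by rewrite leeD2l.
have mcu : measurable_fun [set: measurableTypeR R] (fun s => cusp 1 (t - s)).
  by apply: measurable_cusp2 => //; exact: measurable_funB.
have mIA : measurable_fun `[0%R, t]%classic (fun s => \int[mu]_l (A s l)%:E)%E.
  apply: measurable_funTS.
  apply: (@measurable_integral1 R (fun z : R * R => (A z.1 z.2)%:E)).
    apply/measurable_EFinP.
    have m1 := @measurable_fst12 R; have m2 := @measurable_snd12 R.
    have md : measurable_fun [set: measurableTypeR R * measurableTypeR R]
        (fun z : R * R => z.2 - a * z.1).
      by apply: measurable_funB => //; exact: measurable_funM.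
    apply: measurable_funM.
      apply: measurable_decay; apply: measurable_funD => //.
      by apply: (measurableT_comp (@normr_measurable R setT)).
    apply: (measurableT_comp (@measurable_time_profile e a c r t)
       (g := fun z : R * R => (z.2 - a * z.1, z.1))).
    exact: measurable_fun_pair.
  by move=> z; rewrite lee_fin.
apply: (@le_trans _ _ (\int[mu]_(s in `[0%R, t])
   (K%:E * (\int[mu]_l (A s l)%:E + (C2 * cusp 1 (t - s))%:E)))%E).
  apply: ge0_integral_mono => s; rewrite /= in_itv/= => st.
    rewrite mule_ge0//.
      rewrite lee_fin addr_ge0// divr_ge0//; case/andP: st => _ st.
      by rewrite subr_ge0.
    apply: integral_ge0 => y _; rewrite lee_fin.
    by rewrite (mulr_ge0 (mulr_ge0 _ (w0 _ _)))// invr_ge0 sqrtr_ge0.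
  exact: step.
have mC : measurable_fun `[0%R, t]%classic (fun s => (C2 * cusp 1 (t - s))%:E).
  by apply/measurable_EFinP; apply: measurable_funTS; exact: measurable_funM.
have IA0 s : (0 <= \int[mu]_l (A s l)%:E)%E by apply: integral_ge0 => l _; rewrite lee_fin.
have C0 s : (0 <= (C2 * cusp 1 (t - s))%:E)%E.
  by rewrite lee_fin mulr_ge0 ?cusp_ge0// ltW.
rewrite ge0_integralZl_EFin//; last 2 first.
- by move=> s _; rewrite adde_ge0.
- exact: emeasurable_funD.
rewrite ge0_integralD//.
have iC : (\int[mu]_(s in `[0%R, t]) (C2 * cusp 1 (t - s))%:E <= (C2 * 8)%:E)%E.
  under eq_integral do rewrite EFinM.
  rewrite ge0_integralZl_EFin ?(ltW C20)//; last 2 first.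
  - by move=> s _; rewrite lee_fin cusp_ge0.
  - by apply/measurable_EFinP; exact: measurable_funTS.
  rewrite EFinM lee_wpmul2l ?lee_fin ?(ltW C20)//.
  apply: (le_trans (integral_itv_le_line _ mcu _)) => //.
    by move=> s; exact: cusp_ge0.
  rewrite (@integral_subl R t (fun u => (cusp 1 u)%:E)); last 2 first.
  - by apply/measurable_EFinP; exact: measurable_cusp.
  - by move=> u; rewrite lee_fin cusp_ge0.
  have := @integral_cusp R 0 1 ltr01.
  under eq_integral do rewrite subr0.
  by rewrite /root4 !sqrtr1 mulr1.
have iA := @integral_profile_le e k a c r t L k0 t0 L0 hL.
apply: (@le_trans _ _ (K%:E * (((2 * L + 16) * (2 * k^-1))%:E + (C2 * 8)%:E))%E).
  by rewrite lee_wpmul2l ?lee_fin// leeD.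
rewrite -EFinD -EFinM lee_fin.
have : (2 * L + 16) * (2 * k^-1) + C2 * 8 <= C3 * (1 + L).
  rewrite /C3; have : 0 <= L * k^-1 by rewrite mulr_ge0// ltW.
  have : 0 <= L * C2 by rewrite mulr_ge0// ltW.
  nra.
move=> h; rewrite [leRHS](_ : _ = K * (C3 * (1 + L))); last by rewrite /K; ring.
by rewrite ler_wpM2l.
Qed.

End cone_estimate.

(** * Iterated integrals of continuous functions *)

Section continuity.
Context {R : realType} {P : topologicalType}.
Implicit Types f g : P -> R.

Lemma cont_cst (Q : topologicalType) (k : Q) : continuous (fun _ : P => k).
Proof. by move=> z; exact: cvg_cst. Qed.

Lemma contD f g : continuous f -> continuous g -> continuous (fun z => f z + g z).
Proof. by move=> cf cg z; apply: cvgD; [exact: cf|exact: cg]. Qed.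

Lemma contM f g : continuous f -> continuous g -> continuous (fun z => f z * g z).
Proof. by move=> cf cg z; apply: cvgM; [exact: cf|exact: cg]. Qed.

Lemma contN f : continuous f -> continuous (fun z => - f z).
Proof. by move=> cf z; apply: cvgN; exact: cf. Qed.

Lemma contX f n : continuous f -> continuous (fun z => f z ^+ n).
Proof.
move=> cf; elim: n => [|n IH]; first exact: cont_cst.
by under eq_fun do rewrite exprS; exact: contM.
Qed.

Lemma cont_norm f : continuous f -> continuous (fun z => `|f z|).
Proof. by move=> cf z; apply: cvg_norm; exact: cf. Qed.

Lemma cont_comp (h : R -> R) f : continuous h -> continuous f ->
  continuous (fun z => h (f z)).
Proof. by move=> ch cf z; apply: continuous_comp; [exact: cf|exact: ch]. Qed.

Lemma cont_sin f : continuous f -> continuous (fun z => sin (f z)).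
Proof. by move=> cf; apply: cont_comp => //; exact: continuous_sin. Qed.

Lemma cont_cos f : continuous f -> continuous (fun z => cos (f z)).
Proof. by move=> cf; apply: cont_comp => //; exact: continuous_cos. Qed.

Lemma cont_pair (Q S : topologicalType) (u : P -> Q) (v : P -> S) :
  continuous u -> continuous v -> continuous (fun z => (u z, v z)).
Proof. by move=> cu cv z; apply: cvg_pair; [exact: cu|exact: cv]. Qed.

Lemma cont_fst (Q S : topologicalType) (u : P -> Q * S) :
  continuous u -> continuous (fun z => (u z).1).
Proof. by move=> cu z; apply: continuous_comp; [exact: cu|exact: cvg_fst]. Qed.

Lemma cont_snd (Q S : topologicalType) (u : P -> Q * S) :
  continuous u -> continuous (fun z => (u z).2).
Proof. by move=> cu z; apply: continuous_comp; [exact: cu|exact: cvg_snd]. Qed.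

Lemma cont_id : continuous (fun z : P => z).
Proof. by move=> z; exact: cvg_id. Qed.

Lemma cont_fcomp (Q S : topologicalType) (h : Q -> S) (u : P -> Q) :
  continuous h -> continuous u -> continuous (fun z => h (u z)).
Proof. by move=> ch cu z; apply: continuous_comp; [exact: cu|exact: ch]. Qed.

End continuity.

(* Dispatching on the head symbol avoids the costly failing unifications of a
   [first [apply ..]] search. *)
Ltac cont := lazymatch goal with
  | |- continuous (fun _ => ?k) => exact: (@cont_cst _ _ k)
  | |- continuous (fun z => z) => exact: cont_id
  | |- continuous (fun z => @GRing.add _ (@?f z) (@?g z)) => apply: (@contD _ _ f g); cont
  | |- continuous (fun z => @GRing.mul _ (@?f z) (@?g z)) => apply: (@contM _ _ f g); cont
  | |- continuous (fun z => @GRing.opp _ (@?f z)) => apply: (@contN _ _ f); cont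
  | |- continuous (fun z => @GRing.exp _ (@?f z) ?n) => apply: (@contX _ _ f n); cont
  | |- continuous (fun z => @Num.norm _ _ (@?f z)) => apply: (@cont_norm _ _ f); cont
  | |- continuous (fun z => sin (@?f z)) => apply: (@cont_sin _ _ f); cont
  | |- continuous (fun z => cos (@?f z)) => apply: (@cont_cos _ _ f); cont
  | |- continuous (fun z => (@?u z, @?v z)) => apply: (@cont_pair _ _ _ u v); cont
  | |- continuous (fun z => (@?u z).1) => apply: (@cont_fst _ _ _ u); cont
  | |- continuous (fun z => (@?u z).2) => apply: (@cont_snd _ _ _ u); cont
  | |- continuous (fun z => ?h (@?u z)) =>
      try first [assumption | apply: (@cont_fcomp _ _ _ h u); [assumption | cont]]
  | _ => try assumption
  end.

Section rint.
Context {R : realType}.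
Notation mu := (@lebesgue_measure R).
Implicit Types (a b : R) (f g : R -> R).

Definition rint a b f : R := Rintegral mu `[a, b] f.

Lemma rint_integrable a b f : continuous f -> mu.-integrable `[a, b] (EFin \o f).
Proof.
move=> cf; apply: continuous_compact_integrable; first exact: segment_compact.
exact: continuous_subspaceT.
Qed.

Lemma EFin_rint a b f : continuous f ->
  (rint a b f)%:E = (\int[mu]_(x in `[a, b]) (f x)%:E)%E.
Proof.
move=> cf; rewrite /rint /Rintegral fineK//.
by apply: integrable_fin_num => //; exact: rint_integrable.
Qed.

Lemma eq_rint a b f g : (forall x, a <= x <= b -> f x = g x) -> rint a b f = rint a b g.
Proof.
by move=> fg; apply: eq_Rintegral => x; rewrite inE/= in_itv/=; exact: fg.
Qed.

Lemma rintD a b f g : continuous f -> continuous g ->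
  rint a b (fun x => f x + g x) = rint a b f + rint a b g.
Proof. by move=> cf cg; rewrite /rint RintegralD//; exact: rint_integrable. Qed.

Lemma rintZl a b k f : continuous f -> rint a b (fun x => k * f x) = k * rint a b f.
Proof. by move=> cf; rewrite /rint RintegralZl//; exact: rint_integrable. Qed.

Lemma rint0 a b : rint a b (fun=> 0) = 0.
Proof. by rewrite /rint /Rintegral integral0_eq. Qed.

Lemma ler_rint a b f g : continuous f -> continuous g ->
  (forall x, a <= x <= b -> f x <= g x) -> rint a b f <= rint a b g.
Proof.
move=> cf cg fg; apply: le_Rintegral.
- exact: measurable_itv.
- exact: rint_integrable.
- exact: rint_integrable.
by move=> x /=; rewrite in_itv/=; exact: fg.
Qed.

Lemma ler_norm_rint a b f : continuous f -> `|rint a b f| <= rint a b (fun x => `|f x|).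
Proof. by move=> cf; apply: le_normr_Rintegral => //; exact: rint_integrable. Qed.

Lemma rint_cst a b (k : R) : a <= b -> rint a b (fun=> k) = k * (b - a).
Proof.
rewrite le_eqVlt => /predU1P[<-|ab].
  by rewrite /rint set_itv1 Rintegral_set1 subrr mulr0.
apply: EFin_inj; rewrite EFin_rint; last exact: cont_cst.
by rewrite integral_cst//= lebesgue_measure_itv/= lte_fin ab -EFinB -EFinM.
Qed.

Lemma rint_FTC a b (F f : R -> R) : a <= b -> continuous f -> continuous F ->
  (forall x : R, a < x < b -> is_derive x (1 : R) F (f x)) -> rint a b f = F b - F a.
Proof.
rewrite le_eqVlt => /predU1P[<-|ab] cf cF dF.
  by rewrite /rint set_itv1 Rintegral_set1 subrr.
apply: EFin_inj; rewrite EFin_rint// (continuous_FTC2 (F := F) ab)//.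
- exact: continuous_subspaceT.
- split.
  + by move=> u; rewrite in_itv/= => /dF[].
  + exact/cvg_at_right_filter/cF.
  + exact/cvg_at_left_filter/cF.
- by move=> u; rewrite in_itv/= => /dF[_ <-]; rewrite derive1E.
Qed.

(** Around each [x] of the segment both values are compared with [h (p, x)]; compactness makes the
    neighbourhood of [p] independent of [x]. *)
Lemma near_segment (P : topologicalType) a b (h : P * R -> R) (p : P) (e : R) :
  continuous h -> 0 < e ->
  \forall q \near p, forall x, a <= x <= b -> `|h (q, x) - h (p, x)| < e.
Proof.
move=> ch e0.
have := (iffLR (compact_near_coveringP _) (@segment_compact R a b)) P (nbhs p)
  (fun q x => `|h (q, x) - h (p, x)| < e) _ _.
have e2 : 0 < e / 2 by rewrite divr_gt0.
move=> /(_ (nbhs_filter p)) H.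
have {}H := H _; apply: filterS (H _).
  by move=> q Hq x xab; apply: Hq => /=; rewrite in_itv.
move=> x _.
have c1 := ch (p, x).
have /cvgrPdist_lt/(_ _ e2) h1 := c1.
have [[U V] [/= Up Vx] UV] := h1.
exists (V, U) => //= -[x' q] /= [Vx' Uq].
have /= a1 := UV (q, x') (conj Uq Vx').
have /= a2 := UV (p, x') (conj (nbhs_singleton Up) Vx').
rewrite (_ : h (q, x') - h (p, x') =
   (h (p, x) - h (p, x')) - (h (p, x) - h (q, x'))); last by ring.
by rewrite (le_lt_trans (ler_normB _ _))// [ltRHS](splitr e) ltrD.
Qed.

Lemma rint_continuous (P : topologicalType) a b (h : P * R -> R) :
  continuous h -> continuous (fun p => rint a b (fun x => h (p, x))).
Proof.
move=> ch p; have [ab|ba] := leP a b; last first.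
  have -> : (fun p => rint a b (fun x => h (p, x))) = (fun=> 0).
    apply/funext => q; rewrite (eq_rint (g := fun=> 0)) ?rint0// => x /andP[ax xb].
    by have := le_trans ax xb; rewrite leNgt ba.
  exact: cvg_cst.
have hq q : continuous (fun x => h (q, x)) by cont.
apply/cvgrPdist_lt => e e0.
have d0 : 0 < e / (1 + (b - a)) by rewrite divr_gt0// ltr_pwDl// subr_ge0.
near=> q.
have N : forall x, a <= x <= b -> `|h (q, x) - h (p, x)| < e / (1 + (b - a)).
  by near: q; exact: near_segment.
have -> : rint a b (fun x => h (p, x)) - rint a b (fun x => h (q, x)) =
    rint a b (fun x => h (p, x) + -1 * h (q, x)).
  by rewrite rintD// ?rintZl ?mulN1r//; cont.
apply: (le_lt_trans (ler_norm_rint _ _ _)); first by cont.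
apply: (@le_lt_trans _ _ (rint a b (fun=> e / (1 + (b - a))))).
  apply: ler_rint; [by cont|by cont|] => x /N; rewrite mulN1r distrC => /ltW.
  by [].
rewrite rint_cst// mulrAC ltr_pdivrMr ?ltr_pM2l//; last by rewrite ltr_pwDl// subr_ge0.
by rewrite ltrDr.
Unshelve. all: by end_near. Qed.

Lemma rint_swap_ge0 a b c d (h : R * R -> R) : continuous h -> (forall z, 0 <= h z) ->
  rint a b (fun x => rint c d (fun y => h (x, y))) =
  rint c d (fun y => rint a b (fun x => h (x, y))).
Proof.
move=> ch h0.
have c1 x : continuous (fun y => h (x, y)) by cont.
have c2 y : continuous (fun x => h (x, y)) by cont.
apply: EFin_inj; rewrite EFin_rint; last exact: rint_continuous.
rewrite EFin_rint; last first.
  by apply: (@rint_continuous R a b (fun z => h (z.2, z.1))); cont.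
under eq_integral do rewrite EFin_rint//.
under [RHS]eq_integral do rewrite EFin_rint//.
pose B (z : R * R) :=
  ((if ((a <= z.1) && (z.1 <= b)) && ((c <= z.2) && (z.2 <= d)) then h z else 0) : R)%:E.
have m1 := @measurable_fst12 R; have m2 := @measurable_snd12 R.
have mB : measurable_fun [set: measurableTypeR R * measurableTypeR R] B.
  apply/measurable_EFinP; apply: measurable_fun_ifT => //.
    by apply: measurable_and; apply: measurable_and; apply: measurable_fun_ler.
  exact: continuous_measurable_prod.
have B0 z : (0 <= B z)%E by rewrite lee_fin; case: ifP.
have := integral2_swap mB B0.
rewrite (_ : \int[mu]_x _ = \int[mu]_(x in `[a, b]) \int[mu]_(y in `[c, d]) (h (x, y))%:E)%E;
  last first.
  rewrite [RHS]integral_mkcond; apply: eq_integral => x _; rewrite /patch mem_setE in_itv/=.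
  case: ifPn => xab.
    rewrite [RHS]integral_mkcond; apply: eq_integral => y _.
    by rewrite /patch mem_setE in_itv/= /B/= xab/=; case: ifPn.
  by rewrite integral0_eq// => y _; rewrite /B/= (negbTE xab).
move=> ->.
rewrite [RHS]integral_mkcond; apply: eq_integral => y _; rewrite /patch mem_setE in_itv/=.
case: ifPn => ycd.
  rewrite [RHS]integral_mkcond; apply: eq_integral => x _.
  by rewrite /patch mem_setE in_itv/= /B/= ycd/= andbT; case: ifPn.
by rewrite integral0_eq// => x _; rewrite /B/= (negbTE ycd) andbF.
Qed.

(** A continuous [h] is the difference of |h| + h and |h|, which are continuous and nonnegative, so
    that Tonelli applies to each. *)
Lemma rint_swap a b c d (h : R * R -> R) : continuous h ->
  rint a b (fun x => rint c d (fun y => h (x, y))) =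
  rint c d (fun y => rint a b (fun x => h (x, y))).
Proof.
move=> ch.
pose p z := `|h z| + h z; pose n z := `|h z|.
have cp : continuous p by rewrite /p; cont.
have cn : continuous n by rewrite /n; cont.
have hE x y : h (x, y) = p (x, y) + -1 * n (x, y) by rewrite /p /n; ring.
have p0 z : 0 <= p z by rewrite /p -lerBlDr sub0r (le_trans (ler_norm _))// normrN.
have n0 z : 0 <= n z by exact: normr_ge0.
have swapE (u v a' b' c' d' : R) (g : R * R -> R) (q : R * R -> R) :
    continuous g -> continuous q ->
    rint a' b' (fun x => rint c' d' (fun y => g (x, y) + -1 * q (x, y))) =
    rint a' b' (fun x => rint c' d' (fun y => g (x, y))) +
    -1 * rint a' b' (fun x => rint c' d' (fun y => q (x, y))).
  move=> cg cq.
  have cgx x : continuous (fun y => g (x, y)) by cont.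
  have cqx x : continuous (fun y => q (x, y)) by cont.
  rewrite -rintZl; last exact: rint_continuous.
  rewrite -rintD; [|exact: rint_continuous|by cont; exact: rint_continuous].
  by apply: eq_rint => x _; rewrite rintD ?rintZl//; cont.
under eq_rint => x _ do under eq_rint => y _ do rewrite hE.
under [RHS]eq_rint => y _ do under eq_rint => x _ do rewrite hE.
rewrite swapE// (swapE 0 0 c d a b (fun z => p (z.2, z.1)) (fun z => n (z.2, z.1))); [|by cont..].
by rewrite (rint_swap_ge0 a b c d cp p0) (rint_swap_ge0 a b c d cn n0).
Qed.

End rint.

(** * Functions of class C1 *)

Section difference_quotients.
Context {R : realType}.
Implicit Types f g : R -> R.

Lemma is_derive_quotP f (u l : R) :
  is_derive u (1 : R) f l <-> (f (u + h) - f u) / h @[h --> 0^'] --> l.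
Proof.
have E : (fun h => h^-1 *: (f (h *: (1 : R) + u) - f u)) = (fun h => (f (u + h) - f u) / h).
  by apply/funext => h; rewrite /GRing.scale/= mulr1 mulrC [h + u]addrC.
split.
  case=> df <-; move: df; rewrite /derivable /derive /= E.
  by [].
move=> cf; split; first by rewrite /derivable E; apply/cvg_ex; exists l.
by rewrite /derive E; exact: cvg_lim.
Qed.

Lemma near_cvg_to (P T : topologicalType) (G : set_system P) {FG : Filter G}
    (p q : P -> T) (l : T) : (\forall h \near G, p h = q h) -> p h @[h --> G] --> l -> q h @[h
      --> G] --> l.
Proof. by move=> pq; apply: cvg_trans; exact: near_eq_cvg. Qed.

Lemma cvg_increment f (u l : R) : is_derive u (1 : R) f l ->
  f (u + h) - f u @[h --> 0^'] --> (0 : R).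
Proof.
move=> /is_derive_quotP q.
have h0 : h @[h --> 0^'] --> (0 : R) by exact/cvg_within.
have H : (f (u + h) - f u) / h * h @[h --> 0^'] --> l * 0 by apply: cvgM.
rewrite mulr0 in H; apply: (near_cvg_to _ H).
near=> h; rewrite /= divfK//; near: h.
exact: nbhs_dnbhs_neq.
Unshelve. all: by end_near. Qed.

(** The integral form of the increment is valid for [a] of either sign and for [a = 0], and its
    second factor depends continuously on all parameters. It plays below the part of the mean value
    theorem. *)
Lemma rint_increment f g (x a : R) : continuous f -> continuous g ->
  (forall v : R, 0 < v < 1 -> is_derive (x + v * a) (1 : R) f (g (x + v * a))) ->
  f (x + a) - f x = a * rint 0 1 (fun v => g (x + v * a)).
Proof.
move=> cf cg dg.
rewrite -rintZl; last by cont.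
have c1 : continuous (fun v : R => a * g (x + v * a)) by cont.
have c2 : continuous (fun v : R => f (x + v * a)) by cont.
suff dF (v : R) : 0 < v < 1 ->
    is_derive v (1 : R) (fun v : R => f (x + v * a)) (a * g (x + v * a)).
  by rewrite (@rint_FTC R 0 1 _ _ ler01 c1 c2 dF) mul1r mul0r addr0.
move=> v01.
have dl : is_derive v (1 : R) (fun v : R => x + v * a) a.
  apply/is_derive_quotP; rewrite (_ : (fun h => _) = (fun h => (h * a) / h)); last first.
    by apply/funext => h; congr (_ / _); ring.
  apply: (@near_cvg_to R R (0 : R)^' _ (fun=> a)); last exact: cvg_cst.
  near=> h; rewrite /= mulrAC mulfV ?mul1r//; near: h.
  exact: nbhs_dnbhs_neq.
have := @is_derive1_comp R f (fun v => x + v * a) v _ _ (dg v v01) dl.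
by rewrite mulrC.
Unshelve. all: by end_near. Qed.

End difference_quotients.

Section C1_cylinder.
Context {R : realType}.
Notation spacetime := ((R * R) * R)%type.

(* [F] is defined on all of space-time: in the application it is frozen in time
   outside of [0, t]. *)
Definition C1_cylinder (t : R) (F D0 D1 D2 : spacetime -> R) : Prop :=
  [/\ continuous F, continuous D0, continuous D1 & continuous D2] /\
  [/\ (forall y1 y2 s : R,
        is_derive y1 (1 : R) (fun u => F ((u, y2), s)) (D1 ((y1, y2), s))),
      (forall y1 y2 s : R,
        is_derive y2 (1 : R) (fun u => F ((y1, u), s)) (D2 ((y1, y2), s))) &
      (forall y1 y2 s : R, 0 < s < t ->
        is_derive s (1 : R) (fun u => F ((y1, y2), u)) (D0 ((y1, y2), s)))].

(** The increment is split into one step along each axis. Space derivatives exist at all times, so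
    only the step in time has to stay inside []0, t[], unless it is void. *)
Lemma C1_cylinder_increment t F D0 D1 D2 (C : C1_cylinder t F D0 D1 D2)
    (y1 y2 s a b e : R) :
  (forall v, 0 < v < 1 -> 0 < s + v * e < t) \/ e = 0 ->
  F ((y1 + a, y2 + b), s + e) - F ((y1, y2), s) =
  a * rint 0 1 (fun v => D1 ((y1 + v * a, y2 + b), s + e)) +
  b * rint 0 1 (fun v => D2 ((y1, y2 + v * b), s + e)) +
  e * rint 0 1 (fun v => D0 ((y1, y2), s + v * e)).
Proof.
move: C => [[cF c0 c1 c2] [d1 d2 d0]] hs.
have -> : F ((y1 + a, y2 + b), s + e) - F ((y1, y2), s) =
  (F ((y1 + a, y2 + b), s + e) - F ((y1, y2 + b), s + e)) +
  (F ((y1, y2 + b), s + e) - F ((y1, y2), s + e)) +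
  (F ((y1, y2), s + e) - F ((y1, y2), s)) by ring.
congr (_ + _ + _).
- have cf : continuous (fun u : R => F ((u, y2 + b), s + e)) by cont.
  have cg : continuous (fun u : R => D1 ((u, y2 + b), s + e)) by cont.
  exact: (@rint_increment R _ _ y1 a cf cg (fun v _ => d1 _ _ _)).
- have cf : continuous (fun u : R => F ((y1, u), s + e)) by cont.
  have cg : continuous (fun u : R => D2 ((y1, u), s + e)) by cont.
  exact: (@rint_increment R _ _ y2 b cf cg (fun v _ => d2 _ _ _)).
- case: hs => [hs|->]; last by rewrite addr0 subrr mul0r.
  have cf : continuous (fun u : R => F ((y1, y2), u)) by cont.
  have cg : continuous (fun u : R => D0 ((y1, y2), u)) by cont.
  exact: (@rint_increment R _ _ s e cf cg (fun v v01 => d0 _ _ _ (hs v v01))).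
Qed.

(** The three integral factors of the increment are continuous in the step, so they tend to the
    partial derivatives. A curve at constant time is allowed at every time, including [0] and
    [t]. *)
Lemma is_derive_C1_cylinder t F D0 D1 D2 (C : C1_cylinder t F D0 D1 D2)
    (y1 y2 s : R -> R) (u a b e : R) :
  is_derive u (1 : R) y1 a -> is_derive u (1 : R) y2 b -> is_derive u (1 : R) s e ->
  0 < s u < t \/ (forall v, s v = s u) ->
  let p := ((y1 u, y2 u), s u) in
  is_derive u (1 : R) (fun v => F ((y1 v, y2 v), s v)) (D1 p * a + D2 p * b + D0 p * e).
Proof.
move=> da db de hs p; apply/is_derive_quotP.
have [[cF c0 c1 c2] _] := C.
pose A1 (z : spacetime) :=
  rint 0 1 (fun v => D1 ((y1 u + v * z.1.1, y2 u + z.1.2), s u + z.2)).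
pose A2 (z : spacetime) :=
  rint 0 1 (fun v => D2 ((y1 u, y2 u + v * z.1.2), s u + z.2)).
pose A0 (z : spacetime) := rint 0 1 (fun v => D0 ((y1 u, y2 u), s u + v * z.2)).
pose z h := ((y1 (u + h) - y1 u, y2 (u + h) - y2 u), s (u + h) - s u).
have cz : z h @[h --> 0^'] --> ((0, 0), 0).
  exact: cvg_pair (cvg_pair (cvg_increment da) (cvg_increment db)) (cvg_increment de).
have lim (A : spacetime -> R) : continuous A -> A (z h) @[h --> 0^'] --> A ((0, 0), 0).
  by move=> cA; exact: (cvg_comp _ _ cz (cA ((0, 0), 0))).
have rc (k : R) : rint 0 1 (fun _ : R => k) = k by rewrite rint_cst// subr0 mulr1.
have E1 : A1 ((0, 0), 0) = D1 p.
  by rewrite /A1/= !addr0 -[RHS]rc; apply: eq_rint => v _; rewrite mulr0 addr0.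
have E2 : A2 ((0, 0), 0) = D2 p.
  by rewrite /A2/= !addr0 -[RHS]rc; apply: eq_rint => v _; rewrite mulr0 addr0.
have E0 : A0 ((0, 0), 0) = D0 p.
  by rewrite /A0/= -[RHS]rc; apply: eq_rint => v _; rewrite mulr0 addr0.
have l1 : A1 (z h) @[h --> 0^'] --> D1 p.
  rewrite -E1; apply: lim; apply: (@rint_continuous R _ 0 1 (fun q : spacetime * R =>
    D1 ((y1 u + q.2 * q.1.1.1, y2 u + q.1.1.2), s u + q.1.2))); by cont.
have l2 : A2 (z h) @[h --> 0^'] --> D2 p.
  rewrite -E2; apply: lim; apply: (@rint_continuous R _ 0 1 (fun q : spacetime * R =>
    D2 ((y1 u, y2 u + q.2 * q.1.1.2), s u + q.1.2))); by cont.
have l0 : A0 (z h) @[h --> 0^'] --> D0 p.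
  rewrite -E0; apply: lim; apply: (@rint_continuous R _ 0 1 (fun q : spacetime * R =>
    D0 ((y1 u, y2 u), s u + q.2 * q.1.2))); by cont.
have qa := (is_derive_quotP _ _ _).1 da.
have qb := (is_derive_quotP _ _ _).1 db.
have qe := (is_derive_quotP _ _ _).1 de.
have L : A1 (z h) * ((y1 (u + h) - y1 u) / h) + A2 (z h) * ((y2 (u + h) - y2 u) / h) +
    A0 (z h) * ((s (u + h) - s u) / h) @[h --> 0^'] --> D1 p * a + D2 p * b + D0 p * e.
  by apply: cvgD; [apply: cvgD|]; apply: cvgM.
apply: (near_cvg_to _ L).
have nh : \forall h \near 0^', (forall v, 0 < v < 1 ->
    0 < s u + v * (s (u + h) - s u) < t) \/ s (u + h) - s u = 0.
  case: hs => [/andP[s0 st]|sE]; last first.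
    by apply: nearW => h; right; rewrite sE subrr.
  have m0 : 0 < Num.min (s u) (t - s u) by rewrite lt_min s0 subr_gt0.
  have /cvgrPdist_lt/(_ _ m0) := cvg_increment de.
  apply: filterS => h; rewrite sub0r normrN lt_min => /andP[h1 h2]; left => v /andP[v0 v1].
  have vh : `|v * (s (u + h) - s u)| <= `|s (u + h) - s u|.
    by rewrite normrM (gtr0_norm v0) ler_piMl// ltW.
  have := le_lt_trans vh h1; have := le_lt_trans vh h2.
  rewrite !ltr_norml => /andP[_ k2] /andP[k1 _].
  by apply/andP; split; lra.
near=> h.
have hh : h != 0 by near: h; exact: nbhs_dnbhs_neq.
have H : (forall v, 0 < v < 1 -> 0 < s u + v * (s (u + h) - s u) < t) \/
    s (u + h) - s u = 0 by near: h.
have := @C1_cylinder_increment t F D0 D1 D2 C (y1 u) (y2 u) (s u)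
  (y1 (u + h) - y1 u) (y2 (u + h) - y2 u) (s (u + h) - s u) H.
rewrite !(addrC (_ u) (_ - _ u)) !subrK => E.
have -> : F (y1 (u + h), y2 (u + h), s (u + h)) - F (y1 u, y2 u, s u) =
  (y1 (u + h) - y1 u) * A1 (z h) + (y2 (u + h) - y2 u) * A2 (z h) +
  (s (u + h) - s u) * A0 (z h).
  rewrite E /A1 /A2 /A0 /=.
  congr (_ * _ + _ * _ + _ * _); apply: eq_rint => v _.
  - by rewrite !(addrC (_ u) (_ - _ u)) !subrK.
  - by rewrite !(addrC (s u) (_ - _ u)) !subrK.
by move: (A1 _) (A2 _) (A0 _) => a1 a2 a0; ring.
Unshelve. all: by end_near. Qed.

End C1_cylinder.

(** * Integrals over the box of one time and two angles *)

Section triple.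
Context {R : realType}.
Notation spacetime := ((R * R) * R)%type.
Implicit Types (g h : spacetime -> R) (t : R).

Definition rint3 t g : R := rint 0 t (fun s =>
  rint (- (pi / 2)) (pi / 2) (fun th => rint (- (pi / 2)) (pi / 2) (fun ch => g ((s, th), ch)))).

Lemma rint3_continuous (P : topologicalType) t (h : P * spacetime -> R) : continuous h ->
  continuous (fun p => rint3 t (fun z => h (p, z))).
Proof.
move=> ch.
apply: (@rint_continuous R P 0 t (fun q => rint (- (pi / 2)) (pi / 2) (fun th =>
  rint (- (pi / 2)) (pi / 2) (fun ch => h (q.1, ((q.2, th), ch)))))).
apply: (@rint_continuous R _ (- (pi / 2)) (pi / 2) (fun q : (P * R) * R =>
  rint (- (pi / 2)) (pi / 2) (fun ch => h (q.1.1, ((q.1.2, q.2), ch))))).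
apply: (@rint_continuous R _ (- (pi / 2)) (pi / 2) (fun q : ((P * R) * R) * R =>
  h (q.1.1.1, ((q.1.1.2, q.1.2), q.2)))).
by cont.
Qed.

Lemma rint2_continuous g : continuous g -> continuous (fun s : R =>
  rint (- (pi / 2)) (pi / 2) (fun th => rint (- (pi / 2)) (pi / 2) (fun ch => g ((s, th), ch)))).
Proof.
move=> cg.
apply: (@rint_continuous R R (- (pi / 2)) (pi / 2) (fun q : R * R =>
  rint (- (pi / 2)) (pi / 2) (fun ch => g ((q.1, q.2), ch)))).
apply: (@rint_continuous R _ (- (pi / 2)) (pi / 2) (fun q : (R * R) * R =>
  g ((q.1.1, q.1.2), q.2))).
by cont.
Qed.

Lemma rint1_continuous g (s : R) : continuous g ->
  continuous (fun th : R => rint (- (pi / 2)) (pi / 2) (fun ch => g ((s, th), ch))).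
Proof.
move=> cg; apply: (@rint_continuous R _ (- (pi / 2)) (pi / 2) (fun q : R * R =>
  g ((s, q.1), q.2))).
by cont.
Qed.

Definition box t (z : spacetime) : Prop :=
  [/\ 0 <= z.1.1 <= t, - (pi / 2) <= z.1.2 <= pi / 2 & - (pi / 2) <= z.2 <= pi / 2].

Lemma eq_rint3 t g h : (forall z, box t z -> g z = h z) -> rint3 t g = rint3 t h.
Proof.
move=> gh; apply: eq_rint => s s0; apply: eq_rint => th th0; apply: eq_rint => ch ch0.
exact: gh.
Qed.

Lemma rint3D t g h : continuous g -> continuous h ->
  rint3 t (fun z => g z + h z) = rint3 t g + rint3 t h.
Proof.
move=> cg ch; rewrite -rintD; [|exact: rint2_continuous..].
apply: eq_rint => s _; rewrite -rintD; [|exact: rint1_continuous..].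
by apply: eq_rint => th _; rewrite rintD//; cont.
Qed.

Lemma rint3Zl t k g : continuous g -> rint3 t (fun z => k * g z) = k * rint3 t g.
Proof.
move=> cg; rewrite -rintZl; last exact: rint2_continuous.
apply: eq_rint => s _; rewrite -rintZl; last exact: rint1_continuous.
by apply: eq_rint => th _; rewrite rintZl//; cont.
Qed.

Lemma ler_rint3 t g h : continuous g -> continuous h ->
  (forall z, box t z -> g z <= h z) -> rint3 t g <= rint3 t h.
Proof.
move=> cg ch gh; apply: ler_rint => [| |s s0]; [exact: rint2_continuous..|].
apply: ler_rint => [| |th th0]; [exact: rint1_continuous..|].
by apply: ler_rint => [| |x x0]; [cont|cont|exact: gh].
Qed.

Lemma ler_norm_rint3 t g h : continuous g -> continuous h ->
  (forall z, box t z -> `|g z| <= h z) -> `|rint3 t g| <= rint3 t h.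
Proof.
move=> cg ch gh; rewrite ler_norml; apply/andP; split; last first.
  by apply: ler_rint3 => // z /gh; apply: le_trans; exact: ler_norm.
have -> : - rint3 t h = rint3 t (fun z => -1 * h z) by rewrite (rint3Zl _ _ ch) mulN1r.
apply: ler_rint3; [by cont|by []|].
by move=> z /gh; rewrite mulN1r ler_norml => /andP[].
Qed.

(** The difference quotient of the integrand is [q (h, z)], which is continuous up to [h = 0];
    differentiation under the integral sign is then continuity of an integral in its parameter. *)
Lemma is_derive_rint3 t (f : R -> spacetime -> R) (q : R * spacetime -> R) (x : R) :
  (forall u, continuous (f u)) -> continuous q ->
  (forall (h : R) z, f (x + h) z - f x z = h * q (h, z)) ->
  is_derive x (1 : R) (fun u => rint3 t (f u)) (rint3 t (fun z => q (0, z))).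
Proof.
move=> cf cq fq; apply/is_derive_quotP.
have cJ := @rint3_continuous R t q cq.
have L : rint3 t (fun z => q (h, z)) @[h --> 0^'] --> rint3 t (fun z => q (0, z)).
  by apply: cvg_within_filter; exact: cJ.
apply: (near_cvg_to _ L); near=> h.
have hh : h != 0 by near: h; exact: nbhs_dnbhs_neq.
have cqh : continuous (fun z => q (h, z)) by cont.
have cfx : continuous (fun z => -1 * f x z) by have cfx := cf x; cont.
have -> : rint3 t (f (x + h)) - rint3 t (f x) = h * rint3 t (fun z => q (h, z)).
  rewrite -(rint3Zl t h cqh) -mulN1r -(rint3Zl t (-1) (cf x)) -(rint3D t (cf _) cfx).
  by apply: eq_rint3 => z _; rewrite mulN1r fq.
by rewrite mulrC mulKf.
Unshelve. all: by end_near. Qed.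

(** The variable [x] only translates the argument of [F], so the integral factor of
    [C1_cylinder_increment] provides the continuous quotient [q]. *)
Lemma is_derive_rint3_shift t T F D0 D1 D2 (W W1 W2 : spacetime -> R) (x1 x2 : R) :
  C1_cylinder T F D0 D1 D2 -> continuous W -> continuous W1 -> continuous W2 ->
  is_derive x1 (1 : R)
    (fun u => rint3 t (fun z => W z * F ((u - W1 z, x2 - W2 z), z.1.1)))
    (rint3 t (fun z => W z * D1 ((x1 - W1 z, x2 - W2 z), z.1.1))) /\
  is_derive x2 (1 : R)
    (fun u => rint3 t (fun z => W z * F ((x1 - W1 z, u - W2 z), z.1.1)))
    (rint3 t (fun z => W z * D2 ((x1 - W1 z, x2 - W2 z), z.1.1))).
Proof.
move=> C cW cW1 cW2; have [[cF c0 c1 c2] _] := C.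
have rc (k : R) : rint 0 1 (fun _ : R => k) = k by rewrite rint_cst// subr0 mulr1.
split.
- pose q (p : R * spacetime) := W p.2 * rint 0 1 (fun v =>
    D1 ((x1 - W1 p.2 + v * p.1, x2 - W2 p.2), p.2.1.1)).
  have cq : continuous q.
    rewrite /q; cont; apply: (@rint_continuous R _ 0 1 (fun p : (R * spacetime) * R =>
      D1 ((x1 - W1 p.1.2 + p.2 * p.1.1, x2 - W2 p.1.2), p.1.2.1.1))).
    by cont.
  have -> : rint3 t (fun z => W z * D1 ((x1 - W1 z, x2 - W2 z), z.1.1)) =
      rint3 t (fun z => q (0, z)).
    apply: eq_rint3 => z _; rewrite /q /=; congr (_ * _); rewrite -[LHS]rc.
    by apply: eq_rint => v _; rewrite mulr0 addr0.
  apply: (@is_derive_rint3 t (fun u z => W z * F ((u - W1 z, x2 - W2 z), z.1.1)) q x1) => //.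
    by move=> u; cont.
  move=> h z.
  have := @C1_cylinder_increment R _ _ _ _ _ C (x1 - W1 z) (x2 - W2 z) z.1.1 h 0 0 (or_intror
    (erefl _)).
  rewrite !mul0r !addr0 => E.
  rewrite (addrAC x1 h) -mulrBr E /q /= mulrCA.
  by congr (_ * (_ * rint _ _ _)); apply/funext => v; rewrite !addr0.
- pose q (p : R * spacetime) := W p.2 * rint 0 1 (fun v =>
    D2 ((x1 - W1 p.2, x2 - W2 p.2 + v * p.1), p.2.1.1)).
  have cq : continuous q.
    rewrite /q; cont; apply: (@rint_continuous R _ 0 1 (fun p : (R * spacetime) * R =>
      D2 ((x1 - W1 p.1.2, x2 - W2 p.1.2 + p.2 * p.1.1), p.1.2.1.1))).
    by cont.
  have -> : rint3 t (fun z => W z * D2 ((x1 - W1 z, x2 - W2 z), z.1.1)) =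
      rint3 t (fun z => q (0, z)).
    apply: eq_rint3 => z _; rewrite /q /=; congr (_ * _); rewrite -[LHS]rc.
    by apply: eq_rint => v _; rewrite mulr0 addr0.
  apply: (@is_derive_rint3 t (fun u z => W z * F ((x1 - W1 z, u - W2 z), z.1.1)) q x2) => //.
    by move=> u; cont.
  move=> h z.
  have := @C1_cylinder_increment R _ _ _ _ _ C (x1 - W1 z) (x2 - W2 z) z.1.1 0 h 0 (or_intror
    (erefl _)).
  rewrite !mul0r !addr0 add0r => E.
  rewrite (addrAC x2 h) -mulrBr E /q /= mulrCA.
  by congr (_ * (_ * rint _ _ _)); apply/funext => v; rewrite !addr0.
Qed.

End triple.

(** * The solution operator on the backward cone *)

Section freeze.
Context {R : realType}.
Notation spacetime := ((R * R) * R)%type.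

Definition clamp (t s : R) : R := Num.max 0 (Num.min s t).

(** Agrees with [F] at the times of [[0, t]], turns continuity relative to the slab into continuity
    everywhere, and commutes with the space derivatives. *)
Definition freeze (t : R) (F : spacetime -> R) : spacetime -> R :=
  fun p => F (p.1, clamp t p.2).

Lemma clamp_itv t s : 0 <= t -> 0 <= clamp t s <= t.
Proof. by move=> t0; rewrite /clamp le_max lexx/= ge_max t0 ge_min lexx orbT. Qed.

Lemma clamp_id t s : 0 <= s <= t -> clamp t s = s.
Proof.
by move=> /andP[s0 st]; rewrite /clamp (min_idPl st); exact/max_idPr.
Qed.

Lemma continuous_clamp t : continuous (clamp t).
Proof.
have -> : clamp t = fun s => (0 + (s + t - `|s - t|) / 2 + `|0 - (s + t - `|s - t|) / 2|) / 2.
  by apply/funext => s; rewrite /clamp maxr_absE minr_absE.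
by cont.
Qed.

Lemma continuous_freeze (T t : R) F : 0 <= t < T ->
  {within slab T, continuous F} -> continuous (freeze t F).
Proof.
move=> /andP[t0 tT] /subspace_continuousP cF p.
have sp (q : spacetime) : slab T (q.1, clamp t q.2).
  by have /andP[c0 ct] := clamp_itv q.2 t0; apply/andP; split=> //=; exact: le_lt_trans tT.
have cc := @continuous_clamp t.
have cg : continuous (fun q : spacetime => (q.1, clamp t q.2)) by cont.
have gw : (fun q : spacetime => (q.1, clamp t q.2)) @ p -->
    within (slab T) (nbhs (p.1, clamp t p.2)).
  move=> B H; have K : \near p, slab T (p.1, clamp t p.2) -> B (p.1, clamp t p.2) := cg p _ H.
  change (\near p, B (p.1, clamp t p.2)).
  by apply: filterS K => q h; exact: h (sp q).
exact: (cvg_comp _ _ gw (cF _ (sp p))).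
Qed.

Lemma scale_e1D (h y1 y2 s : R) : h *: (e1 : spacetime) + (y1, y2, s) = (y1 + h, y2, s).
Proof.
change ((h * 1 + y1, h * 0 + y2, h * 0 + s) = (y1 + h, y2, s)).
by rewrite mulr1 !mulr0 !add0r addrC.
Qed.

Lemma scale_e2D (h y1 y2 s : R) : h *: (e2 : spacetime) + (y1, y2, s) = (y1, y2 + h, s).
Proof.
change ((h * 0 + y1, h * 1 + y2, h * 0 + s) = (y1, y2 + h, s)).
by rewrite mulr1 !mulr0 !add0r addrC.
Qed.

Lemma C1_cylinder_freeze (T t : R) F : 0 <= t < T -> smooth T F ->
  C1_cylinder t (freeze t F) (freeze t (d0 F)) (freeze t (d1 F)) (freeze t (d2 F)).
Proof.
move=> tT sF.
have [cF [dF [[c0 _] [c1 _] [c2 _]]]] := sF 1%N.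
split.
  split; [exact: (continuous_freeze tT cF)|exact: (continuous_freeze tT c0)
    |exact: (continuous_freeze tT c1)|exact: (continuous_freeze tT c2)].
have sp y s : slab T (y, clamp t s).
  case/andP: tT => t0 tT; have /andP[a0 at'] := clamp_itv s t0.
  by apply/andP; split=> //=; exact: le_lt_trans tT.
split.
- move=> y1 y2 s; have [_ D _] := dF _ (sp (y1, y2) s).
  apply/is_derive_quotP; rewrite /freeze/= /d1 /derive.
  have E : (fun h => h^-1 *: (F (h *: e1 + (y1, y2, clamp t s)) - F (y1, y2, clamp t s))) =
     (fun h : R => (F (y1 + h, y2, clamp t s) - F (y1, y2, clamp t s)) / h).
    by apply/funext => h; rewrite scale_e1D; exact: mulrC.
  by move: D; rewrite /derivable E.
- move=> y1 y2 s; have [_ _ D] := dF _ (sp (y1, y2) s).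
  apply/is_derive_quotP; rewrite /freeze/= /d2 /derive.
  have E : (fun h => h^-1 *: (F (h *: e2 + (y1, y2, clamp t s)) - F (y1, y2, clamp t s))) =
     (fun h : R => (F (y1, y2 + h, clamp t s) - F (y1, y2, clamp t s)) / h).
    by apply/funext => h; rewrite scale_e2D; exact: mulrC.
  by move: D; rewrite /derivable E.
- move=> y1 y2 s /andP[s0 st]; have [D _ _] := dF _ (sp (y1, y2) s).
  have s0t : 0 <= s <= t by rewrite (ltW s0) (ltW st).
  rewrite (clamp_id s0t) /derivable0 in D.
  apply/is_derive_quotP; rewrite /freeze/= (clamp_id s0t).
  have nb : \forall h \near (0 : R), 0 <= s + h <= t.
    have m0 : 0 < Num.min s (t - s) by rewrite lt_min s0 subr_gt0.
    apply/nbhs_ballP; exists (Num.min s (t - s)) => // h.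
    rewrite /ball/= sub0r normrN lt_min !ltr_norml => /andP[/andP[h1 _] /andP[_ h2]].
    by apply/andP; split; lra.
  (* As [0 < s], the constraint [0 <= s + h] holds for all small [h], and the limit in [d0] is
     two-sided. *)
  have L : diff_quot0 F (y1, y2, s) h @[h --> 0^'] --> d0 F (y1, y2, s).
    apply: cvg_trans D; apply: cvg_fmap2 => B /=.
    rewrite /time_incr /within/= => H; near=> h.
    have h0 : h != 0 by near: h; exact: nbhs_dnbhs_neq.
    have hh : 0 <= s + h <= t by near: h; exact: nbhs_dnbhs nb.
    have : h != 0 -> 0 <= s + h -> B h by near: h; exact: nbhs_dnbhs H.
    by apply=> //; case/andP: hh.
  apply: (near_cvg_to _ L); near=> h.
  rewrite /diff_quot0/= clamp_id//; near: h; exact: nbhs_dnbhs nb.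
Unshelve. all: by end_near. Qed.

End freeze.

Section disc.
Context {R : realType}.
Notation mu := (@lebesgue_measure R).
Notation mu2 := (mu \x mu)%E.
Notation spacetime := ((R * R) * R)%type.

Definition rint2 (g : R * R -> R) : R :=
  rint (- (pi / 2)) (pi / 2) (fun th => rint (- (pi / 2)) (pi / 2) (fun ch => g (th, ch))).

Lemma rint2D (g h : R * R -> R) : continuous g -> continuous h ->
  rint2 (fun z => g z + h z) = rint2 g + rint2 h.
Proof.
move=> cg ch; rewrite -rintD; [|exact: rint_continuous..].
by apply: eq_rint => th _; rewrite rintD//; cont.
Qed.

Lemma rint2Zl k (g : R * R -> R) : continuous g ->
  rint2 (fun z => k * g z) = k * rint2 g.
Proof.
move=> cg; rewrite -rintZl; last exact: rint_continuous.
by apply: eq_rint => th _; rewrite rintZl//; cont.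
Qed.

Lemma integral_kern_rint2 (f : R * R -> R) (rho : R) (x : R * R) :
  continuous f -> (forall y, 0 <= f y) -> 0 <= rho ->
  (\int[mu2]_y (f y * kern rho (x - y))%:E =
   (rint2 (fun z => rho * cos z.1 *
      f (x.1 - rho * sin z.1, x.2 - rho * (cos z.1 * sin z.2))))%:E)%E.
Proof.
move=> cf f0; rewrite le_eqVlt => /predU1P[<-|rho0].
  rewrite integral0_eq; last by move=> y _; rewrite kern0 mulr0.
  rewrite /rint2 (eq_rint (g := fun=> 0)) ?rint0// => th _.
  by rewrite (eq_rint (g := fun=> 0)) ?rint0// => ch _; rewrite !mul0r.
pose fx (z : R * R) := f (x.1 - z.1, x.2 - z.2).
have cfx : continuous fx by rewrite /fx; cont.
have mfx := continuous_measurable_prod cfx.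
have mF : measurable_fun [set: measurableTypeR R * measurableTypeR R]
    (fun z => (fx z)%:E) by exact/measurable_EFinP.
have mk : measurable_fun [set: measurableTypeR R * measurableTypeR R]
    (fun z => (fx z * kern rho z)%:E).
  by apply/measurable_EFinP; apply: measurable_funM => //; exact: measurable_kern.
have k0 (z : R * R) : 0 <= kern rho z by rewrite /kern invr_ge0 sqrtr_ge0.
have fk0 z : (0 <= (fx z * kern rho z)%:E)%E.
  by rewrite lee_fin; apply: mulr_ge0; [exact: f0|exact: k0].
have := integral2_subl x mk fk0.
rewrite (_ : \int[mu2]_z _ = \int[mu2]_y (f y * kern rho (x - y))%:E)%E; last first.
  apply: eq_integral => y _; congr (_ * _)%:E; rewrite /fx; congr f.
  by case: y => y1 y2; rewrite /= !subKr.
move=> ->.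
under eq_integral do rewrite EFinM.
rewrite (@integral_kern R rho (fun z => (fx z)%:E) rho0 mF)//; last by move=> z; rewrite lee_fin f0.
pose G (z : R * R) := rho * cos z.1 *
      f (x.1 - rho * sin z.1, x.2 - rho * (cos z.1 * sin z.2)).
have cG : continuous G by rewrite /G; cont.
rewrite -/G /rint2 EFin_rint; last exact: rint_continuous.
apply: eq_integral => th _; rewrite -EFin_rint; last by rewrite /fx /hemi/=; cont.
rewrite -EFinM; congr EFin; rewrite mulrC -rintZl; last by rewrite /fx /hemi/=; cont.
by apply: eq_rint.
Qed.

(** The positive and negative parts of [f] are continuous, and [integral_kern_rint2] gives each a
    finite integral against the kernel; the two are then recombined over the rectangle of angles. *)
Lemma Rintegral_disc (f : R * R -> R) (rho : R) (x : R * R) :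
  continuous f -> 0 <= rho ->
  Rintegral mu2 [set y | enorm (x - y) < rho]
    (fun y => f y / Num.sqrt (rho ^+ 2 - enorm (x - y) ^+ 2)) =
  rint2 (fun z => rho * cos z.1 *
      f (x.1 - rho * sin z.1, x.2 - rho * (cos z.1 * sin z.2))).
Proof.
move=> cf rho0.
pose fp y := (f y + `|f y|) / 2; pose fm y := (- f y + `|f y|) / 2.
have cfp : continuous fp by rewrite /fp; cont.
have cfm : continuous fm by rewrite /fm; cont.
have fp0 y : 0 <= fp y by rewrite /fp; have := ler_norm (- f y); rewrite normrN => ?; lra.
have fm0 y : 0 <= fm y by rewrite /fm; have := ler_norm (f y) => ?; lra.
have k0 (z : R * R) : 0 <= kern rho z by rewrite /kern invr_ge0 sqrtr_ge0.
pose g y := f y / Num.sqrt (rho ^+ 2 - enorm (x - y) ^+ 2).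
transitivity (fine (\int[mu2]_y (g y)%:E)%E).
  congr fine; apply: eq_integral_support; first by move=> y _ /(_ I).
  move=> y _ /= /negP; rewrite -leNgt => xy; congr EFin.
  rewrite ler0_sqrtr ?invr0 ?mulr0// subr_le0.
  by rewrite ler_sqr// nnegrE// (le_trans rho0).
rewrite integralE.
rewrite (_ : \int[mu2]_y _ = (\int[mu2]_y (fp y * kern rho (x - y))%:E))%E; last first.
  apply: eq_integral => y _; rewrite funeposE /kern -sqr_enorm.
  have := k0 (x - y); rewrite /kern -sqr_enorm; set k := (Num.sqrt _)^-1 => kk0.
  rewrite -EFin_max; congr EFin; rewrite -[X in Num.max _ X](mul0r k) -maxr_pMl//.
  by congr (_ * _); rewrite maxr_absE subr0 addr0.
rewrite [X in (_ - X)%E](_ : _ = (\int[mu2]_y (fm y * kern rho (x - y))%:E))%E; last first.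
  apply: eq_integral => y _; rewrite funenegE /kern -sqr_enorm.
  have := k0 (x - y); rewrite /kern -sqr_enorm; set k := (Num.sqrt _)^-1 => kk0.
  rewrite -EFinN -EFin_max; congr EFin; rewrite -mulNr -[X in Num.max _ X](mul0r k) -maxr_pMl//.
  by congr (_ * _); rewrite maxr_absE subr0 addr0 normrN.
rewrite !integral_kern_rint2//= -[X in _ - X]mul1r -mulNr -rint2Zl; last by cont.
rewrite -rint2D; [|by cont..].
apply: eq_rint => th _; apply: eq_rint => ch _ /=.
by rewrite /fp /fm; field.
Qed.

Definition cap_weight (t : R) (z : spacetime) : R := (t - z.1.1) * cos z.1.2.

Definition cap_point (c t : R) (x : R * R) (z : spacetime) : spacetime :=
  ((x.1 - c * (t - z.1.1) * sin z.1.2, x.2 - c * (t - z.1.1) * (cos z.1.2 * sin z.2)), z.1.1).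

(** The radius [c * (t - s)] contributes a factor [c] that cancels the one in the prefactor of
    [Lwave]; the remaining weight does not depend on [c]. *)
Lemma Lwave_rint3 (T t c : R) F (x : R * R) : 0 <= t < T -> 0 < c ->
  {within slab T, continuous F} ->
  Lwave c F (x, t) =
  (2 * pi)^-1 * rint3 t (fun z => cap_weight t z * freeze t F (cap_point c t x z)).
Proof.
move=> tT c0 cF; have cf := continuous_freeze tT cF.
rewrite /Lwave /=.
have -> : Rintegral mu `[0, t] (fun s => Rintegral mu2
    [set y | enorm (x - y) < c * (t - s)]
    (fun y => F (y, s) / Num.sqrt (c ^+ 2 * (t - s) ^+ 2 - enorm (x - y) ^+ 2))) =
  rint3 t (fun z => c * (cap_weight t z * freeze t F (cap_point c t x z))).
  apply: eq_rint => s st.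
  have cs0 : 0 <= c * (t - s).
    by rewrite mulr_ge0 ?(ltW c0)// subr_ge0; case/andP: st.
  have cfs : continuous (fun y => freeze t F (y, s)) by cont.
  rewrite -exprMn; transitivity (Rintegral mu2 [set y | enorm (x - y) < c * (t - s)]
    (fun y => freeze t F (y, s) / Num.sqrt ((c * (t - s)) ^+ 2 - enorm (x - y) ^+ 2))).
    by apply: eq_Rintegral => y _; rewrite /freeze/= clamp_id.
  rewrite (Rintegral_disc x cfs cs0).
  apply: eq_rint => th _; apply: eq_rint => ch _.
  by rewrite /cap_weight /cap_point/= !mulrA.
rewrite rint3Zl; last by rewrite /cap_weight /cap_point; cont.
by rewrite !invfM -!mulrA [c^-1 * _]mulrA mulVf ?gt_eqF// mul1r.
Qed.

(** Since 2 t - s = (t - s) (1 + t / (t - s)), the weight [2 * t - s] covers at once the kernel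
    weight [t - s] and the undifferentiated terms with factor [t]. The interval is open at [t],
    where the quotient degenerates. *)
Lemma rint3_cap_le (t c : R) (N : spacetime -> R) (x : R * R) : 0 <= t -> 0 < c ->
  continuous N -> (forall p, 0 <= N p) ->
  ((c * rint3 t (fun z => (2 * t - z.1.1) * cos z.1.2 * N (cap_point c t x z)))%:E =
   \int[mu]_(s in `[0%R, t[) ((1 + t / (t - s))%:E *
      \int[mu2]_y (N (y, s) * kern (c * (t - s)) (x - y))%:E))%E.
Proof.
move=> t0 c0 cN N0.
have cI : continuous (fun z : spacetime =>
    c * ((2 * t - z.1.1) * cos z.1.2 * N (cap_point c t x z))).
  by rewrite /cap_point; cont.
rewrite -rint3Zl; last by rewrite /cap_point; cont.
have cJ := rint2_continuous cI.
rewrite /rint3 EFin_rint// -integral_itv_bndo_bndc; last first.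
  by apply/measurable_EFinP; apply: measurable_funTS; exact: continuous_measurable_fun.
apply: eq_integral => s; rewrite inE/= in_itv/= => /andP[s0 st].
have cs0 : 0 <= c * (t - s) by rewrite mulr_ge0 ?(ltW c0)// subr_ge0 ltW.
have cNs : continuous (fun y => N (y, s)) by cont.
rewrite (integral_kern_rint2 x cNs)// -EFinM; congr EFin.
rewrite -rint2Zl; last by cont.
apply: eq_rint => th _; apply: eq_rint => ch _ /=.
rewrite /cap_point/=; move: (N _) => n.
by field; rewrite subr_eq0 gt_eqF.
Qed.

End disc.

(** * Integration by parts *)

Section der.
Context {R : realType}.
Implicit Types (f g : R -> R) (x : R).

(* Not a type class, unlike [is_derive], so that [eapply] computes the
   derivative of a lambda term. *)
Definition der f x (d : R) : Prop := is_derive x (1 : R) f d.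

Lemma der_cst (k x : R) : der (fun=> k) x 0.
Proof. exact: is_derive_cst. Qed.

Lemma der_id x : der (fun v => v) x 1.
Proof. exact: is_derive_id. Qed.

Lemma derD f g x a b : der f x a -> der g x b -> der (fun v => f v + g v) x (a + b).
Proof. by move=> df dg; exact: is_deriveD. Qed.

Lemma derN f x a : der f x a -> der (fun v => - f v) x (- a).
Proof. by move=> df; exact: is_deriveN. Qed.

Lemma derM f g x a b : der f x a -> der g x b ->
  der (fun v => f v * g v) x (f x * b + g x * a).
Proof. by move=> df dg; exact: is_deriveM. Qed.

Lemma der_sin f x a : der f x a -> der (fun v => sin (f v)) x (cos (f x) * a).
Proof.
by move=> df; have := @is_derive1_comp R (@sin R) f x _ _ (is_derive_sin (f x)) df.
Qed.

Lemma der_cos f x a : der f x a -> der (fun v => cos (f v)) x (- sin (f x) * a).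
Proof.
by move=> df; have := @is_derive1_comp R (@cos R) f x _ _ (is_derive_cos (f x)) df.
Qed.

Lemma der_eq f x a b : der f x a -> a = b -> der f x b.
Proof. by move=> df <-. Qed.

End der.

Ltac deriv := lazymatch goal with
  | |- der (fun _ => ?k) _ _ => exact: (@der_cst _ k)
  | |- der (fun v => v) _ _ => exact: der_id
  | |- der (fun z => @GRing.add _ (@?f z) (@?g z)) _ _ => eapply (@derD _ f g); deriv
  | |- der (fun z => @GRing.mul _ (@?f z) (@?g z)) _ _ => eapply (@derM _ f g); deriv
  | |- der (fun z => @GRing.opp _ (@?f z)) _ _ => eapply (@derN _ f); deriv
  | |- der (fun z => sin (@?f z)) _ _ => eapply (@der_sin _ f); deriv
  | |- der (fun z => cos (@?f z)) _ _ => eapply (@der_cos _ f); deriv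
  | _ => eassumption
  end.

Section divergence.
Context {R : realType}.
Notation spacetime := ((R * R) * R)%type.
Notation hp := (pi / 2 : R).
Implicit Types (P dP : spacetime -> R) (t : R).

Lemma hp_le : - hp <= hp.
Proof. by have := @pihalf_gt0 R; lra. Qed.

Lemma rint_der (a b : R) (p dp : R -> R) : a <= b -> continuous p -> continuous dp ->
  (forall u : R, a < u < b -> der p u (dp u)) -> p a = 0 -> p b = 0 -> rint a b dp = 0.
Proof.
by move=> ab cp cdp d pa pb; rewrite (rint_FTC ab cdp cp d) pa pb subrr.
Qed.

(** With the two lemmas that follow, this is the integration by parts: a derivative whose primitive
    vanishes on two opposite faces of the box integrates to [0]. In the other two directions the
    order of integration is changed first. *)
Lemma rint3_dch t P dP : continuous P -> continuous dP ->
  (forall s th ch : R, der (fun v => P ((s, th), v)) ch (dP ((s, th), ch))) ->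
  (forall s th, P ((s, th), hp) = 0 /\ P ((s, th), - hp) = 0) -> rint3 t dP = 0.
Proof.
move=> cP cdP d bd; rewrite /rint3 (eq_rint (g := fun=> 0)) ?rint0// => s _.
rewrite (eq_rint (g := fun=> 0)) ?rint0// => th _.
have [b1 b2] := bd s th.
apply: (@rint_der _ _ (fun v => P ((s, th), v))) => //; first exact: hp_le.
- by cont.
- by cont.
Qed.

Lemma rint3_dth t P dP : continuous P -> continuous dP ->
  (forall s th ch : R, der (fun v => P ((s, v), ch)) th (dP ((s, th), ch))) ->
  (forall s ch, P ((s, hp), ch) = 0 /\ P ((s, - hp), ch) = 0) -> rint3 t dP = 0.
Proof.
move=> cP cdP d bd; rewrite /rint3 (eq_rint (g := fun=> 0)) ?rint0// => s _.
rewrite (rint_swap (- hp) hp (- hp) hp (h := fun z : R * R => dP ((s, z.1), z.2))); last by cont.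
rewrite (eq_rint (g := fun=> 0)) ?rint0// => ch _ /=.
have [b1 b2] := bd s ch.
apply: (@rint_der _ _ (fun v => P ((s, v), ch))) => //; first exact: hp_le.
- by cont.
- by cont.
Qed.

Lemma rint3_ds t P dP : 0 <= t -> continuous P -> continuous dP ->
  (forall s th ch : R, 0 < s < t -> der (fun v => P ((v, th), ch)) s (dP ((s, th), ch))) ->
  (forall th ch, P ((0, th), ch) = 0 /\ P ((t, th), ch) = 0) -> rint3 t dP = 0.
Proof.
move=> t0 cP cdP d bd; rewrite /rint3.
rewrite (rint_swap 0 t (- hp) hp (h := fun z : R * R =>
  rint (- hp) hp (fun ch => dP ((z.1, z.2), ch)))); last first.
  apply: (@rint_continuous R _ (- hp) hp (fun q : (R * R) * R => dP ((q.1.1, q.1.2), q.2))).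
  by cont.
rewrite (eq_rint (g := fun=> 0)) ?rint0// => th _ /=.
rewrite (rint_swap 0 t (- hp) hp (h := fun z : R * R => dP ((z.1, th), z.2))); last by cont.
rewrite (eq_rint (g := fun=> 0)) ?rint0// => ch _ /=.
have [b1 b2] := bd th ch.
apply: (@rint_der _ _ (fun v => P ((v, th), ch))) => //.
- by cont.
- by cont.
- by move=> u; exact: d.
Qed.

End divergence.

(** * The gradient identity along the cone *)

Section cap_identities.
Context {R : realType}.
Variables x1 x2 c t s S1 C1 S2 C2 f g0 g1 g2 : R.
Hypothesis h1 : C1 * C1 = 1 - S1 * S1.
Hypothesis h2 : C2 * C2 = 1 - S2 * S2.
Let y1 := x1 - c * (t - s) * S1.
Let y2 := x2 - c * (t - s) * (C1 * S2).
Let Sf := s * g0 + y1 * g1 + y2 * g2.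
Let Of := y1 * g2 - y2 * g1.
(** [fs], [fth] and [fch] are the derivatives of [F] along the coordinates [s], [th] and [ch] of the
    box, computed in [der_cap_s], [der_cap_th] and [der_cap_ch]. *)
Let fs := g1 * (c * S1) + g2 * (c * (C1 * S2)) + g0.
Let fth := g1 * (- (c * (t - s) * C1)) + g2 * (c * (t - s) * (S1 * S2)).
Let fch := g2 * (- (c * (t - s) * (C1 * C2))).

Lemma cap_identity1 :
  (x1 * x1 + x2 * x2 - c * t * (c * t)) * ((t - s) * C1 * g1) =
  C1 * ((t - s) * (x1 + c * t * S1) * Sf + (t - s) * - (x2 - c * t * (C1 * S2)) * Of) +
  ((t - 2 * s) * (x1 + c * t * S1) * C1 + (2 * t - s) * (c * t) * C1 * S1
    + c * t * t * C1 * S1) * f +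
  (- ((t - 2 * s) * (x1 + c * t * S1) * C1) * f
    - (t - s) * s * (x1 + c * t * S1) * C1 * fs) +
  ((- (2 * t - s) * (c * t * S1 * S2 * C1 * S2 - (x2 - c * t * (C1 * S2)) * S1 * S2) -
     c * t * t * (2 * S1 * C1 * C2 * C2)) * f +
   (- (2 * t - s) * (x2 - c * t * (C1 * S2)) * C1 * S2 + c * t * t * C1 * C1 * C2 * C2) * fth)
  +
  (((2 * t - s) * S1 * (- (c * t * C1 * C2 * C2) - (x2 - c * t * (C1 * S2)) * S2) +
     c * t * t * S1 * C1 * (C2 * C2 - S2 * S2)) * f +
   ((2 * t - s) * (x2 - c * t * (C1 * S2)) * S1 * C2 + c * t * t * S1 * C1 * S2 * C2) * fch).
Proof. rewrite /Sf /Of /fs /fth /fch /y1 /y2; ring: h1 h2. Qed.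

Lemma cap_identity2 :
  (x1 * x1 + x2 * x2 - c * t * (c * t)) * ((t - s) * C1 * g2) =
  C1 * ((t - s) * (x2 + c * t * (C1 * S2)) * Sf + (t - s) * (x1 - c * t * S1) * Of) +
  ((t - 2 * s) * (x2 + c * t * (C1 * S2)) * C1 + (2 * t - s) * (c * t) * C1 * (C1 * S2)
    + c * t * t * C1 * (C1 * S2)) * f +
  (- ((t - 2 * s) * (x2 + c * t * (C1 * S2)) * C1) * f
    - (t - s) * s * (x2 + c * t * (C1 * S2)) * C1 * fs) +
  ((2 * t - s) * S2 * (- (c * t * C1) * C1 - (x1 - c * t * S1) * S1) * f +
   (2 * t - s) * (x1 - c * t * S1) * C1 * S2 * fth) +
  (((2 * t - s) * (x1 - c * t * S1) * S1 * S2 - c * t * t * C1 * C1 * S2) * f +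
   (- (2 * t - s) * (x1 - c * t * S1) * S1 * C2 + c * t * t * C1 * C1 * C2) * fch).
Proof. rewrite /Sf /Of /fs /fth /fch /y1 /y2; ring: h1 h2. Qed.

End cap_identities.

Section cap_derivatives.
Context {R : realType}.
Notation spacetime := ((R * R) * R)%type.
Notation hp := (pi / 2 : R).
Variables (t c x1 x2 : R) (F D0 D1 D2 : spacetime -> R).
Hypothesis C : C1_cylinder t F D0 D1 D2.
Notation cap := (cap_point c t (x1, x2)).

Lemma der_cap_s (s th ch : R) : 0 < s < t ->
  der (fun v => F (cap ((v, th), ch))) s
   (D1 (cap ((s, th), ch)) * (c * sin th) +
    D2 (cap ((s, th), ch)) * (c * (cos th * sin ch)) + D0 (cap ((s, th), ch))).
Proof.
move=> st.
pose y1 v := x1 - c * (t - v) * sin th; pose y2 v := x2 - c * (t - v) * (cos th * sin ch).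
have da : der y1 s (c * sin th).
  by rewrite /y1; eapply der_eq; [deriv|ring].
have db : der y2 s (c * (cos th * sin ch)).
  by rewrite /y2; eapply der_eq; [deriv|ring].
have := is_derive_C1_cylinder C da db (@der_id R s) (or_introl st).
by cbv zeta; rewrite mulr1.
Qed.

Lemma der_cap_th (s th ch : R) :
  der (fun v => F (cap ((s, v), ch))) th
   (D1 (cap ((s, th), ch)) * (- (c * (t - s) * cos th)) +
    D2 (cap ((s, th), ch)) * (c * (t - s) * (sin th * sin ch))).
Proof.
pose y1 v := x1 - c * (t - s) * sin v; pose y2 v := x2 - c * (t - s) * (cos v * sin ch).
have da : der y1 th (- (c * (t - s) * cos th)).
  by rewrite /y1; eapply der_eq; [deriv|ring].
have db : der y2 th (c * (t - s) * (sin th * sin ch)).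
  by rewrite /y2; eapply der_eq; [deriv|ring].
have := is_derive_C1_cylinder C da db (@der_cst R s th) (or_intror (fun=> erefl)).
by cbv zeta; rewrite mulr0 addr0.
Qed.

Lemma der_cap_ch (s th ch : R) :
  der (fun v => F (cap ((s, th), v))) ch
   (D2 (cap ((s, th), ch)) * (- (c * (t - s) * (cos th * cos ch)))).
Proof.
pose y1 (v : R) := x1 - c * (t - s) * sin th; pose y2 v := x2 - c * (t - s) * (cos th * sin v).
have da : der y1 ch 0.
  by rewrite /y1; eapply der_eq; [deriv|ring].
have db : der y2 ch (- (c * (t - s) * (cos th * cos ch))).
  by rewrite /y2; eapply der_eq; [deriv|ring].
have := is_derive_C1_cylinder C da db (@der_cst R s ch) (or_intror (fun=> erefl)).
by cbv zeta; rewrite !mulr0 add0r addr0.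
Qed.

End cap_derivatives.

Section cap_gradient.
Context {R : realType}.
Notation spacetime := ((R * R) * R)%type.
Notation hp := (pi / 2 : R).

Definition scal (D0 D1 D2 : spacetime -> R) p : R :=
  p.2 * D0 p + p.1.1 * D1 p + p.1.2 * D2 p.

Definition rot (D1 D2 : spacetime -> R) p : R := p.1.1 * D2 p - p.1.2 * D1 p.

(** Used with [M = r + c * t], so that division of r^2 - (c t)^2 by [M] leaves r - c t. The constant
    4 is 1 + 2 + 1, from the three terms with factor [f]. *)
Lemma cap_integrand_le (M X A w Sv Ov f t s C C1 : R) :
  0 <= C1 -> 0 <= s <= t -> `|X| <= M -> `|A| <= M -> `|w| <= 1 -> 0 <= C <= M ->
  `|C1 * ((t - s) * X * Sv + (t - s) * A * Ov) +
    ((t - 2 * s) * X * C1 + (2 * t - s) * C * C1 * w + C * t * C1 * w) * f| <=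
  M * (C1 * ((t - s) * `|Sv| + (t - s) * `|Ov| + 4 * t * `|f|)).
Proof.
move=> C10 /andP[s0 st] XM AM w1 /andP[C0 CM].
have M0 : 0 <= M by exact: le_trans CM.
have ts0 : 0 <= t - s by lra.
have t0 : 0 <= t by lra.
rewrite [X in `|X|](_ : _ = C1 * ((t - s) * (X * Sv) + (t - s) * (A * Ov) +
   ((t - 2 * s) * X + (2 * t - s) * (C * w) + t * (C * w)) * f)); last by ring.
rewrite normrM (ger0_norm C10) [leRHS]mulrCA ler_wpM2l//.
have h1 : `|X * Sv| <= M * `|Sv| by rewrite normrM ler_wpM2r.
have h2 : `|A * Ov| <= M * `|Ov| by rewrite normrM ler_wpM2r.
have h3 : `|C * w| <= M.
  by rewrite normrM (ger0_norm C0) -[leRHS]mulr1 ler_pM.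
have h4 : `|(t - 2 * s) * X| <= t * M.
  by rewrite normrM ler_pM// ler_norml; apply/andP; split; lra.
have h5 : `|(2 * t - s) * (C * w)| <= 2 * t * M.
  by rewrite normrM ler_pM// ler_norml; apply/andP; split; lra.
have h6 : `|t * (C * w)| <= t * M by rewrite normrM (ger0_norm t0) ler_wpM2l.
apply: (le_trans (ler_normD _ _)); apply: (@le_trans _ _
  ((t - s) * (M * `|Sv|) + (t - s) * (M * `|Ov|) + (4 * t * M) * `|f|)); last first.
  by rewrite le_eqVlt; apply/orP; left; apply/eqP; ring.
apply: lerD; last first.
  rewrite normrM ler_wpM2r//; apply: (le_trans (ler_normD _ _)).
  have := ler_normD ((t - 2 * s) * X) ((2 * t - s) * (C * w)); lra.
apply: (le_trans (ler_normD _ _)); apply: lerD.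
  by rewrite normrM (ger0_norm ts0) ler_wpM2l.
by rewrite normrM (ger0_norm ts0) ler_wpM2l.
Qed.

Lemma cap_gradient_le (t c x1 x2 : R) (F D0 D1 D2 : spacetime -> R)
    (r := enorm (x1, x2)) : 0 <= t -> 0 < c -> C1_cylinder t F D0 D1 D2 ->
  let bound := rint3 t (fun z => let p := cap_point c t (x1, x2) z in
    cos z.1.2 * ((t - z.1.1) * `|scal D0 D1 D2 p| + (t - z.1.1) * `|rot D1 D2 p|
      + 4 * t * `|F p|)) in
  `|r - c * t| *
    `|rint3 t (fun z => cap_weight t z * D1 (cap_point c t (x1, x2) z))| <= bound /\
  `|r - c * t| *
    `|rint3 t (fun z => cap_weight t z * D2 (cap_point c t (x1, x2) z))| <= bound.
Proof.
move=> t0 c0 HC bound.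
have [[cF cD0 cD1 cD2] _] := HC.
have ct0 : 0 <= c * t by rewrite mulr_ge0// ltW.
have r0 : 0 <= r by exact: enorm_ge0.
pose cap := cap_point c t (x1, x2).
have ccap : continuous cap by rewrite /cap /cap_point/=; cont.
pose S := scal D0 D1 D2; pose Om := rot D1 D2.
have cS : continuous S by rewrite /S /scal; cont.
have cO : continuous Om by rewrite /Om /rot; cont.
pose B (z : spacetime) := cos z.1.2 * ((t - z.1.1) * `|S (cap z)| +
  (t - z.1.1) * `|Om (cap z)| + 4 * t * `|F (cap z)|).
have cB : continuous B by rewrite /B; cont.
pose M := r + c * t.
have cosb z : box t z -> 0 <= cos z.1.2 by case=> _ h _; exact: cos_ge0.
have h1 (u : R) : cos u * cos u = 1 - sin u * sin u.
  by have := cos2Dsin2 u; rewrite !expr2 => <-; ring.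
have sin1 (u : R) : `|sin u| <= 1.
  by rewrite ler_norml sin_geN1 sin_le1.
have cs1 (u v : R) : `|cos u * sin v| <= 1.
  have c1 : `|cos u| <= 1 by rewrite ler_norml cos_geN1 cos_le1.
  by rewrite normrM mulr_ile1.
have x1r : `|x1| <= r by exact: (@ler_abs1_enorm R (x1, x2)).
have x2r : `|x2| <= r by exact: (@ler_abs2_enorm R (x1, x2)).
have bD (a b : R) : `|a| <= r -> `|b| <= 1 -> `|a + c * t * b| <= M.
  move=> ar b1; apply: (le_trans (ler_normD _ _)); rewrite lerD// normrM.
  by rewrite (ger0_norm ct0) ler_piMr.
have bB (a b : R) : `|a| <= r -> `|b| <= 1 -> `|a - c * t * b| <= M.
  by move=> ar b1; rewrite -mulrN bD// normrN.
have rr : r ^+ 2 = x1 * x1 + x2 * x2 by rewrite /r sqr_enorm /= !expr2.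
(* Common to both components of the gradient: the three total derivatives integrate to [0], and what
   remains is bounded by [M] times the integral of [B]. *)
have finish (D X A w dPs dPth dPch : spacetime -> R) :
    continuous D -> continuous X -> continuous A -> continuous w ->
    continuous dPs -> continuous dPth -> continuous dPch ->
    (forall z, `|X z| <= M) -> (forall z, `|A z| <= M) -> (forall z, `|w z| <= 1) ->
    rint3 t dPs = 0 -> rint3 t dPth = 0 -> rint3 t dPch = 0 ->
    (forall z : spacetime, (x1 * x1 + x2 * x2 - c * t * (c * t)) *
        ((t - z.1.1) * cos z.1.2 * D (cap z)) =
      cos z.1.2 * ((t - z.1.1) * X z * S (cap z) + (t - z.1.1) * A z * Om (cap z)) +
      ((t - 2 * z.1.1) * X z * cos z.1.2 + (2 * t - z.1.1) * (c * t) * cos z.1.2 * w z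
        + c * t * t * cos z.1.2 * w z) * F (cap z) + dPs z + dPth z + dPch z) ->
    `|r - c * t| * `|rint3 t (fun z => cap_weight t z * D (cap z))| <= rint3 t B.
  move=> cD cX cA cw cs cth cch bX bA bw i1 i2 i3 E.
  have cW : continuous (fun z => cap_weight t z * D (cap z)) by rewrite /cap_weight; cont.
  pose G (z : spacetime) := cos z.1.2 * ((t - z.1.1) * X z * S (cap z)
      + (t - z.1.1) * A z * Om (cap z)) +
      ((t - 2 * z.1.1) * X z * cos z.1.2 + (2 * t - z.1.1) * (c * t) * cos z.1.2 * w z
        + c * t * t * cos z.1.2 * w z) * F (cap z).
  have cG : continuous G by rewrite /G; cont.
  have IE : (r ^+ 2 - (c * t) ^+ 2) * rint3 t (fun z => cap_weight t z * D (cap z)) =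
      rint3 t G.
    rewrite -(rint3Zl _ _ cW).
    transitivity (rint3 t (fun z => G z + dPs z + dPth z + dPch z)).
      by apply: eq_rint3 => z _; rewrite rr [(c * t) ^+ 2]expr2 E.
    rewrite rint3D; [|by cont|by []]; rewrite rint3D; [|by cont|by []].
    by rewrite rint3D// i1 i2 i3 !addr0.
  have GB : `|rint3 t G| <= M * rint3 t B.
    rewrite -(rint3Zl _ _ cB); apply: ler_norm_rint3; [by []|by cont|].
    move=> z zb; apply: cap_integrand_le => //.
    - exact: cosb.
    - by case: zb.
    - by rewrite ct0 lerDr.
  (* If [M = 0] one cannot divide by it, but then [r = c * t = 0] and the left side vanishes. *)
  have [M0|M0] := eqVneq M 0.
    have /andP[/eqP rE /eqP cE] : (r == 0) && (c * t == 0).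
      by rewrite -paddr_eq0// -/M M0.
    rewrite rE cE subrr normr0 mul0r -(rint0 0 t).
    have -> : rint 0 t (fun=> 0) = rint3 t (fun=> 0).
      by apply: eq_rint => s _; rewrite (eq_rint (g := fun=> 0)) ?rint0// => th _; rewrite rint0.
    apply: ler_rint3 => //; first exact: cont_cst.
    move=> z zb; rewrite mulr_ge0 ?cosb//; case: zb => /andP[s0 st] _ _.
    by rewrite !addr_ge0// mulr_ge0// ?subr_ge0// mulr_ge0.
  have M1 : 0 < M by rewrite lt_neqAle eq_sym M0 addr_ge0.
  rewrite -(ler_pM2l M1); apply: le_trans GB; rewrite -IE normrM subr_sqr normrM.
  by rewrite (gtr0_norm M1) mulrA (mulrC M).
pose fs (z : spacetime) := D1 (cap z) * (c * sin z.1.2) +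
    D2 (cap z) * (c * (cos z.1.2 * sin z.2)) + D0 (cap z).
pose fth (z : spacetime) := D1 (cap z) * (- (c * (t - z.1.1) * cos z.1.2)) +
    D2 (cap z) * (c * (t - z.1.1) * (sin z.1.2 * sin z.2)).
pose fch (z : spacetime) := D2 (cap z) * (- (c * (t - z.1.1) * (cos z.1.2 * cos z.2))).
pose f z := F (cap z).
have cf : continuous f by rewrite /f; cont.
have cfs : continuous fs by rewrite /fs; cont.
have cfth : continuous fth by rewrite /fth; cont.
have cfch : continuous fch by rewrite /fch; cont.
have ds (s th ch : R) : 0 < s < t -> der (fun v => f ((v, th), ch)) s (fs ((s, th), ch)).
  exact: (@der_cap_s R t c x1 x2 F D0 D1 D2 HC s th ch).
have dth (s th ch : R) : der (fun v => f ((s, v), ch)) th (fth ((s, th), ch)).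
  exact: (@der_cap_th R t c x1 x2 F D0 D1 D2 HC s th ch).
have dch (s th ch : R) : der (fun v => f ((s, th), v)) ch (fch ((s, th), ch)).
  exact: (@der_cap_ch R t c x1 x2 F D0 D1 D2 HC s th ch).
have ch0 : cos hp = 0 by exact: cos_pihalf.
have chN0 : cos (- hp) = 0 by rewrite cosN.
split.
- apply: (finish D1 (fun z => x1 + c * t * sin z.1.2)
    (fun z => - (x2 - c * t * (cos z.1.2 * sin z.2))) (fun z => sin z.1.2)
    (fun z => - ((t - 2 * z.1.1) * (x1 + c * t * sin z.1.2) * cos z.1.2) * f z
      - (t - z.1.1) * z.1.1 * (x1 + c * t * sin z.1.2) * cos z.1.2 * fs z)
    (fun z => (- (2 * t - z.1.1) * (c * t * sin z.1.2 * sin z.2 * cos z.1.2 * sin z.2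
        - (x2 - c * t * (cos z.1.2 * sin z.2)) * sin z.1.2 * sin z.2) -
       c * t * t * (2 * sin z.1.2 * cos z.1.2 * cos z.2 * cos z.2)) * f z +
      (- (2 * t - z.1.1) * (x2 - c * t * (cos z.1.2 * sin z.2)) * cos z.1.2 * sin z.2
        + c * t * t * cos z.1.2 * cos z.1.2 * cos z.2 * cos z.2) * fth z)
    (fun z => ((2 * t - z.1.1) * sin z.1.2 * (- (c * t * cos z.1.2 * cos z.2 * cos z.2)
        - (x2 - c * t * (cos z.1.2 * sin z.2)) * sin z.2) +
       c * t * t * sin z.1.2 * cos z.1.2 * (cos z.2 * cos z.2 - sin z.2 * sin z.2)) * f z +
      ((2 * t - z.1.1) * (x2 - c * t * (cos z.1.2 * sin z.2)) * sin z.1.2 * cos z.2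
        + c * t * t * sin z.1.2 * cos z.1.2 * sin z.2 * cos z.2) * fch z)).
  1-7: by cont.
  + by move=> z; apply: bD.
  + by move=> z; rewrite normrN; apply: bB.
  + by move=> z; exact: sin1.
  + apply: (@rint3_ds R t (fun z => - ((t - z.1.1) * z.1.1 * (x1 + c * t * sin z.1.2)
       * cos z.1.2 * f z))); [exact: t0|by cont|by cont| |].
      move=> s th ch st /=; have d := ds s th ch st.
      by eapply der_eq; [deriv|ring].
    by move=> th ch /=; split; ring.
  + apply: (@rint3_dth R t (fun z => (- (2 * t - z.1.1) * (x2 - c * t * (cos z.1.2 * sin z.2))
        * cos z.1.2 * sin z.2 + c * t * t * cos z.1.2 * cos z.1.2 * cos z.2 * cos z.2) * f z));
          [by cont|by cont| |].
      move=> s th ch /=; have d := dth s th ch.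
      by eapply der_eq; [deriv|ring].
    by move=> s ch /=; rewrite ch0 chN0; split; ring.
  + apply: (@rint3_dch R t (fun z => ((2 * t - z.1.1) * (x2 - c * t * (cos z.1.2 * sin z.2))
        * sin z.1.2 * cos z.2 + c * t * t * sin z.1.2 * cos z.1.2 * sin z.2 * cos z.2) * f z));
          [by cont|by cont| |].
      move=> s th ch /=; have d := dch s th ch.
      by eapply der_eq; [deriv|ring].
    by move=> s th /=; rewrite ch0 chN0; split; ring.
  move=> z; have := cap_identity1 x1 x2 c t z.1.1 (f z) (D0 (cap z)) (D1 (cap z)) (D2 (cap z))
    (h1 z.1.2) (h1 z.2).
  move=> ->.
  by rewrite /fs /fth /fch /S /Om /scal /rot.
- apply: (finish D2 (fun z => x2 + c * t * (cos z.1.2 * sin z.2))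
    (fun z => x1 - c * t * sin z.1.2) (fun z => cos z.1.2 * sin z.2)
    (fun z => - ((t - 2 * z.1.1) * (x2 + c * t * (cos z.1.2 * sin z.2)) * cos z.1.2) * f z
      - (t - z.1.1) * z.1.1 * (x2 + c * t * (cos z.1.2 * sin z.2)) * cos z.1.2 * fs z)
    (fun z => (2 * t - z.1.1) * sin z.2 * (- (c * t * cos z.1.2) * cos z.1.2
        - (x1 - c * t * sin z.1.2) * sin z.1.2) * f z +
      (2 * t - z.1.1) * (x1 - c * t * sin z.1.2) * cos z.1.2 * sin z.2 * fth z)
    (fun z => ((2 * t - z.1.1) * (x1 - c * t * sin z.1.2) * sin z.1.2 * sin z.2
        - c * t * t * cos z.1.2 * cos z.1.2 * sin z.2) * f z +
      (- (2 * t - z.1.1) * (x1 - c * t * sin z.1.2) * sin z.1.2 * cos z.2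
        + c * t * t * cos z.1.2 * cos z.1.2 * cos z.2) * fch z)).
  1-7: by cont.
  + by move=> z; apply: bD.
  + by move=> z; apply: bB.
  + by move=> z; exact: cs1.
  + apply: (@rint3_ds R t (fun z => - ((t - z.1.1) * z.1.1 * (x2 + c * t * (cos z.1.2 * sin z.2))
       * cos z.1.2 * f z))); [exact: t0|by cont|by cont| |].
      move=> s th ch st /=; have d := ds s th ch st.
      by eapply der_eq; [deriv|ring].
    by move=> th ch /=; split; ring.
  + apply: (@rint3_dth R t (fun z => (2 * t - z.1.1) * (x1 - c * t * sin z.1.2)
        * cos z.1.2 * sin z.2 * f z)); [by cont|by cont| |].
      move=> s th ch /=; have d := dth s th ch.
      by eapply der_eq; [deriv|ring].
    by move=> s ch /=; rewrite ch0 chN0; split; ring.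
  + apply: (@rint3_dch R t (fun z => (- (2 * t - z.1.1) * (x1 - c * t * sin z.1.2)
        * sin z.1.2 * cos z.2 + c * t * t * cos z.1.2 * cos z.1.2 * cos z.2) * f z)); [by
          cont|by cont| |].
      move=> s th ch /=; have d := dch s th ch.
      by eapply der_eq; [deriv|ring].
    by move=> s th /=; rewrite ch0 chN0; split; ring.
  move=> z; have := cap_identity2 x1 x2 c t z.1.1 (f z) (D0 (cap z)) (D1 (cap z)) (D2 (cap z))
    (h1 z.1.2) (h1 z.2).
  move=> ->.
  by rewrite /fs /fth /fch /S /Om /scal /rot.
Qed.

End cap_gradient.

(** * Pointwise bounds by the M-norm *)

Section Gamma_norm.
Context {R : realType}.
Notation spacetime := ((R * R) * R)%type.

Lemma foldr_iter_delta (V : Type) (k : 'I_5) (op : 'I_5 -> V -> V) (v : V) (s : seq 'I_5) :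
  uniq s -> foldr (fun j => iter (j == k) (op j)) v s = if k \in s then op k v else v.
Proof.
elim: s => //= j s IH /andP[js us]; rewrite IH// inE (eq_sym k j).
by case: (eqVneq j k) => [<-|//]; rewrite (negbTE js).
Qed.

(** A multi-index of length at most 1 is zero or one of the five unit vectors [d k], for which the
    composition of operators reduces to [Gamma k]. *)
Lemma Gamma_norm1E (F : spacetime -> R) p :
  Gamma_norm 1 F p = `|F p| + \sum_k `|Gamma k F p|.
Proof.
pose z : {ffun 'I_5 -> 'I_2} := [ffun => ord0].
pose d (k : 'I_5) : {ffun 'I_5 -> 'I_2} := [ffun j => if j == k then ord_max else ord0].
have dE k j : (d k j : nat) = (j == k) by rewrite ffunE; case: eqP.
rewrite /Gamma_norm (bigD1 z)/=; last by rewrite big1// => j _; rewrite ffunE.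
congr (_ + _).
  congr `|_|; rewrite /Gamma_mono; elim: (enum _) => //= j s IH.
  by rewrite ffunE /= IH.
rewrite (reindex_onto d (fun a => odflt ord0 [pick k | a k != ord0]))/=; last first.
  move=> a /andP[a1 az]; case: pickP => [k ak|a0]; last first.
    by case/negP: az; apply/eqP/ffunP => j; rewrite ffunE; apply/eqP; rewrite -[_ == _]negbK a0.
  apply/ffunP => j; rewrite ffunE; case: eqVneq => [->|jk].
    by apply/val_inj => /=; case: (a k) ak => -[|[|]].
  have := a1; rewrite (bigD1 k)//= (bigD1 j)//=.
  have : (0 < a k)%N by rewrite lt0n.
  by case: (a k : nat) => // n _; rewrite addSn ltnS leqn0 !addn_eq0 => /andP[_ /andP[/eqP aj _]];
    apply/val_inj.
apply: eq_big => [k|k _].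
  rewrite big_mkcond/=; have -> : (\sum_j d k j <= 1)%N.
    by under eq_bigr do rewrite dE; rewrite -big_mkcond/= big_pred1_eq.
  have dz : d k != z.
    by apply/eqP => /ffunP /(_ k) /(congr1 val) /=; rewrite dE eqxx ffunE.
  rewrite dz /=; case: pickP => [j /=|/(_ k)]; last first.
    by rewrite -val_eqE /= dE eqxx.
  by rewrite -val_eqE /= dE eqb0 negbK => /eqP ->; rewrite eqxx.
congr `|_|; rewrite /Gamma_mono.
transitivity (foldr (fun j => iter (j == k) (@Gamma R j)) F (enum 'I_5) p).
  congr (_ p); elim: (enum _) => //= j s ->.
  by rewrite dE.
by rewrite foldr_iter_delta ?enum_uniq// mem_enum.
Qed.

Definition jet_norm (f f0 f1 f2 : spacetime -> R) (p : spacetime) : R :=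
  `|f p| + (`|f0 p| + (`|f1 p| + (`|f2 p| + (`|rot f1 f2 p| + `|scal f0 f1 f2 p|)))).

Lemma continuous_jet_norm (f f0 f1 f2 : spacetime -> R) : continuous f ->
  continuous f0 -> continuous f1 -> continuous f2 -> continuous (jet_norm f f0 f1 f2).
Proof. by move=> cf cf0 cf1 cf2; rewrite /jet_norm /rot /scal; cont. Qed.

(** Equal to [Gamma_norm 1 F] at the times of [[0, t]], but continuous on all of space-time, hence a
    legitimate integrand over the box. *)
Definition frozen_norm (t : R) (F : spacetime -> R) : spacetime -> R :=
  jet_norm (freeze t F) (freeze t (d0 F)) (freeze t (d1 F)) (freeze t (d2 F)).

Lemma frozen_normE (t : R) (F : spacetime -> R) p : 0 <= p.2 <= t ->
  frozen_norm t F p = Gamma_norm 1 F p.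
Proof.
move=> pt; rewrite Gamma_norm1E !big_ord_recl big_ord0 /Gamma /= addr0.
rewrite /frozen_norm /jet_norm /rot /scal /freeze clamp_id//.
by rewrite -[X in F X]surjective_pairing -(surjective_pairing p).
Qed.

Lemma frozen_norm_ge0 t F p : 0 <= frozen_norm t F p.
Proof. by rewrite !addr_ge0. Qed.

Lemma continuous_frozen_norm (T t : R) F : 0 <= t < T -> smooth T F ->
  continuous (frozen_norm t F).
Proof.
move=> tT sF; have [[c c0 c1 c2] _] := C1_cylinder_freeze tT sF.
exact: continuous_jet_norm.
Qed.

Lemma bounded_frozen_norm (T t B : R) F : 0 <= t < T -> smooth T F ->
  exists K : R, forall p, `|p.1.1| <= B -> `|p.1.2| <= B -> 0 <= p.2 <= t ->
    frozen_norm t F p <= K.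
Proof.
move=> tT sF; have cN := continuous_frozen_norm tT sF.
pose A : set spacetime := (`[- B, B]%classic `*` `[- B, B]%classic) `*` `[0, t]%classic.
have cA : compact A by apply: compact_setX; [apply: compact_setX|]; exact: segment_compact.
have /compact_bounded[M [_ HM]] := continuous_compact (continuous_subspaceT cN) cA.
exists (M + 1) => p p1 p2 p3.
apply: le_trans (ler_norm _) _; apply: (HM (M + 1)); first by rewrite ltrDl.
by exists p => //; split; [split|] => /=; rewrite in_itv/= -?ler_norml.
Qed.

End Gamma_norm.

Lemma enorm_le_abs {R : realType} (z : R * R) : enorm z <= `|z.1| + `|z.2|.
Proof.
rewrite -ler_sqr ?nnegrE ?enorm_ge0 ?addr_ge0// sqr_enorm sqrrD !real_normK ?num_real//.
by rewrite -addrA lerD2l lerDr mulrn_wge0// mulr_ge0.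
Qed.

Section weights.
Context {R : realType}.
Notation spacetime := ((R * R) * R)%type.
Variables (c : nat -> R) (m : nat).

Definition Mterm (T : R) (i : nat) (mu nu : R) (F : spacetime -> R) p (j : nat) : R :=
  sup [set Num.sqrt (enorm q.1) * zweight c j mu nu (enorm q.1) q.2 * Gamma_norm 1 F q
        | q in Lambda c m T j `&` Dcone (c i) p].

Lemma zweight_gt0 j mu nu l s : 0 <= s -> 0 <= l -> 0 < zweight c j mu nu l s.
Proof.
by move=> s0 l0; rewrite /zweight mulr_gt0//; apply: powR_gt0; lra.
Qed.

Lemma Gamma_norm_ge0 n (F : spacetime -> R) p : 0 <= Gamma_norm n F p.
Proof. by rewrite /Gamma_norm sumr_ge0. Qed.

Lemma zweight_inv_cone_weight j rho l s : 0 <= s -> 0 <= l ->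
  (zweight c j 0 rho l s)^-1 = cone_weight 0 rho (c j) s l.
Proof. by move=> s0 l0; rewrite /zweight /cone_weight /decay invfM. Qed.

(** With second exponent 1 the weight is not integrable in [l - c j * s]. As [1 + |l - c j * s|] is
    at most [1 + c j] times [1 + s + l], half of the surplus [mu] can be moved from the first factor
    to the second. *)
Lemma zweight_inv_le j mu l s : 0 < mu -> 0 <= c j -> 0 <= s -> 0 <= l ->
  (zweight c j mu 0 l s)^-1 <= (1 + c j) `^ (mu / 2) * cone_weight (mu / 2) (mu / 2) (c j) s l.
Proof.
move=> mu0 c0 s0 l0; rewrite /zweight /cone_weight /decay invfM.
set A := 1 + s + l; set B := 1 + `|l - c j * s|.
have A0 : 0 < A by rewrite /A; lra.
have B0 : 0 < B by rewrite /B ltr_pwDl.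
have h : B <= (1 + c j) * A.
  have cs : 0 <= c j * s by rewrite mulr_ge0.
  have cl : 0 <= c j * l by rewrite mulr_ge0.
  have : `|l - c j * s| <= l + c j * s.
    by rewrite (le_trans (ler_normB _ _))// !ger0_norm.
  rewrite /B /A; lra.
have Bp : B `^ (mu / 2) <= (1 + c j) `^ (mu / 2) * A `^ (mu / 2).
  rewrite -powRM; [|lra|exact: ltW].
  by apply: ge0_ler_powR; rewrite ?nnegrE ?(ltW B0)//; [lra|rewrite (le_trans (ltW B0))].
have Ab : 0 < A `^ (mu / 2) by rewrite powR_gt0.
have Bb : 0 < B `^ (mu / 2) by rewrite powR_gt0.
have Aa : 0 < A `^ (1 + mu / 2) by rewrite powR_gt0.
have Ba : 0 < B `^ (1 + mu / 2) by rewrite powR_gt0.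
have EA : A `^ (1 + mu) = A `^ (1 + mu / 2) * A `^ (mu / 2).
  by rewrite -powRD ?(gt_eqF A0) ?implybT//; congr (_ `^ _); field.
have EB : B `^ (1 + 0) * B `^ (mu / 2) = B `^ (1 + mu / 2).
  by rewrite -powRD ?(gt_eqF B0) ?implybT//; congr (_ `^ _); ring.
have B1 : 0 < B `^ (1 + 0) by rewrite powR_gt0.
rewrite EA -EB !invfM.
rewrite [leLHS](_ : _ = ((A `^ (1 + mu / 2))^-1 * (B `^ (1 + 0))^-1) * (A `^ (mu / 2))^-1);
  last by ring.
rewrite [leRHS](_ : _ = ((A `^ (1 + mu / 2))^-1 * (B `^ (1 + 0))^-1) *
  ((1 + c j) `^ (mu / 2) / B `^ (mu / 2))); last by ring.
rewrite ler_wpM2l//; first by rewrite mulr_ge0// invr_ge0 ltW.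
by rewrite ler_pdivlMr// mulrC ler_pdivrMr.
Qed.

Lemma Mterm_ge0 T i mu nu F p j : 0 <= Mterm T i mu nu F p j.
Proof.
rewrite /Mterm; set S := [set _ | _ in _].
have [hs|hs] := pselect (has_sup S); last by rewrite sup_out.
have [[v Sv] ub] := hs; apply: le_trans (ub_le_sup ub Sv).
case: Sv => q [Lq Dq] <-; apply: mulr_ge0; last exact: Gamma_norm_ge0.
apply: mulr_ge0; first exact: sqrtr_ge0.
by rewrite /zweight mulr_ge0// powR_ge0.
Qed.

Hypothesis c0 : c 0%N = 0.
Hypothesis cS : forall j : nat, (j < m)%N -> c j < c j.+1.

Lemma speed_ge0 j : (j <= m)%N -> 0 <= c j.
Proof.
elim: j => [|j IH] jm; first by rewrite c0.
by rewrite (le_trans (IH (ltnW jm)))// ltW// cS.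
Qed.

Lemma speed_gt0 i : (1 <= i <= m)%N -> 0 < c i.
Proof.
by case: i => // i /andP[_ im]; rewrite (le_lt_trans (speed_ge0 (ltnW im)))// cS.
Qed.

(** A real [sup] is an upper bound only of a set that is bounded above; otherwise its value is [0].
    Here the backward cone stays in a bounded region with times in [[0, t]], and [t < T], so
    continuity bounds the norm by compactness. *)
Lemma Mterm_ub (T t mu nu : R) F i x j q : 0 <= mu -> 0 <= nu -> (1 <= i <= m)%N ->
  0 <= t < T -> smooth T F -> (j <= m)%N -> Lambda c m T j q -> Dcone (c i) (x, t) q ->
  Num.sqrt (enorm q.1) * zweight c j mu nu (enorm q.1) q.2 * Gamma_norm 1 F q <=
  Mterm T i mu nu F (x, t) j.
Proof.
move=> mu0 nu0 im tT sF jm Lq Dq; apply: ub_le_sup; last by exists q.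
have ci := speed_gt0 im; have cj := speed_ge0 jm.
have slabL p : Lambda c m T j p -> slab T p.
  by case: j {jm Lq cj} => [[]//|j []].
have [t0 tT'] := andP tT.
pose B := 2 * (enorm x + c i * t).
have [K HK] := bounded_frozen_norm B tT sF.
pose Z := (1 + t + B) `^ (1 + mu) * (1 + (B + c j * t)) `^ (1 + nu).
exists (Num.sqrt B * Z * K) => _ [p [Lp Dp] <-].
have /andP[p0 _] := slabL _ Lp.
have Dp' : enorm (x - p.1) <= c i * (t - p.2) := Dp.
have pt : p.2 <= t.
  by rewrite -subr_ge0 -(pmulr_rge0 _ ci) (le_trans _ Dp')// enorm_ge0.
have pB : enorm p.1 <= B.
  have ct : c i * (t - p.2) <= c i * t by rewrite ler_wpM2l ?(ltW ci)//; lra.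
  have a1 := ler_abs1_enorm (x - p.1); have a2 := ler_abs2_enorm (x - p.1).
  have b1 := ler_abs1_enorm x; have b2 := ler_abs2_enorm x.
  have e1 := ler_normB x.1 (x.1 - p.1.1); have e2 := ler_normB x.2 (x.2 - p.1.2).
  rewrite !subKr in e1 e2.
  have := enorm_le_abs p.1; rewrite /B.
  have a1' : `|x.1 - p.1.1| <= enorm (x - p.1) := a1.
  have a2' : `|x.2 - p.1.2| <= enorm (x - p.1) := a2.
  lra.
have eB0 := enorm_ge0 p.1.
have B0 : 0 <= B by exact: le_trans pB.
apply: ler_pM.
- by rewrite mulr_ge0 ?sqrtr_ge0// ltW// zweight_gt0.
- exact: Gamma_norm_ge0.
- apply: ler_pM; [exact: sqrtr_ge0|by rewrite ltW// zweight_gt0|exact: ler_wsqrtr|].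
  have cp : 0 <= c j * p.2 by rewrite mulr_ge0.
  have cpt : c j * p.2 <= c j * t by rewrite ler_wpM2l.
  apply: ler_pM; rewrite ?powR_ge0//.
    by apply: ge0_ler_powR; rewrite ?nnegrE; lra.
  have h : `|enorm p.1 - c j * p.2| <= B + c j * t.
    by rewrite (le_trans (ler_normB _ _))// !ger0_norm// lerD.
  have := normr_ge0 (enorm p.1 - c j * p.2) => n0.
  by apply: ge0_ler_powR; rewrite ?nnegrE; lra.
- rewrite -(@frozen_normE R t); last by rewrite p0.
  apply: HK; [| |by rewrite p0].
    exact: le_trans (ler_abs1_enorm _) pB.
  exact: le_trans (ler_abs2_enorm _) pB.
Qed.

Lemma Lambda_cover (T : R) q : slab T q -> exists2 j, (j <= m)%N & Lambda c m T j q.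
Proof.
move=> sq; have [[k /= km kq]|nk] := pselect ((\bigcup_(k in [set k | (1 <= k <= m)%N])
  cone_nbhd c m T k) q).
  by exists k; [case/andP: km|case: k km kq].
by exists 0%N.
Qed.

(** The point lies in one of the regions [Lambda], and the terms of the others are nonnegative; the
    sum over all [j] spares a division of the integral into regions. At the origin the factor
    |y|^(1/2) of the norm vanishes and gives no bound. *)
Lemma Gamma_norm_le_Mterm (T t mu nu : R) F i x q : 0 <= mu -> 0 <= nu -> (1 <= i <= m)%N ->
  0 <= t < T -> smooth T F -> slab T q -> Dcone (c i) (x, t) q -> 0 < enorm q.1 ->
  Gamma_norm 1 F q <= \sum_(0 <= j < m.+1) Mterm T i mu nu F (x, t) j *
     ((Num.sqrt (enorm q.1))^-1 * (zweight c j mu nu (enorm q.1) q.2)^-1).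
Proof.
move=> mu0 nu0 im tT sF sq Dq q0.
have [j jm Lq] := Lambda_cover sq.
have /andP[s0 _] := sq.
have z0 k : 0 < zweight c k mu nu (enorm q.1) q.2 by apply: zweight_gt0 => //; exact: ltW.
have r0 : 0 < Num.sqrt (enorm q.1) by rewrite sqrtr_gt0.
rewrite (bigD1_seq j); [|by rewrite mem_index_iota|exact: iota_uniq]; rewrite /=.
apply: ler_wpDr.
  apply: sumr_ge0 => k _; apply: mulr_ge0; first exact: Mterm_ge0.
  by rewrite mulr_ge0// invr_ge0// ltW.
have := Mterm_ub mu0 nu0 im tT sF jm Lq Dq => h.
by rewrite -invfM ler_pdivlMr; [rewrite mulrC|exact: mulr_gt0].
Qed.

End weights.

(** * From pointwise weights to the integral over the backward cone *)

Section weighted.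
Context {R : realType}.
Notation mu := (@lebesgue_measure R).
Notation mu2 := (mu \x mu)%E.
Notation spacetime := ((R * R) * R)%type.

Lemma measurable_kern_comp d (T : measurableType d) (rho f1 f2 : T -> R) :
  measurable_fun setT rho -> measurable_fun setT f1 -> measurable_fun setT f2 ->
  measurable_fun setT (fun w => kern (rho w) (f1 w, f2 w)).
Proof.
move=> mr m1 m2; apply: (measurableT_comp measurable_invr).
apply: (measurableT_comp measurable_sqrtr); apply: measurable_funB.
  exact: measurable_funX.
by apply: measurable_funD; exact: measurable_funX.
Qed.

Lemma measurable_cone_weight d (T : measurableType d) (e k a : R) (s l : T -> R) :
  measurable_fun setT s -> measurable_fun setT l ->
  measurable_fun setT (fun w => cone_weight e k a (s w) (l w)).
Proof.
move=> ms ml; apply: measurable_funM; apply: measurable_decay.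
  by apply: measurable_funD => //; exact: measurable_funD.
apply: measurable_funD => //; apply: (measurableT_comp (@normr_measurable R setT)).
by apply: measurable_funB => //; exact: measurable_funM.
Qed.

Lemma negligible_origin : mu2.-negligible [set (0, 0) : R * R].
Proof.
exists [set (0, 0)]; split => //.
  rewrite (_ : [set (0, 0)] = [set 0] `*` [set 0]); last first.
    by apply/seteqP; split => [[u v] [-> ->]//|[u v] [/= -> ->]].
  by apply: measurableX; exact: measurable_set1.
rewrite (_ : [set (0, 0)] = [set (0 : R)] `*` [set (0 : R)]); last first.
  by apply/seteqP; split => [[u v] [-> ->]//|[u v] [/= -> ->]].
rewrite product_measure1E; [|exact: measurable_set1|exact: measurable_set1].
rewrite [X in (X * _)%E](_ : _ = 0%E) ?mul0e//; exact: lebesgue_measure_set1.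
Qed.

(** Each [j] contributes [cone_integral_le] with its own speed [a j], and [S] dominates the finitely
    many constants. A pointwise bound off the origin and inside the disc is enough: the origin is a
    null set, and the kernel vanishes outside the disc. *)
Lemma rint3_cap_weighted_le (n : nat) (a : nat -> R) (e k c : R) :
  0 <= e -> 0 < k -> (forall j, 0 <= a j) -> 0 < c ->
  exists2 C : R, 0 < C & forall (x : R * R) (t L : R) (N : spacetime -> R) (M : nat -> R), 0 <=
    t -> 0 <= L ->
    (\int[mu]_(s in `[0%R, t]) (decay e (1 + s))%:E <= L%:E)%E ->
    continuous N -> (forall p, 0 <= N p) -> (forall j, 0 <= M j) ->
    (forall y s, 0 < enorm y -> 0 <= s < t -> enorm (x - y) < c * (t - s) ->
      N (y, s) <= \sum_(0 <= j < n) M j *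
        ((Num.sqrt (enorm y))^-1 * cone_weight e k (a j) s (enorm y))) ->
    rint3 t (fun z => (2 * t - z.1.1) * cos z.1.2 * N (cap_point c t x z)) *
      Num.sqrt (1 + enorm x) <= C * (1 + L) * \sum_(0 <= j < n) M j.
Proof.
move=> e0 k0 a0 c0.
have [Cf HC] := choice (fun j => let: ex_intro2 C C0 H := cone_integral_le e0 k0 (a0 j) c0 in
  ex_intro (fun C => 0 < C /\ _) C (conj C0 H)).
pose S := 1 + \sum_(0 <= j < n) Cf j.
have Cf0 j : 0 < Cf j by case: (HC j).
have S0 : 0 < S by rewrite ltr_pwDl// sumr_ge0// => j _; exact: ltW.
exists (c^-1 * S); first by rewrite mulr_gt0// invr_gt0.
move=> x t L N M t0 L0 hL cN N0 M0 NM.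
set Q := rint3 _ _.
pose r := Num.sqrt (1 + enorm x).
have r0 : 0 < r by rewrite sqrtr_gt0 ltr_pwDl// enorm_ge0.
pose g j s y := (Num.sqrt (enorm y))^-1 * cone_weight e k (a j) s (enorm y) *
  kern (c * (t - s)) (x - y).
have g0 j s y : 0 <= g j s y.
  rewrite /g /cone_weight /kern; apply: mulr_ge0; last by rewrite invr_ge0 sqrtr_ge0.
  by apply: mulr_ge0; [rewrite invr_ge0 sqrtr_ge0|rewrite mulr_ge0 ?decay_ge0].
have mg j : measurable_fun
    [set: (measurableTypeR R * measurableTypeR R) * measurableTypeR R]
    (fun w : (R * R) * R => (g j w.1.1 (w.1.2, w.2))%:E).
  have m1 : measurable_fun
      [set: (measurableTypeR R * measurableTypeR R) * measurableTypeR R]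
      (fun w : (R * R) * R => w.1) by exact: measurable_fst.
  have m2 : measurable_fun
      [set: (measurableTypeR R * measurableTypeR R) * measurableTypeR R]
      (fun w : (R * R) * R => w.2) by exact: measurable_snd.
  have m11 := measurableT_comp (@measurable_fst12 R) m1.
  have m12 := measurableT_comp (@measurable_snd12 R) m1.
  have me := measurableT_comp (@measurable_enorm R) (measurable_fun_pair m12 m2).
  apply/measurable_EFinP; apply: measurable_funM; first apply: measurable_funM.
  - apply: (measurableT_comp measurable_invr); exact: (measurableT_comp measurable_sqrtr me).
  - exact: measurable_cone_weight m11 me.
  - apply: (@measurable_kern_comp _ _ (fun w : (R * R) * R => c * (t - w.1.1))
      (fun w => x.1 - w.1.2) (fun w => x.2 - w.2)).
    + by apply: measurable_funM => //; exact: measurable_funB.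
    + exact: measurable_funB.
    + exact: measurable_funB.
have mgs j s : measurable_fun [set: measurableTypeR R * measurableTypeR R]
    (fun y => (g j s y)%:E).
  apply: (measurableT_comp (mg j) (g := fun y : R * R => ((s, y.1), y.2))).
  apply: measurable_fun_pair; last exact: measurable_snd12.
  by apply: measurable_fun_pair => //; exact: measurable_fst12.
pose I (j : nat) (s : R) : \bar R := (\int[mu2]_y (g j s y)%:E)%E.
have I0 j s : (0 <= I j s)%E by apply: integral_ge0 => y _; rewrite lee_fin.
have mI j : measurable_fun [set: measurableTypeR R] (I j).
  have gE0 (w : (R * R) * R) : (0 <= (g j w.1.1 (w.1.2, w.2))%:E)%E by rewrite lee_fin.
  have H : measurable_fun [set: measurableTypeR R * measurableTypeR R]
      (fun w : R * R => \int[mu]_v (g j w.1 (w.2, v))%:E)%E.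
    exact: (measurable_fun_fubini_tonelli_F _ (mg j) gE0).
  have H0 (w : R * R) : (0 <= \int[mu]_v (g j w.1 (w.2, v))%:E)%E.
    by apply: integral_ge0 => v _; rewrite lee_fin.
  have := @measurable_integral1 R (fun w => \int[mu]_v (g j w.1 (w.2, v))%:E)%E H H0.
  congr (measurable_fun _ _); apply/funext => s; rewrite /I (integral2E (mgs j s))//.
  by move=> y; rewrite lee_fin.
pose fac s := 1 + t / (t - s).
have mfac : measurable_fun [set: measurableTypeR R] fac.
  apply: measurable_funD => //; apply: measurable_funM => //.
  by apply: (measurableT_comp measurable_invr); exact: measurable_funB.
have QE : ((c * Q)%:E <= \int[mu]_(s in `[0%R, t[)
    \sum_(0 <= j < n) ((M j)%:E * ((fac s)%:E * I j s)))%E.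
  rewrite rint3_cap_le//; apply: ge0_integral_mono => s; rewrite /= in_itv/= => /andP[s0 st].
    rewrite mule_ge0//.
      by rewrite lee_fin addr_ge0// divr_ge0// subr_ge0 ltW.
    apply: integral_ge0 => y _; rewrite lee_fin; apply: mulr_ge0; first exact: N0.
    by rewrite invr_ge0 sqrtr_ge0.
  have f0 : 0 <= fac s by rewrite addr_ge0// divr_ge0// subr_ge0 ltW.
  rewrite (_ : \sum_(0 <= j < n) _ = (fac s)%:E * \sum_(0 <= j < n) ((M j)%:E * I j s))%E;
    last first.
    rewrite ge0_sume_distrr; last by move=> j _; rewrite mule_ge0// lee_fin.
    by apply: eq_bigr => j _; rewrite muleCA.
  rewrite lee_wpmul2l ?lee_fin//.
  rewrite (_ : \sum_(0 <= j < n) _ = \int[mu2]_y \sum_(0 <= j < n) ((M j)%:E * (g j s y)%:E))%E;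
    last first.
    rewrite ge0_integral_sum//; last 2 first.
    - by move=> j; exact: emeasurable_funM.
    - by move=> j y _; rewrite mule_ge0 ?lee_fin.
    apply: eq_bigr => j _; rewrite ge0_integralZlT//.
    by move=> y; rewrite lee_fin.
  apply: ae_ge0_le_integral.
  - exact: measurableT.
  - move=> y _; rewrite lee_fin; apply: mulr_ge0; first exact: N0.
    by rewrite invr_ge0 sqrtr_ge0.
  - apply/measurable_EFinP; apply: measurable_funM.
      apply: continuous_measurable_prod; by cont.
    apply: (@measurable_kern_comp _ (measurableTypeR R * measurableTypeR R)%type
      (fun=> c * (t - s)) (fun y : R * R => x.1 - y.1) (fun y : R * R => x.2 - y.2)).
    + exact: measurable_cst.
    + by apply: measurable_funB => //; exact: measurable_fst12.
    + by apply: measurable_funB => //; exact: measurable_snd12.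
  - by move=> y _; apply: sume_ge0 => j _; rewrite mule_ge0 ?lee_fin.
  - by apply: emeasurable_sum => j; exact: emeasurable_funM.
  have [Z [mZ Z0 sZ]] := negligible_origin.
  exists Z; split => // y; apply: contra_notP => yZ _.
  have y0 : 0 < enorm y.
    rewrite lt_neqAle enorm_ge0 andbT eq_sym; apply/eqP => ye; apply: yZ; apply: sZ.
    have := ler_abs1_enorm y; have := ler_abs2_enorm y; rewrite ye !normr_le0.
    by case: y {ye} => y1 y2 /= /eqP -> /eqP ->.
  under eq_bigr do rewrite -EFinM.
  rewrite sumEFin lee_fin.
  have [xy|xy] := ltP (enorm (x - y)) (c * (t - s)); last first.
    have -> : kern (c * (t - s)) (x - y) = 0.
      rewrite /kern -sqr_enorm ler0_sqrtr ?invr0// subr_le0 ler_sqr ?nnegrE//.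
        by rewrite mulr_ge0 ?(ltW c0)// subr_ge0 ltW.
      exact: enorm_ge0.
    by rewrite mulr0 sumr_ge0// => j _; rewrite mulr_ge0.
  rewrite (_ : \sum_(0 <= j < n) _ = (\sum_(0 <= j < n) M j *
        ((Num.sqrt (enorm y))^-1 * cone_weight e k (a j) s (enorm y))) *
        kern (c * (t - s)) (x - y)); last first.
    by rewrite mulr_suml; apply: eq_bigr => j _; rewrite /g !mulrA.
  rewrite ler_wpM2r//; first by rewrite invr_ge0 sqrtr_ge0.
  by apply: NM => //; rewrite s0.
have IE j : (\int[mu]_(s in `[0%R, t[) ((M j)%:E * ((fac s)%:E * I j s)) <=
    (M j * (Cf j * (1 + L) / r))%:E)%E.
  have mf : measurable_fun `[0%R, t[%classic (fun s => (fac s)%:E * I j s)%E.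
    apply: measurable_funTS; apply: emeasurable_funM; last exact: mI.
    exact/measurable_EFinP.
  have ff0 s : `[0%R, t[%classic s -> (0 <= (fac s)%:E * I j s)%E.
    rewrite /= in_itv/= => /andP[s0 st].
    by rewrite mule_ge0// lee_fin addr_ge0// divr_ge0// subr_ge0 ltW.
  rewrite ge0_integralZl_EFin// EFinM lee_wpmul2l ?lee_fin//.
  rewrite integral_itv_bndo_bndc//.
  by case: (HC j) => _ /(_ x t L t0 L0 hL).
rewrite ge0_integral_sum// in QE; last 2 first.
- move=> j; apply: emeasurable_funM => //; apply: measurable_funTS.
  by apply: emeasurable_funM; [exact/measurable_EFinP|exact: mI].
- move=> j s; rewrite /= in_itv/= => /andP[s0 st].
  rewrite mule_ge0 ?lee_fin// mule_ge0// lee_fin addr_ge0// divr_ge0// subr_ge0.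
  exact: ltW.
have := le_trans QE (@lee_sum _ _ _ _ (index_iota 0 n) xpredT (fun j _ => IE j)).
rewrite sumEFin lee_fin => H.
rewrite -(ler_pM2l c0) [leRHS](_ : _ = S * (1 + L) * \sum_(0 <= j < n) M j); last first.
  by field; rewrite gt_eqF.
rewrite mulrA -ler_pdivlMr//; apply: (le_trans H).
rewrite (_ : _ / r = \sum_(0 <= j < n) M j * (S * (1 + L) / r)); last first.
  by rewrite -mulr_suml; ring.
apply: ler_sum_nat => j /andP[_ jn]; rewrite ler_wpM2l// ler_wpM2r ?invr_ge0 ?(ltW r0)//.
rewrite ler_wpM2r ?addr_ge0// /S (bigD1_seq j); [|by rewrite mem_index_iota|exact: iota_uniq].
rewrite addrCA lerDl addr_ge0// sumr_ge0// => k' _; exact: ltW.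
Qed.

End weighted.

(** * The two estimates *)

Section estimates.
Context {R : realType}.
Notation mu_ := (@lebesgue_measure R).
Notation spacetime := ((R * R) * R)%type.

Definition cap_mean (c t : R) (x : R * R) (N : spacetime -> R) : R :=
  rint3 t (fun z => (2 * t - z.1.1) * cos z.1.2 * N (cap_point c t x z)).

Lemma continuous_cap (c t : R) x (N : spacetime -> R) : continuous N ->
  continuous (fun z => N (cap_point c t x z)).
Proof. by move=> cN; rewrite /cap_point; cont. Qed.

Lemma sum_mul_le (n : nat) (a b : nat -> R) : (forall j, 0 <= a j) -> (forall j, 0 <= b j) ->
  \sum_(0 <= j < n) a j * b j <= (\sum_(0 <= j < n) b j) * \sum_(0 <= j < n) a j.
Proof.
move=> a0 b0; rewrite mulr_sumr; apply: ler_sum_nat => j /andP[_ jn].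
rewrite mulrC ler_wpM2r// (bigD1_seq j); [|by rewrite mem_index_iota|exact: iota_uniq].
by rewrite /= lerDl sumr_ge0.
Qed.

Lemma Lwave_le_cap_mean (T t c : R) F x : 0 <= t < T -> 0 < c -> smooth T F ->
  `|Lwave c F (x, t)| <= (2 * pi)^-1 * cap_mean c t x (frozen_norm t F).
Proof.
move=> tT c0 sF; have cN := continuous_frozen_norm tT sF.
have [cF _] := sF 0%N.
have cf := continuous_freeze tT cF.
have ip : 0 <= (2 * pi : R)^-1 by rewrite invr_ge0 mulr_ge0// pi_ge0.
rewrite (Lwave_rint3 x tT c0 cF) normrM (ger0_norm ip) ler_wpM2l//.
have c1 := @continuous_cap c t x _ cf; have c2 := @continuous_cap c t x _ cN.
apply: ler_norm_rint3.
- by rewrite /cap_weight; apply: contM => //; cont.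
- by apply: contM => //; cont.
move=> z [/andP[s0 st] hth _].
have co := cos_ge0 hth.
have t0 : 0 <= t - z.1.1 by rewrite subr_ge0.
rewrite normrM /cap_weight ger0_norm; last exact: mulr_ge0.
apply: ler_pM; [exact: mulr_ge0|by []| |].
  by rewrite ler_wpM2r//; lra.
by rewrite /frozen_norm /jet_norm lerDl !addr_ge0.
Qed.

Lemma jet_weights_le (t s a a0 a1 a2 ro sc dd : R) : 0 <= s -> s <= t -> dd <= a1 + a2 ->
  0 <= a -> 0 <= a0 -> 0 <= ro -> 0 <= sc -> 0 <= dd ->
  (t - s) * dd + ((t - s) * ro + (t - s) * sc + 4 * t * a) <=
  4 * (2 * t - s) * (a + (a0 + (a1 + (a2 + (ro + sc))))).
Proof.
move=> s0 st dle pa p0 pr ps pd; set b := 4 * (2 * t - s).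
have ts0 : 0 <= t - s by rewrite subr_ge0.
have t4 : 0 <= 4 * t by rewrite mulr_ge0// (le_trans s0).
have bt : t - s <= b by rewrite /b; lra.
have b4 : 4 * t <= b by rewrite /b; lra.
have b0 : 0 <= b by exact: le_trans bt.
have k1 := ler_pM ts0 pd bt dle.
have k2 := ler_wpM2r pr bt.
have k3 := ler_wpM2r ps bt.
have k4 := ler_wpM2r pa b4.
have k5 := mulr_ge0 b0 p0.
rewrite !mulrDr; rewrite mulrDr in k1.
move: k1 k2 k3 k4 k5; clear.
by move: (b * _) (b * _) (b * _) (b * _) (b * _) (b * _) => *; lra.
Qed.

(** The summand [1] is covered by estimating the derivative directly under the integral, the summand
    |r - c t| by [cap_gradient_le]; both integrands are then compared with the single weight
    [4 * (2 * t - s)]. *)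
Lemma cap_gradient_le_jet (t c : R) (f f0 f1 f2 : spacetime -> R) (x : R * R) :
  0 <= t -> 0 < c -> C1_cylinder t f f0 f1 f2 ->
  (1 + `|enorm x - c * t|) * `|rint3 t (fun z => cap_weight t z * f1 (cap_point c t x z))| <=
     4 * cap_mean c t x (jet_norm f f0 f1 f2) /\
  (1 + `|enorm x - c * t|) * `|rint3 t (fun z => cap_weight t z * f2 (cap_point c t x z))| <=
     4 * cap_mean c t x (jet_norm f f0 f1 f2).
Proof.
move=> t0 c0 HC; rewrite /cap_mean.
have := cap_gradient_le x.1 x.2 t0 c0 HC; rewrite -surjective_pairing.
have [[cf cf0 cf1 cf2] _] := HC; move=> [b1 b2].
have cN := continuous_jet_norm cf cf0 cf1 cf2.
have cSc : continuous (scal f0 f1 f2) by rewrite /scal; cont.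
have cRo : continuous (rot f1 f2) by rewrite /rot; cont.
have c_f := @continuous_cap c t x _ cf; have c_N := @continuous_cap c t x _ cN.
have c_1 := @continuous_cap c t x _ cf1; have c_2 := @continuous_cap c t x _ cf2.
have c_S := @continuous_cap c t x _ cSc; have c_R := @continuous_cap c t x _ cRo.
have c_B : continuous (fun z : spacetime => cos z.1.2 *
   ((t - z.1.1) * `|scal f0 f1 f2 (cap_point c t x z)| +
    (t - z.1.1) * `|rot f1 f2 (cap_point c t x z)| + 4 * t * `|f (cap_point c t x z)|)).
  by cont.
have fin (d : spacetime -> R) : continuous d -> (forall p, `|d p| <= `|f1 p| + `|f2 p|) ->
  `|enorm x - c * t| * `|rint3 t (fun z => cap_weight t z * d (cap_point c t x z))| <=
    rint3 t (fun z => cos z.1.2 *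
   ((t - z.1.1) * `|scal f0 f1 f2 (cap_point c t x z)| +
    (t - z.1.1) * `|rot f1 f2 (cap_point c t x z)| + 4 * t * `|f (cap_point c t x z)|)) ->
  (1 + `|enorm x - c * t|) *
     `|rint3 t (fun z => cap_weight t z * d (cap_point c t x z))| <=
     4 * rint3 t (fun z => (2 * t - z.1.1) * cos z.1.2 *
       jet_norm f f0 f1 f2 (cap_point c t x z)).
  move=> cd d12 bd; have c_d := @continuous_cap c t x _ cd.
  have c_w : continuous (fun z => cap_weight t z * d (cap_point c t x z)).
    by rewrite /cap_weight; apply: contM => //; cont.
  have c_wn : continuous (fun z : spacetime => cos z.1.2 * ((t - z.1.1) *
      `|d (cap_point c t x z)|)) by cont.
  have c_m : continuous (fun z : spacetime => (2 * t - z.1.1) * cos z.1.2 *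
      jet_norm f f0 f1 f2 (cap_point c t x z)) by apply: contM => //; cont.
  rewrite mulrDl mul1r -(rint3Zl _ _ c_m).
  have h1 : `|rint3 t (fun z => cap_weight t z * d (cap_point c t x z))| <=
      rint3 t (fun z => cos z.1.2 * ((t - z.1.1) * `|d (cap_point c t x z)|)).
    apply: ler_norm_rint3 => // z [/andP[s0 st] hth _].
    have co := cos_ge0 hth; have ts : 0 <= t - z.1.1 by rewrite subr_ge0.
    rewrite normrM /cap_weight ger0_norm; last exact: mulr_ge0.
    by rewrite le_eqVlt; apply/orP; left; apply/eqP; ring.
  apply: (le_trans (lerD h1 bd)); rewrite -(rint3D _ c_wn c_B).
  apply: ler_rint3; [exact: contD|by apply: contM => //; exact: cont_cst|].
  move=> z [/andP[s0 st] hth _] /=.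
  have co := cos_ge0 hth.
  set p := cap_point c t x z; have dp := d12 p.
  rewrite [leRHS](_ : _ = cos z.1.2 * (4 * (2 * t - z.1.1) * jet_norm f f0 f1 f2 p)); last by ring.
  rewrite -mulrDr ler_wpM2l// /jet_norm.
  move: dp (normr_ge0 (f p)) (normr_ge0 (f0 p)) (normr_ge0 (f1 p)) (normr_ge0 (f2 p))
    (normr_ge0 (rot f1 f2 p)) (normr_ge0 (scal f0 f1 f2 p)) (normr_ge0 (d p)).
  move: `|f p| `|f0 p| `|f1 p| `|f2 p| `|rot f1 f2 p| `|scal f0 f1 f2 p| `|d p|.
  move: (z.1.1) s0 st => s s0 st a a0 a1 a2 ro sc dd dle pa p0 p1 p2 pr ps pd.
  by rewrite (addrC (_ * sc)); exact: jet_weights_le.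
split.
  by apply: (fin f1 cf1 _ b1) => p; rewrite lerDl.
by apply: (fin f2 cf2 _ b2) => p; rewrite lerDr.
Qed.

Lemma cap_gradient_le_mean (T t c : R) F (x : R * R) : 0 <= t < T -> 0 < c -> smooth T F ->
  (1 + `|enorm x - c * t|) *
     `|rint3 t (fun z => cap_weight t z * freeze t (d1 F) (cap_point c t x z))| <=
     4 * cap_mean c t x (frozen_norm t F) /\
  (1 + `|enorm x - c * t|) *
     `|rint3 t (fun z => cap_weight t z * freeze t (d2 F) (cap_point c t x z))| <=
     4 * cap_mean c t x (frozen_norm t F).
Proof.
move=> tT c0 sF; have t0 : 0 <= t by case/andP: tT.
exact: (cap_gradient_le_jet x t0 c0 (C1_cylinder_freeze tT sF)).
Qed.

Lemma continuous_slabD (T : R) (G H : spacetime -> R) :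
  {within slab T, continuous G} -> {within slab T, continuous H} ->
  {within slab T, continuous (fun p => G p + H p)}.
Proof. by move=> cG cH p; apply: cvgD; [exact: cG|exact: cH]. Qed.

Lemma d1_is_derive (Phi : spacetime -> R) (x1 x2 t l : R) :
  is_derive x1 (1 : R) (fun u => Phi ((u, x2), t)) l -> d1 Phi ((x1, x2), t) = l.
Proof.
move=> /is_derive_quotP H; rewrite /d1 /derive.
have -> : (fun h => h^-1 *: (Phi (h *: e1 + (x1, x2, t)) - Phi (x1, x2, t))) =
    (fun h : R => (Phi (x1 + h, x2, t) - Phi (x1, x2, t)) / h).
  by apply/funext => h; rewrite scale_e1D; exact: mulrC.
exact: cvg_lim H.
Qed.

Lemma d2_is_derive (Phi : spacetime -> R) (x1 x2 t l : R) :
  is_derive x2 (1 : R) (fun u => Phi ((x1, u), t)) l -> d2 Phi ((x1, x2), t) = l.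
Proof.
move=> /is_derive_quotP H; rewrite /d2 /derive.
have -> : (fun h => h^-1 *: (Phi (h *: e2 + (x1, x2, t)) - Phi (x1, x2, t))) =
    (fun h : R => (Phi (x1, x2 + h, t) - Phi (x1, x2, t)) / h).
  by apply/funext => h; rewrite scale_e2D; exact: mulrC.
exact: cvg_lim H.
Qed.

(** Differentiability of [Lwave] is obtained from its form over the box. The parts of [G] and [H]
    are separated because they are bounded by different norms. *)
Lemma gradient_LwaveD (T t c : R) (G H : spacetime -> R) (x : R * R) :
  0 <= t < T -> 0 < c -> smooth T G -> smooth T H ->
  d1 (Lwave c (fun p => G p + H p)) (x, t) = (2 * pi)^-1 *
    (rint3 t (fun z => cap_weight t z * freeze t (d1 G) (cap_point c t x z)) +
     rint3 t (fun z => cap_weight t z * freeze t (d1 H) (cap_point c t x z))) /\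
  d2 (Lwave c (fun p => G p + H p)) (x, t) = (2 * pi)^-1 *
    (rint3 t (fun z => cap_weight t z * freeze t (d2 G) (cap_point c t x z)) +
     rint3 t (fun z => cap_weight t z * freeze t (d2 H) (cap_point c t x z))).
Proof.
move=> tT c0 sG sH; case: x => x1 x2.
have CG := C1_cylinder_freeze tT sG; have CH := C1_cylinder_freeze tT sH.
have [cG _] := sG 0%N; have [cH _] := sH 0%N.
have cfG := continuous_freeze tT cG; have cfH := continuous_freeze tT cH.
have cGH := continuous_slabD cG cH.
pose W := @cap_weight R t.
pose W1 (z : spacetime) := c * (t - z.1.1) * sin z.1.2.
pose W2 (z : spacetime) := c * (t - z.1.1) * (cos z.1.2 * sin z.2).
have cW : continuous W by rewrite /W /cap_weight; cont.
have cW1 : continuous W1 by rewrite /W1; cont.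
have cW2 : continuous W2 by rewrite /W2; cont.
have LE (y : R * R) : Lwave c (fun p => G p + H p) (y, t) = (2 * pi)^-1 *
    (rint3 t (fun z => W z * freeze t G (cap_point c t y z)) +
     rint3 t (fun z => W z * freeze t H (cap_point c t y z))).
  have a1 := contM cW (@continuous_cap c t y _ cfG).
  have a2 := contM cW (@continuous_cap c t y _ cfH).
  rewrite (Lwave_rint3 y tT c0 cGH).
  apply: congr1.
  transitivity (rint3 t (fun z => W z * freeze t G (cap_point c t y z) +
      W z * freeze t H (cap_point c t y z))); last exact: rint3D a1 a2.
  apply: eq_rint3 => z _; exact: mulrDr.
have [G1 G2] := is_derive_rint3_shift t x1 x2 CG cW cW1 cW2.
have [H1 H2] := is_derive_rint3_shift t x1 x2 CH cW cW1 cW2.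
have dsum (p q : R -> R) (u a b : R) : is_derive u (1 : R) p a -> is_derive u (1 : R) q b ->
    is_derive u (1 : R) (fun v => (2 * pi)^-1 * (p v + q v)) ((2 * pi)^-1 * (a + b)).
  move=> dp dq; have d1 : der (fun v => p v) u a := dp; have d2 : der (fun v => q v) u b := dq.
  have : der (fun v => (2 * pi)^-1 * (p v + q v)) u ((2 * pi)^-1 * (a + b)).
    by eapply der_eq; [deriv|ring].
  by [].
split.
  apply: d1_is_derive.
  have -> : (fun u => Lwave c (fun p => G p + H p) ((u, x2), t)) = (fun u => (2 * pi)^-1 *
    (rint3 t (fun z => W z * freeze t G ((u - W1 z, x2 - W2 z), z.1.1)) +
     rint3 t (fun z => W z * freeze t H ((u - W1 z, x2 - W2 z), z.1.1)))).
    by apply/funext => u; rewrite LE.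
  exact: dsum G1 H1.
apply: d2_is_derive.
have -> : (fun u => Lwave c (fun p => G p + H p) ((x1, u), t)) = (fun u => (2 * pi)^-1 *
  (rint3 t (fun z => W z * freeze t G ((x1 - W1 z, u - W2 z), z.1.1)) +
   rint3 t (fun z => W z * freeze t H ((x1 - W1 z, u - W2 z), z.1.1)))).
  by apply/funext => u; rewrite LE.
exact: dsum G2 H2.
Qed.

Section speeds.
Variables (c : nat -> R) (m : nat).
Hypothesis c0 : c 0%N = 0.
Hypothesis cS : forall j : nat, (j < m)%N -> c j < c j.+1.

(** The comparison of weights is a hypothesis because the theorem needs two kinds: with [e = k]
    equal to [mu / 2] or [nu / 2] when the second exponent is 1, and with [e = 0], [k = rho] when
    the first one is. *)
Lemma cap_mean_le_Mnorm (mu nu e k : R) (K : nat -> R) : 0 <= mu -> 0 <= nu ->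
  0 <= e -> 0 < k -> (forall j, 0 <= K j) ->
  (forall j s l, (j <= m)%N -> 0 <= s -> 0 <= l ->
    (zweight c j mu nu l s)^-1 <= K j * cone_weight e k (c j) s l) ->
  exists2 C : R, 0 < C & forall T F i x t L, (1 <= i <= m)%N -> 0 <= t < T ->
    smooth T F -> 0 <= L ->
    (\int[mu_]_(s in `[0%R, t]) (decay e (1 + s))%:E <= L%:E)%E ->
    cap_mean (c i) t x (frozen_norm t F) * Num.sqrt (1 + enorm x) <=
    C * (1 + L) * Mnorm c m T i mu nu F (x, t).
Proof.
move=> mu0 nu0 e0 k0 K0 hK.
(* Nothing is known of the speeds of index above [m]; [a] and [ci] replace them by values for which
   the constants exist at every index. *)
pose a j := if (j <= m)%N then c j else 0.
have a0 j : 0 <= a j by rewrite /a; case: ifPn => // jm; exact: (speed_ge0 c0 cS).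
pose ci i := if (1 <= i <= m)%N then c i else 1.
have ci0 i : 0 < ci i by rewrite /ci; case: ifPn => // im; exact: (speed_gt0 c0 cS).
have [Cf HC] := choice (fun i =>
  let: ex_intro2 C C0 H := rint3_cap_weighted_le m.+1 e0 k0 a0 (ci0 i) in
  ex_intro (fun C => 0 < C /\ _) C (conj C0 H)).
have Cf0 i : 0 < Cf i by case: (HC i).
pose S := \sum_(0 <= i < m.+1) Cf i; pose KK := \sum_(0 <= j < m.+1) K j.
have S0 : 0 <= S by apply: sumr_ge0 => i _; exact: ltW.
have KK0 : 0 <= KK by apply: sumr_ge0.
exists (S * KK + 1) => [|T F i x t L im tT sF L0 hL].
  by rewrite ltr_wpDl// mulr_ge0.
have t0 : 0 <= t by case/andP: tT.
have ciE : ci i = c i by rewrite /ci im.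
have ci1 := ci0 i; rewrite ciE in ci1.
pose M j := Mterm c m T i mu nu F (x, t) j.
have M0 j : 0 <= M j by exact: Mterm_ge0.
have MnE : Mnorm c m T i mu nu F (x, t) = \sum_(0 <= j < m.+1) M j by [].
have SM0 : 0 <= \sum_(0 <= j < m.+1) M j by apply: sumr_ge0.
have [_ H] := HC i; rewrite ciE in H.
have {}H := H x t L (frozen_norm t F) (fun j => M j * K j) t0 L0 hL
  (continuous_frozen_norm tT sF) (frozen_norm_ge0 t F) (fun j => mulr_ge0 (M0 j) (K0 j)).
apply: (le_trans (H _)).
  move=> y s y0 /andP[s0 st] xy.
  have sT : s < T by case/andP: tT => _; exact: lt_trans.
  have slq : slab T (y, s) by rewrite /slab /= s0.
  have Dq : Dcone (c i) (x, t) (y, s) by exact: ltW.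
  rewrite frozen_normE/=; last by rewrite s0 ltW.
  apply: (le_trans (Gamma_norm_le_Mterm c0 cS mu0 nu0 im tT sF slq Dq y0)).
  apply: ler_sum_nat => j /andP[_ jm]; rewrite -mulrA ler_wpM2l//= mulrCA.
  rewrite ler_wpM2l ?invr_ge0 ?sqrtr_ge0// /a -ltnS jm.
  by apply: hK => //; rewrite enorm_ge0.
have CS : Cf i <= S.
  have im' : (i < m.+1)%N by case/andP: im.
  rewrite /S (bigD1_seq i); [|by rewrite mem_index_iota|exact: iota_uniq].
  by rewrite /= lerDl sumr_ge0// => j _; exact: ltW.
have MK := sum_mul_le m.+1 M0 K0.
rewrite MnE; apply: (@le_trans _ _ (S * (1 + L) * (KK * \sum_(0 <= j < m.+1) M j))).
  apply: ler_pM => //.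
  - by rewrite mulr_ge0 ?addr_ge0// ltW.
  - by apply: sumr_ge0 => j _; rewrite mulr_ge0.
  - by rewrite ler_wpM2r// addr_ge0.
rewrite [leLHS](_ : _ = S * KK * ((1 + L) * \sum_(0 <= j < m.+1) M j)); last by ring.
rewrite -[leRHS]mulrA ler_wpM2r ?lerDl// mulr_ge0// addr_ge0//.
Qed.

Lemma Mnorm_ge0 T i mu nu F (p : spacetime) : 0 <= Mnorm c m T i mu nu F p.
Proof. by apply: sumr_ge0 => j _; exact: Mterm_ge0. Qed.

End speeds.
End estimates.

Section final_bound.
Context {R : realType}.
Notation spacetime := ((R * R) * R)%type.

(** The constant 8 collects 4 from each of the two components of the gradient. *)
Lemma sum_norm_le (P W u v a b a' b' p q : R) : 0 <= P -> 0 <= W ->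
  u = P * (a + b) -> v = P * (a' + b') ->
  W * `|a| <= 4 * p -> W * `|a'| <= 4 * p -> W * `|b| <= 4 * q -> W * `|b'| <= 4 * q ->
  (`|u| + `|v|) * W <= P * (8 * (p + q)).
Proof.
move=> P0 W0 -> -> G1 G2 H1 H2.
rewrite !normrM (ger0_norm P0) -mulrDr -mulrA ler_wpM2l// mulrC.
have h1 := ler_wpM2l W0 (ler_normD a b); have h2 := ler_wpM2l W0 (ler_normD a' b').
rewrite !mulrDr in h1 h2 *; lra.
Qed.

Lemma grad_norm_LwaveD_le (T t c : R) (G H : spacetime -> R) (x : R * R) :
  0 <= t < T -> 0 < c -> smooth T G -> smooth T H ->
  grad_norm (Lwave c (fun p => G p + H p)) (x, t) * (1 + `|enorm x - c * t|) <=
  (2 * pi)^-1 * (8 * (cap_mean c t x (frozen_norm t G) + cap_mean c t x (frozen_norm t H))).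
Proof.
move=> tT c0 sG sH.
have [E1 E2] := gradient_LwaveD x tT c0 sG sH.
have [G1 G2] := cap_gradient_le_mean x tT c0 sG.
have [H1 H2] := cap_gradient_le_mean x tT c0 sH.
have ip : 0 <= (2 * pi : R)^-1 by rewrite invr_ge0 mulr_ge0// pi_ge0.
have W0 : 0 <= 1 + `|enorm x - c * t| by rewrite addr_ge0.
apply: (@le_trans _ _ ((`|d1 (Lwave c (fun p => G p + H p)) (x, t)| +
  `|d2 (Lwave c (fun p => G p + H p)) (x, t)|) * (1 + `|enorm x - c * t|))).
  by rewrite ler_wpM2r//; exact: enorm_le_abs.
exact: (sum_norm_le ip W0 E1 E2 G1 G2 H1 H2).
Qed.

End final_bound.

Theorem proposition3p1 (R : realType) (m : nat) (c : nat -> R)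
    (hm : (1 <= m)%N) (hc0 : c 0%N = 0)
    (hc : forall j : nat, (j < m)%N -> c j < c j.+1)
    (mu nu rho : R) (hmu : 0 < mu) (hnu : 0 < nu) (hrho : 0 < rho) :
  exists Cmu Cnu Crho : R,
    [/\ 0 < Cmu, 0 < Cnu & 0 < Crho] /\
    forall T : R, 0 < T ->
    forall F G H : (R * R) * R -> R,
      smooth T F -> smooth T G -> smooth T H ->
    forall i : nat, (1 <= i <= m)%N ->
    forall (x : R * R) (t : R), 0 <= t < T ->
      `|Lwave (c i) F (x, t)| * Num.sqrt (1 + enorm x)
        <= Cmu * Mnorm c m T i mu 0 F (x, t)
      /\
      grad_norm (Lwave (c i) (fun p => G p + H p)) (x, t)
          * Num.sqrt (1 + enorm x) * (1 + `|enorm x - c i * t|)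
        <= Cnu * Mnorm c m T i nu 0 G (x, t)
           + Crho * (1 + ln (1 + t + enorm x)) * Mnorm c m T i 0 rho H (x, t).
Proof.
have mu2 : 0 < mu / 2 by rewrite divr_gt0.
have nu2 : 0 < nu / 2 by rewrite divr_gt0.
have pw0 (a : R) j : 0 <= (1 + c j) `^ a by exact: powR_ge0.
have c0 j : (j <= m)%N -> 0 <= c j by exact: (speed_ge0 hc0 hc).
have [Cm Cm0 Em] := cap_mean_le_Mnorm hc0 hc (ltW hmu) (lexx 0) (ltW mu2) mu2 (pw0 (mu / 2))
  (fun j s l jm s0 l0 => zweight_inv_le hmu (c0 j jm) s0 l0).
have [Cn Cn0 En] := cap_mean_le_Mnorm hc0 hc (ltW hnu) (lexx 0) (ltW nu2) nu2 (pw0 (nu / 2))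
  (fun j s l jm s0 l0 => zweight_inv_le hnu (c0 j jm) s0 l0).
have Z0 j s l : (j <= m)%N -> 0 <= s -> 0 <= l ->
    (zweight c j 0 rho l s)^-1 <= 1 * cone_weight 0 rho (c j) s l.
  by move=> _ s0 l0; rewrite mul1r zweight_inv_cone_weight.
have [Cr Cr0 Er] := cap_mean_le_Mnorm hc0 hc (lexx 0) (ltW hrho) (lexx 0) hrho
  (fun _ : nat => ler01) Z0.
have ip : 0 < (2 * pi : R)^-1 by rewrite invr_gt0 mulr_gt0// pi_gt0.
have Lm0 : 0 <= (mu / 2)^-1 by rewrite invr_ge0 ltW.
have Ln0 : 0 <= (nu / 2)^-1 by rewrite invr_ge0 ltW.
(* [(2 * pi)^-1] is the prefactor of [Lwave], [(mu / 2)^-1] and [(nu / 2)^-1] bound the time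
   integrals of the decays, and 8 comes from the gradient bound. For [H] the time integral is the
   logarithm, which stays in the estimate. *)
exists ((2 * pi)^-1 * (Cm * (1 + (mu / 2)^-1))),
  ((2 * pi)^-1 * (8 * (Cn * (1 + (nu / 2)^-1)))), ((2 * pi)^-1 * (8 * Cr)).
split.
  split; apply: mulr_gt0 => //.
  - by rewrite mulr_gt0// ltr_pwDl.
  - by rewrite mulr_gt0// mulr_gt0// ltr_pwDl.
  - by rewrite mulr_gt0.
move=> T T0 F G H sF sG sH i im x t tT.
have ci := speed_gt0 hc0 hc im; have t0 : 0 <= t by case/andP: tT.
have s0 : 0 <= Num.sqrt (1 + enorm x) by exact: sqrtr_ge0.
split.
  apply: le_trans (ler_wpM2r s0 (Lwave_le_cap_mean x tT ci sF)) _.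
  rewrite -!mulrA ler_wpM2l ?(ltW ip)// mulrA.
  exact: Em im tT sF Lm0 (integral_decay mu2 t0).
have x0 := enorm_ge0 x.
have lnt : ln (1 + t) <= ln (1 + t + enorm x) by rewrite ler_ln ?posrE; lra.
have ln0 : 0 <= ln (1 + t) by rewrite ln_ge0//; lra.
have bG := En _ _ _ x _ _ im tT sG Ln0 (integral_decay nu2 t0).
have bH := Er _ _ _ x _ _ im tT sH ln0 (integral_decay0 t0).
have MH := Mnorm_ge0 c m T i 0 rho H (x, t).
have {}bH : cap_mean (c i) t x (frozen_norm t H) * Num.sqrt (1 + enorm x) <=
    Cr * (1 + ln (1 + t + enorm x)) * Mnorm c m T i 0 rho H (x, t).
  by rewrite (le_trans bH)// ler_wpM2r// ler_wpM2l ?(ltW Cr0)// lerD2l.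
rewrite mulrAC; apply: le_trans (ler_wpM2r s0 (grad_norm_LwaveD_le x tT ci sG sH)) _.
rewrite -!mulrA -mulrDr ler_wpM2l ?(ltW ip)// -mulrDr ler_wpM2l// mulrDl.
by rewrite lerD// mulrA.
Qed.
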